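(* Let $(R,\mathfrak{m},k)$ be a commutative noetherian local Cohen--Macaulay ring with a dualizing module $\Omega$. The following assertions hold. (a) Every finitely generated $R$-module $M$ has a special $\mathsf{MCM}$-preenvelope. (b) If $R$ is henselian, then every finitely generated $R$-module has an $\mathsf{MCM}$-envelope. Moreover, every special $\mathsf{MCM}$-preenvelope (in particular, every $\mathsf{MCM}$-envelope) $\mu \colon M \to X$ of a finitely generated $R$-module $M$ has the property that the $R$-module $\operatorname{Hom}_R(\operatorname{Coker}\mu,\Omega)$ has finite injective dimension.
   Context: $R$ is a commutative noetherian local Cohen--Macaulay ring with maximal ideal $\mathfrak{m}$, residue field $k$, Krull dimension $d$, and a dualizing (canonical) module $\Omega$. For a finitely generated $R$-module $M$, $\operatorname{depth}_R M=\inf\{i \mid \operatorname{Ext}^i_R(k,M)\neq 0\}\in\mathbb{N}_0\cup\{\infty\}$. A finitely generated $R$-module $M$ is called maximal Cohen--Macaulay (maximal CM) if $\operatorname{depth}_R M\geqslant d$ (so the zero module is maximal CM). $\mathsf{MCM}$ denotes the full subcategory of maximal CM modules in the category $\mathsf{mod}$ of finitely generated $R$-modules. Let $M$ be a finitely generated $R$-module. An $\mathsf{MCM}$-preenvelope of $M$ is a homomorphism $\mu\colon M\to X$ with $X\in\mathsf{MCM}$ such that every homomorphism $\mu'\colon M\to X'$ with $X'\in\mathsf{MCM}$ factors through $\mu$, i.e. $\mu'=\varphi\mu$ for some $\varphi\colon X\to X'$. A special $\mathsf{MCM}$-preenvelope is an $\mathsf{MCM}$-preenvelope $\mu$ such that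 $\operatorname{Ext}^1_R(\operatorname{Coker}\mu,X')=0$ for every $X'\in\mathsf{MCM}$. An $\mathsf{MCM}$-envelope is an $\mathsf{MCM}$-preenvelope $\mu\colon M\to X$ such that every endomorphism $\varphi$ of $X$ with $\varphi\mu=\mu$ is an automorphism. *)

(* Defs.v *)
From HB Require Import structures.
From mathcomp Require Import all_boot all_order all_algebra.
From mathcomp Require Import boolp.

Set Implicit Arguments.
Unset Strict Implicit.
Unset Printing Implicit Defensive.

Import GRing.Theory.
Local Open Scope ring_scope.
Local Open Scope quotient_scope.

(* An ideal is a submodule of the regular module R^o; unlike [idealr R] (the
   proper ideals), this includes the unit ideal. *)
Definition noetherian (R : comNzRingType) : Prop :=
  forall I : submodClosed R^o, exists (n : nat) (x : 'I_n -> R^o),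
    forall y : R^o,
      y \in I <-> exists c : 'I_n -> R, y = \sum_(i < n) c i *: x i.

Definition maximal_ideal (R : comNzRingType) (I : idealr R) : Prop :=
  forall J : idealr R, {subset I <= J} -> J =i I.

Definition local_with (R : comNzRingType) (m : idealr R) : Prop :=
  maximal_ideal m /\ forall J : idealr R, maximal_ideal J -> J =i m.

(* Strict chains p 0 < p 1 < ... < p n; the values p i for i > n are
   irrelevant. *)
Definition prime_chain (R : comNzRingType) (n : nat) : Prop :=
  exists p : nat -> prime_idealr R,
    forall i, (i < n)%N ->
      {subset p i <= p i.+1} /\ ~ {subset p i.+1 <= p i}.

Definition krull_dim (R : comNzRingType) (d : nat) : Prop :=
  prime_chain R d /\ forall n, prime_chain R n -> (n <= d)%N.

(* A copy of the quotient ring R/m which is also an R-module. *)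
Definition residue (R : comNzRingType) (m : idealr R) : Type := {ideal_quot m}.

Section Residue.
Variables (R : comNzRingType) (m : idealr R).

HB.instance Definition _ := GRing.ComNzRing.on (residue m).

Definition to_residue (a : R) : residue m := \pi_({ideal_quot m}) a.

Fact to_residue_zmod : zmod_morphism to_residue.
Proof. exact: (pi_is_zmod_morphism {ideal_quot m}). Qed.
Fact to_residue_monoid : monoid_morphism to_residue.
Proof. exact: (pi_is_monoid_morphism {ideal_quot m}). Qed.
HB.instance Definition _ :=
  GRing.isZmodMorphism.Build R (residue m) to_residue to_residue_zmod.
HB.instance Definition _ :=
  GRing.isMonoidMorphism.Build R (residue m) to_residue to_residue_monoid.

Definition residue_scale (a : R) (x : residue m) : residue m :=
  to_residue a * x.

Fact residue_scaleA a b x :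
  residue_scale a (residue_scale b x) = residue_scale (a * b) x.
Proof. by rewrite /residue_scale rmorphM mulrA. Qed.
Fact residue_scale1 : left_id 1 residue_scale.
Proof. by move=> x; rewrite /residue_scale rmorph1 mul1r. Qed.
Fact residue_scaleDr : right_distributive residue_scale +%R.
Proof. by move=> a x y; rewrite /residue_scale mulrDr. Qed.
Fact residue_scaleDl x : {morph residue_scale^~ x : a b / a + b}.
Proof. by move=> a b; rewrite /residue_scale rmorphD mulrDl. Qed.
HB.instance Definition _ := GRing.Zmodule_isLmodule.Build R (residue m)
  residue_scaleA residue_scale1 residue_scaleDr residue_scaleDl.
End Residue.

(* Simple roots in R/m of monic polynomials over R lift to R. *)
Definition henselian (R : comNzRingType) (m : idealr R) : Prop :=
  local_with m /\
  forall (f : {poly R}) (a0 : residue m), f \is monic ->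
    let fbar := map_poly (@to_residue R m) f in
    fbar.[a0] = 0 -> fbar^`().[a0] != 0 ->
    exists a : R, f.[a] = 0 /\ to_residue m a = a0.

Definition LinHom (R : comNzRingType) (U V : lmodType R) : Type :=
  {linear U -> V}.

Section LinHom.
Variables (R : comNzRingType) (U V : lmodType R).

HB.instance Definition _ := gen_eqMixin (LinHom U V).
HB.instance Definition _ := gen_choiceMixin (LinHom U V).

Definition hom_fun (f : LinHom U V) : U -> V := (f : {linear U -> V}).

Fact hom_ext (f g : LinHom U V) : hom_fun f =1 hom_fun g -> f = g.
Proof.
case: f => f [[Hf1] [Hf2]]; case: g => g [[Hg1] [Hg2]] /= efg.
have {}efg : f = g by apply/funext.
case: _ / efg in Hg1 Hg2 *; congr GRing.Linear.Pack.
by congr GRing.Linear.Class; f_equal; apply: Prop_irrelevance.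
Qed.

Definition hom_zero : LinHom U V := (\0 : {linear U -> V}).
Definition hom_opp (f : LinHom U V) : LinHom U V := (\- hom_fun f : {linear U -> V}).
Definition hom_add (f g : LinHom U V) : LinHom U V :=
  (hom_fun f \+ hom_fun g : {linear U -> V}).
Definition hom_scale (a : R) (f : LinHom U V) : LinHom U V :=
  (a \*: hom_fun f : {linear U -> V}).

Fact hom_addA : associative hom_add.
Proof. by move=> f g h; apply: hom_ext => x; apply: addrA. Qed.
Fact hom_addC : commutative hom_add.
Proof. by move=> f g; apply: hom_ext => x; apply: addrC. Qed.
Fact hom_add0 : left_id hom_zero hom_add.
Proof. by move=> f; apply: hom_ext => x; apply: add0r. Qed.
Fact hom_addN : left_inverse hom_zero hom_opp hom_add.
Proof. by move=> f; apply: hom_ext => x; apply: addNr. Qed.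
HB.instance Definition _ :=
  GRing.isZmodule.Build (LinHom U V) hom_addA hom_addC hom_add0 hom_addN.

Fact hom_scaleA a b f : hom_scale a (hom_scale b f) = hom_scale (a * b) f.
Proof. by apply: hom_ext => x; apply: scalerA. Qed.
Fact hom_scale1 : left_id 1 hom_scale.
Proof. by move=> f; apply: hom_ext => x; apply: scale1r. Qed.
Fact hom_scaleDr : right_distributive hom_scale +%R.
Proof. by move=> a f g; apply: hom_ext => x; apply: scalerDr. Qed.
Fact hom_scaleDl f : {morph hom_scale^~ f : a b / a + b}.
Proof. by move=> a b; apply: hom_ext => x; apply: scalerDl. Qed.
HB.instance Definition _ := GRing.Zmodule_isLmodule.Build R (LinHom U V)
  hom_scaleA hom_scale1 hom_scaleDr hom_scaleDl.
End LinHom.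

Definition in_image (R : comNzRingType) (U V : lmodType R)
  (f : {linear U -> V}) : {pred V} := fun y => `[< exists x, f x = y >].

Section Cokernel.
Variables (R : comNzRingType) (U V : lmodType R) (f : {linear U -> V}).

Fact in_image_submod : submod_closed (in_image f).
Proof.
split=> [|a u v /asboolP[x <-] /asboolP[y <-]]; apply/asboolP.
  by exists 0; rewrite linear0.
by exists (a *: x + y); rewrite linearP.
Qed.
HB.instance Definition _ :=
  GRing.isSubmodClosed.Build R V (in_image f) in_image_submod.

Definition Cokernel : Type := Quotient.quot (in_image f).
HB.instance Definition _ := GRing.Zmodule.on Cokernel.

Definition to_coker (v : V) : Cokernel := \pi_(Quotient.quot (in_image f)) v.

Definition coker_scale (a : R) (x : Cokernel) : Cokernel :=
  to_coker (a *: repr (x : (Quotient.quot (in_image f)))).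

Fact to_coker_zmod : zmod_morphism to_coker.
Proof. exact: (pi_is_zmod_morphism (Quotient.quot (in_image f))). Qed.
HB.instance Definition _ :=
  GRing.isZmodMorphism.Build V Cokernel to_coker to_coker_zmod.

Fact to_cokerP (x : Cokernel) : exists v, x = to_coker v.
Proof. by exists (repr (x : (Quotient.quot (in_image f)))); rewrite /to_coker reprK. Qed.

Fact to_coker_scale a v : coker_scale a (to_coker v) = to_coker (a *: v).
Proof.
apply/eqP; rewrite /coker_scale /to_coker -Quotient.idealrBE -scalerBr.
by rewrite rpredZ // Quotient.idealrBE reprK.
Qed.

Fact coker_scaleA a b x : coker_scale a (coker_scale b x) = coker_scale (a * b) x.
Proof. by have [v ->] := to_cokerP x; rewrite !to_coker_scale scalerA. Qed.
Fact coker_scale1 : left_id 1 coker_scale.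
Proof. by move=> x; have [v ->] := to_cokerP x; rewrite to_coker_scale scale1r. Qed.
Fact coker_scaleDr : right_distributive coker_scale +%R.
Proof.
move=> a x y; have [v ->] := to_cokerP x; have [w ->] := to_cokerP y.
by rewrite -raddfD !to_coker_scale scalerDr raddfD.
Qed.
Fact coker_scaleDl x : {morph coker_scale^~ x : a b / a + b}.
Proof.
by move=> a b; have [v ->] := to_cokerP x; rewrite !to_coker_scale scalerDl raddfD.
Qed.
HB.instance Definition _ := GRing.Zmodule_isLmodule.Build R Cokernel
  coker_scaleA coker_scale1 coker_scaleDr coker_scaleDl.
End Cokernel.

Definition fin_gen (R : comNzRingType) (M : lmodType R) : Prop :=
  exists (n : nat) (x : 'I_n -> M),
    forall y : M, exists c : 'I_n -> R, y = \sum_(i < n) c i *: x i.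

Section Homological.
Variable R : comNzRingType.
Implicit Types A B C M N P I : lmodType R.

Definition surjective_map A B (f : {linear A -> B}) : Prop := forall y, exists x, f x = y.

Definition exact_at A B C (f : {linear A -> B}) (g : {linear B -> C}) : Prop :=
  forall y, g y = 0 <-> exists x, f x = y.

Definition projective P : Prop :=
  forall A B (g : {linear A -> B}) (h : {linear P -> B}), surjective_map g ->
    exists h' : {linear P -> A}, forall x, g (h' x) = h x.

Definition injective_module I : Prop :=
  forall A B (g : {linear A -> B}) (h : {linear A -> I}), injective g ->
    exists h' : {linear B -> I}, forall x, h' (g x) = h x.

(* ... -> P 2 -> P 1 -> P 0 -> M -> 0 *)
Record proj_resolution M := ProjResolution {
  pr_obj : nat -> lmodType R;
  pr_diff : forall i, {linear pr_obj i.+1 -> pr_obj i};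
  pr_aug : {linear pr_obj 0%N -> M};
  pr_projective : forall i, projective (pr_obj i);
  pr_surj : surjective_map pr_aug;
  pr_exact0 : exact_at (pr_diff 0%N) pr_aug;
  pr_exactS : forall i, exact_at (pr_diff i.+1) (pr_diff i)
}.

(* 0 -> N -> I 0 -> I 1 -> I 2 -> ... *)
Record inj_resolution N := InjResolution {
  ir_obj : nat -> lmodType R;
  ir_diff : forall i, {linear ir_obj i -> ir_obj i.+1};
  ir_aug : {linear N -> ir_obj 0%N};
  ir_injective : forall i, injective_module (ir_obj i);
  ir_inj : injective ir_aug;
  ir_exact0 : exact_at ir_aug (ir_diff 0%N);
  ir_exactS : forall i, exact_at (ir_diff i) (ir_diff i.+1)
}.

Definition finite_injdim N : Prop :=
  exists (I : inj_resolution N) (n : nat),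
    forall i, (n < i)%N -> forall x : ir_obj I i, x = 0.

Definition cocycle M N (P : proj_resolution M) (i : nat)
    (f : {linear pr_obj P i -> N}) : Prop :=
  forall x, f (pr_diff P i x) = 0.

Definition coboundary M N (P : proj_resolution M) (i : nat) :
    {linear pr_obj P i -> N} -> Prop :=
  match i with
  | 0%N => fun f => forall x, f x = 0
  | j.+1 => fun f => exists g : {linear pr_obj P j -> N},
      forall x, f x = g (pr_diff P j x)
  end.

(* Ext^i_R(M, N) = 0, where Ext^i_R(M, N) = H^i(Hom_R(P, N)) for a projective
   resolution P of M (all of which give the same cohomology). *)
Definition Ext_eq0 (i : nat) M N : Prop :=
  forall (P : proj_resolution M) (f : {linear pr_obj P i -> N}),
    cocycle f -> coboundary f.

Definition homothety M (a : R) : LinHom M M := a *: (idfun : LinHom M M).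

Definition dualizing (W : lmodType R) : Prop :=
  [/\ fin_gen W,
      finite_injdim W,
      forall i, (0 < i)%N -> Ext_eq0 i W W
    & bijective (@homothety W)].

(* inf {i | Ext^i_R(k, M) <> 0}, with [None] for the infimum of the empty set. *)
Definition depth (m : idealr R) M : option nat :=
  match pselect (exists i, `[< ~ Ext_eq0 i (residue m) M >]) with
  | left ex => Some (ex_minn ex)
  | right _ => None
  end.

Definition depth_ge (m : idealr R) M (d : nat) : Prop :=
  if depth m M is Some e then (d <= e)%N else True.

(* d is meant to be the Krull dimension of R. *)
Definition MCM (m : idealr R) (d : nat) M : Prop :=
  fin_gen M /\ depth_ge m M d.

Definition MCM_preenvelope (m : idealr R) (d : nat) (M X : lmodType R)
    (mu : {linear M -> X}) : Prop :=
  MCM m d X /\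
  forall (X' : lmodType R) (mu' : {linear M -> X'}), MCM m d X' ->
    exists phi : {linear X -> X'}, forall x, mu' x = phi (mu x).

Definition special_MCM_preenvelope (m : idealr R) (d : nat) (M X : lmodType R)
    (mu : {linear M -> X}) : Prop :=
  MCM_preenvelope m d mu /\
  forall X' : lmodType R, MCM m d X' -> Ext_eq0 1 (Cokernel mu) X'.

Definition MCM_envelope (m : idealr R) (d : nat) (M X : lmodType R)
    (mu : {linear M -> X}) : Prop :=
  MCM_preenvelope m d mu /\
  forall phi : {linear X -> X}, (forall x, phi (mu x) = mu x) -> bijective phi.

End Homological.

(* Main.v *)
From HB Require Import structures.
Require Import Defs.
From mathcomp Require Import all_boot all_order all_algebra.
From mathcomp Require Import boolp ring.
From mathcomp Require Import perm mpoly.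

Set Implicit Arguments.
Unset Strict Implicit.
Unset Printing Implicit Defensive.

Import GRing.Theory.
Local Open Scope ring_scope.

(** Proof idea.  Write [D^+] for [Hom(D, Omega)].

    If [D] has no element killed by the maximal ideal [(x_1, ..., x_n)], then
    [a |-> (x_1 a, ..., x_n a)] embeds [D] into [D^n] with a cokernel of depth
    one less, and multiplication by the [x_j] vanishes on [Ext(k, -)]; this
    embedding replaces regular elements throughout.  With Nakayama's lemma for
    Ext it gives [Ext^i(D, N) = 0] for [i > 0], [D] maximal CM and [N] finitely
    generated of finite injective dimension; it also gives depth [Omega >= d].
    Hence [D |-> D^+] is a duality on maximal CM modules, and every finitely
    generated module is the quotient of a maximal CM module by a module of
    finite injective dimension, by induction on the depth (Auslander and
    Buchweitz).

    For an approximation [0 -> I -> Y -> M^+ -> 0] the map [M -> M^++ -> Y^+]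
    is a preenvelope, and the dual of its cokernel [C] is [I].  For any
    preenvelope, [Ext^1(C, Omega) = 0], so that [Ext^1(C, D^+)] and
    [Ext^1(D, C^+)] vanish together.  Hence the preenvelope above is special,
    and for any special one [C^+] is a direct summand of a module of finite
    injective dimension, because its embedding with maximal CM cokernel splits.

    Over a henselian ring, a coprime factorization [t^a (t - 1)^b] modulo the
    maximal ideal lifts: by Lagrange interpolation at the elements
    [prod_(i in A) x_i], [#|A| = b], the coefficients of the generic factors
    become polynomials over the symmetric functions in a single element, which
    specializes to a simple root.  So an endomorphism fixing a preenvelope is
    either bijective or yields an idempotent killing it, and splitting off a
    maximal such idempotent leaves an envelope. *)

(** * Modules *)

Section Modules.
Variable R : comNzRingType.

(** Only the vanishing of Ext is given, as a statement about cocycles on every projective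
    resolution. No Ext module is formed: each exact segment is proved by correcting cocycles, with
    mapping cones for the first variable, and Nakayama's lemma is applied to cocycles modulo
    coboundaries. A single regular element of [m] would call for avoidance of associated primes; the
    embedding by all generators is injective as soon as [Hom(k, D) = 0], which is how depth is
    given. That [Ext^1(C, D^+)] and [Ext^1(D, C^+)] vanish together comes from reading a map
    [A -> Hom(B, Omega)] as a map [B -> Hom(A, Omega)]. An arbitrary envelope is shown to be special
    by Wakamatsu's argument. The henselian hypothesis lifts simple roots only; degree [b] factors of
    a generic polynomial correspond to sets of [b] of its roots, and the product of the roots in a
    set is 1 modulo the maximal ideal for one set and 0 for all others, which produces a simple
    root. *)

Definition mklin (U V : lmodType R) (f : U -> V) (lf : linear f) : {linear U -> V} :=
  HB.pack f (GRing.isLinear.Build R U V *:%R f lf).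

Lemma mklinE (U V : lmodType R) (f : U -> V) (lf : linear f) x : mklin lf x = f x.
Proof. by []. Qed.

Lemma lin_inj (U V : lmodType R) (f : {linear U -> V}) :
  (forall x, f x = 0 -> x = 0) -> injective f.
Proof.
by move=> f0 x y e; apply/eqP; rewrite -subr_eq0; apply/eqP/f0; rewrite linearB e subrr.
Qed.

Lemma lin_inj0 (U V : lmodType R) (f : {linear U -> V}) :
  injective f -> forall x, f x = 0 -> x = 0.
Proof. by move=> fi x e; apply: fi; rewrite e linear0. Qed.

Lemma factor_surj (B C D : lmodType R) (p : {linear B -> C}) (f : {linear B -> D}) :
  surjective_map p -> (forall b, p b = 0 -> f b = 0) ->
  exists f' : {linear C -> D}, forall b, f' (p b) = f b.
Proof.
move=> ps pf; have [s sP] := choice ps.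
have key b b' : p b = p b' -> f b = f b'.
  move=> e; apply/eqP; rewrite -subr_eq0 -linearB; apply/eqP/pf.
  by rewrite linearB e subrr.
have lf : linear (fun c => f (s c)).
  by move=> a u v /=; rewrite -linearP; apply: key; rewrite linearP !sP.
by exists (mklin lf) => b; rewrite mklinE; apply: key; rewrite sP.
Qed.

Lemma factor_inj (A B D : lmodType R) (i : {linear A -> B}) (f : {linear D -> B}) :
  injective i -> (forall d, exists a, i a = f d) ->
  exists f' : {linear D -> A}, forall d, i (f' d) = f d.
Proof.
move=> ii /choice[s sP].
have lf : linear s by move=> a u v /=; apply: ii; rewrite linearP !sP linearP.
by exists (mklin lf) => b; rewrite mklinE.
Qed.

Lemma bij_inv (A B : lmodType R) (f : {linear A -> B}) :
  injective f -> surjective_map f ->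
  exists g : {linear B -> A}, cancel f g /\ cancel g f.
Proof.
move=> fi fs; have [|g gP] := @factor_inj _ _ _ f (idfun : {linear B -> B}) fi.
  by move=> d; have [a <-] := fs d; exists a.
by exists g; split=> x; [apply: fi; rewrite gP | rewrite gP].
Qed.

Definition lmod_iso (A B : lmodType R) : Prop :=
  exists (f : {linear A -> B}) (g : {linear B -> A}), cancel f g /\ cancel g f.

Lemma bij_lmod_iso (A B : lmodType R) (f : {linear A -> B}) :
  injective f -> surjective_map f -> lmod_iso A B.
Proof. by move=> fi fs; have [g fg] := bij_inv fi fs; exists f, g. Qed.

Lemma lmod_iso_sym (A B : lmodType R) : lmod_iso A B -> lmod_iso B A.
Proof. by move=> [f [g [h k]]]; exists g, f. Qed.

(** Membership is [Prop]-valued, since kernels, images, annihilators and unions of chains are all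
    given by undecided statements. *)
Structure submod (M : lmodType R) := Submod {
  sm_car :> M -> Prop;
  sm_closed : submod_closed (fun x => `[< sm_car x >]) }.

Lemma sm0 M (S : submod M) : S 0.
Proof. by have [/asboolP] := sm_closed S. Qed.

Lemma smP M (S : submod M) a x y : S x -> S y -> S (a *: x + y).
Proof.
have [_ h] := sm_closed S; move=> sx sy.
by apply/asboolP; apply: h; apply/asboolP.
Qed.

Lemma smD M (S : submod M) x y : S x -> S y -> S (x + y).
Proof. by move=> sx sy; rewrite -[x]scale1r; apply: smP. Qed.

Lemma smZ M (S : submod M) a x : S x -> S (a *: x).
Proof. by move=> sx; rewrite -[_ *: _]addr0; apply: smP => //; apply: sm0. Qed.

Lemma smB M (S : submod M) x y : S x -> S y -> S (x - y).
Proof. by move=> sx sy; rewrite addrC -scaleN1r; apply: smP. Qed.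

Lemma sm_sum M (S : submod M) n (x : 'I_n -> M) :
  (forall i, S (x i)) -> S (\sum_i x i).
Proof. by move=> h; elim/big_ind: _ => //; [apply: sm0 | apply: smD]. Qed.

Definition mksub (M : lmodType R) (S : M -> Prop) (S0 : S 0)
  (SP : forall a x y, S x -> S y -> S (a *: x + y)) : submod M.
Proof.
exists S; split; first exact/asboolP.
by move=> a x y /asboolP sx /asboolP sy; apply/asboolP; apply: SP.
Defined.

Section SubT.
Variables (M : lmodType R) (S : submod M).
Definition sm_pred : {pred M} := fun x => `[< S x >].
HB.instance Definition _ := GRing.isSubmodClosed.Build R M sm_pred (sm_closed S).
Definition smT : Type := {x : M | x \in sm_pred}.
HB.instance Definition _ := SubChoice.on smT.
HB.instance Definition _ := [SubChoice_isSubLmodule of smT by <:].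
Definition sm_incl : {linear smT -> M} := (val : {linear smT -> M}).

Lemma sm_incl_inj : injective sm_incl.
Proof. exact: val_inj. Qed.

Lemma sm_inclP y : S y <-> exists x, sm_incl x = y.
Proof.
split=> [sy|[x <-]]; last by have /asboolP := valP x.
have h : y \in sm_pred by apply/asboolP.
by exists (exist _ y h).
Qed.
End SubT.

Definition ker_sub (A B : lmodType R) (f : {linear A -> B}) : submod A.
Proof.
apply: (@mksub A (fun x => f x = 0)); first exact: linear0.
by move=> a x y e e'; rewrite linearP e e' scaler0 addr0.
Defined.

Definition img_sub (A B : lmodType R) (f : {linear A -> B}) : submod B.
Proof.
apply: (@mksub B (fun y => exists x, f x = y)); first by exists 0; rewrite linear0.
by move=> a _ _ [x <-] [y <-]; exists (a *: x + y); rewrite linearP.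
Defined.

Lemma img_factor (A B : lmodType R) (f : {linear A -> B}) :
  exists (I : lmodType R) (p : {linear A -> I}) (i : {linear I -> B}),
    [/\ surjective_map p, injective i & forall x, i (p x) = f x].
Proof.
pose i := sm_incl (img_sub f); have ii : injective i := sm_incl_inj (S := img_sub f).
have [|p hp] := @factor_inj _ _ _ i f ii.
  by move=> d; apply/(sm_inclP (img_sub f)); exists d.
exists (smT (img_sub f)), p, i; split=> // y.
have [a ea] : img_sub f (i y) by apply/(sm_inclP (img_sub f)); exists y.
by exists a; apply: ii; rewrite hp.
Qed.

Definition Ker (A B : lmodType R) (f : {linear A -> B}) : lmodType R := smT (ker_sub f).
Definition ker_incl (A B : lmodType R) (f : {linear A -> B}) : {linear Ker f -> A} :=
  sm_incl (ker_sub f).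

Definition ses (A B C : lmodType R) (f : {linear A -> B}) (g : {linear B -> C}) :=
  [/\ injective f, exact_at f g & surjective_map g].

Lemma ker_ses (A B : lmodType R) (f : {linear A -> B}) :
  surjective_map f -> ses (ker_incl f) f.
Proof. by move=> fs; split=> // [|y]; [apply: sm_incl_inj | apply: (sm_inclP (ker_sub f))]. Qed.

Fact coker_sig (A B : lmodType R) (f : {linear A -> B}) :
  {q : {linear B -> Cokernel f} | forall x, q x = to_coker f x}.
Proof.
have l : linear (@to_coker R A B f).
  by move=> a u v; rewrite raddfD; congr (_ + _); rewrite -[LHS]to_coker_scale.
by exists (mklin l).
Qed.
Definition coker (A B : lmodType R) (f : {linear A -> B}) : {linear B -> Cokernel f} :=
  sval (coker_sig f).
Lemma cokerE (A B : lmodType R) (f : {linear A -> B}) x : coker f x = to_coker f x.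
Proof. exact: (svalP (coker_sig f)). Qed.

Lemma coker_surj (A B : lmodType R) (f : {linear A -> B}) : surjective_map (coker f).
Proof. by move=> y; have [v ->] := to_cokerP y; exists v; rewrite cokerE. Qed.

Lemma coker_exact (A B : lmodType R) (f : {linear A -> B}) : exact_at f (coker f).
Proof.
move=> y; have k : (coker f y == 0) = (y \in in_image f).
  by rewrite cokerE -[y in RHS]subr0 Quotient.idealrBE -[0 in LHS](raddf0 (@to_coker R A B f)).
by split=> [/eqP|h]; [|apply/eqP]; rewrite k; [move/asboolP | apply/asboolP].
Qed.

Lemma coker_ses (A B : lmodType R) (f : {linear A -> B}) :
  injective f -> ses f (coker f).
Proof. by move=> fi; split=> //; [apply: coker_exact | apply: coker_surj]. Qed.

Lemma ses0 (A B C : lmodType R) (f : {linear A -> B}) (g : {linear B -> C}) :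
  ses f g -> forall x, g (f x) = 0.
Proof. by move=> [_ e _] x; apply/e; exists x. Qed.

Definition pow (n : nat) (U : lmodType R) : lmodType R := {ffun 'I_n -> U}.

(** * Finite powers of a module *)

Section Pow.
Variables (n : nat) (U V : lmodType R).

Definition pin_fun (j : 'I_n) (u : U) : pow n U := [ffun k => if k == j then u else 0].
Fact pin_lin j : linear (pin_fun j).
Proof.
move=> a u v; apply/ffunP=> k; rewrite !ffunE.
by case: eqP => // _; rewrite scaler0 addr0.
Qed.
Definition pin j : {linear U -> pow n U} := mklin (pin_lin j).

Lemma pinE j u k : pin j u k = if k == j then u else 0.
Proof. by rewrite mklinE ffunE. Qed.

Fact ppr_lin (j : 'I_n) : linear (fun u : pow n U => u j).
Proof. by move=> a u v; rewrite !ffunE. Qed.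
Definition ppr j : {linear pow n U -> U} := mklin (ppr_lin j).

Lemma pow_dec (u : pow n U) : u = \sum_j pin j (u j).
Proof.
apply/ffunP=> k; rewrite sum_ffunE (bigD1 k) //= ffunE eqxx big1 ?addr0 //.
by move=> i ik; rewrite ffunE eq_sym (negPf ik).
Qed.

Fact ptup_lin (g : 'I_n -> {linear V -> U}) :
  linear (fun v => [ffun j => g j v] : pow n U).
Proof. by move=> a u v; apply/ffunP=> k; rewrite !ffunE linearP. Qed.
Definition ptup g : {linear V -> pow n U} := mklin (ptup_lin g).

Lemma ptupE g v j : ptup g v j = g j v.
Proof. by rewrite mklinE ffunE. Qed.

Fact psum_lin (g : 'I_n -> {linear U -> V}) :
  linear (fun u : pow n U => \sum_j g j (u j)).
Proof.
move=> a u v; rewrite scaler_sumr -big_split; apply: eq_bigr => j _.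
by rewrite !ffunE linearP.
Qed.
Definition psum g : {linear pow n U -> V} := mklin (psum_lin g).

Lemma psumE g u : psum g u = \sum_j g j (u j).
Proof. by []. Qed.

Lemma pow_linE (f : {linear pow n U -> V}) u : f u = \sum_j f (pin j (u j)).
Proof. by rewrite {1}[u]pow_dec linear_sum. Qed.
End Pow.

Definition pmap n (U V : lmodType R) (f : {linear U -> V}) : {linear pow n U -> pow n V} :=
  ptup (fun j => f \o ppr U j : {linear _ -> _}).

Lemma pmapE n (U V : lmodType R) (f : {linear U -> V}) u (j : 'I_n) : pmap n f u j = f (u j).
Proof. by rewrite ptupE. Qed.

Lemma pmap_exact n (A B C : lmodType R) (f : {linear A -> B}) (g : {linear B -> C}) :
  exact_at f g -> exact_at (pmap n f) (pmap n g).
Proof.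
move=> e y; split=> [/ffunP h|[x <-]]; last first.
  by apply/ffunP=> j; rewrite !pmapE ffunE; apply/e; exists (x j).
have h' j : exists x, f x = y j by apply/e; have := h j; rewrite pmapE ffunE.
have [s sP] := choice h'.
by exists [ffun j => s j]; apply/ffunP=> j; rewrite pmapE ffunE.
Qed.

Lemma pmap_surj n (A B : lmodType R) (f : {linear A -> B}) :
  surjective_map f -> surjective_map (pmap n f).
Proof.
move=> fs y; have h' j := fs (y j); have [s sP] := choice h'.
by exists [ffun j => s j]; apply/ffunP=> j; rewrite pmapE ffunE.
Qed.

Lemma pow_ses n (A B C : lmodType R) (f : {linear A -> B}) (g : {linear B -> C}) :
  ses f g -> ses (pmap n f) (pmap n g).
Proof.
move=> [fi e gs]; split; [|exact: pmap_exact|exact: pmap_surj].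
by move=> u v /ffunP h; apply/ffunP=> j; apply: fi; have := h j; rewrite !pmapE.
Qed.

(** When [x] generates the maximal ideal, the kernel consists of the elements killed by that
    ideal. *)
Definition pscale n (x : 'I_n -> R) (A : lmodType R) : {linear A -> pow n A} :=
  ptup (fun j => x j \*: (idfun : {linear A -> A}) : {linear _ -> _}).

Lemma pscaleE n (x : 'I_n -> R) (A : lmodType R) a j : pscale x A a j = x j *: a.
Proof. by rewrite ptupE. Qed.

Definition comb n (M : lmodType R) (x : 'I_n -> M) : {linear pow n R^o -> M} :=
  psum (fun j => mklin (fun a (u v : R^o) => 
     etrans (scalerDl (x j) (a *: u) v) (congr1 (+%R^~ (v *: x j)) (esym (scalerA a u (x j)))))).

Lemma combE n (M : lmodType R) (x : 'I_n -> M) c : comb x c = \sum_i c i *: x i.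
Proof. by []. Qed.

Lemma fin_genP (M : lmodType R) :
  fin_gen M <-> exists n (p : {linear pow n R^o -> M}), surjective_map p.
Proof.
split=> [[n [x h]]|[n [p ps]]].
  exists n, (comb x) => y; have [c ->] := h y; exists [ffun i => c i].
  by rewrite combE; apply: eq_bigr => i _; rewrite ffunE.
exists n, (fun j => p (pin R^o j 1)) => y; have [u <-] := ps y; exists u.
rewrite pow_linE; apply: eq_bigr => i _; rewrite -!linearZ; congr (p (pin _ i _)).
by rewrite /GRing.scale /= mulr1.
Qed.

Lemma fg_surj (A B : lmodType R) (f : {linear A -> B}) :
  surjective_map f -> fin_gen A -> fin_gen B.
Proof.
move=> fs /fin_genP[n [p ps]]; apply/fin_genP; exists n, (f \o p) => y.
by have [a <-] := fs y; have [u <-] := ps a; exists u.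
Qed.

Lemma fg_iso (A B : lmodType R) : lmod_iso A B -> fin_gen A -> fin_gen B.
Proof. by move=> [f [g [fg gf]]]; apply: (@fg_surj _ _ f) => y; exists (g y). Qed.

Lemma fg_pow1 n : fin_gen (pow n R^o).
Proof. by apply/fin_genP; exists n, idfun => y; exists y. Qed.

Lemma fg_ext (A B C : lmodType R) (f : {linear A -> B}) (g : {linear B -> C}) :
  ses f g -> fin_gen A -> fin_gen C -> fin_gen B.
Proof.
move=> [_ e gs] [n [x hx]] [k [z hz]].
have [y yP] := choice (fun i => gs (z i)).
exists (n + k)%N, (fun i => match split i with inl i => f (x i) | inr i => y i end) => b.
have [c ec] := hz (g b).
have /e[a ea] : g (b - \sum_i c i *: y i) = 0.
  rewrite linearB linear_sum ec -sumrB big1 // => i _.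
  by rewrite linearZ yP subrr.
have [c' ec'] := hx a.
exists (fun i => match split i with inl i => c' i | inr i => c i end).
rewrite big_split_ord /=.
under eq_bigr => i _ do rewrite (unsplitK (inl i)).
under [X in _ = _ + X]eq_bigr => i _ do rewrite (unsplitK (inr i)).
rewrite -[b](subrK (\sum_i c i *: y i)) -ea ec' linear_sum; congr (_ + _).
by apply: eq_bigr => i _; rewrite linearZ.
Qed.

Lemma fg_prod (A B : lmodType R) : fin_gen A -> fin_gen B -> fin_gen (A * B)%type.
Proof.
have l1 : linear (fun a : A => (a, 0 : B)).
  by move=> a u v; congr pair; rewrite /= ?scaler0 ?addr0.
apply: (@fg_ext _ _ _ (mklin l1) (@snd A B : {linear _ -> _})).
split=> [x y []//||y]; last by exists (0, y).
by move=> [a b]; split=> [/= ->|[x <-]//]; exists a.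
Qed.

Lemma fg_pow n (U : lmodType R) : fin_gen U -> fin_gen (pow n U).
Proof.
move=> fU; elim: n => [|n IH].
  exists 0%N, (fun i => 0) => y; exists (fun i => 0); rewrite big_ord0.
  by apply/ffunP=> -[].
pose f (u : U * pow n U) : pow n.+1 U :=
  [ffun i => match unlift ord0 i with None => u.1 | Some j => u.2 j end].
have lf : linear f.
  move=> a u v; apply/ffunP=> i; rewrite !ffunE.
  by case: unliftP => [j _|_] //=; rewrite !ffunE.
apply: (@fg_surj _ _ (mklin lf)) (fg_prod fU IH) => y.
exists (y ord0, [ffun j => y (lift ord0 j)]); apply/ffunP=> i; rewrite mklinE ffunE.
by case: unliftP => [j ->|->] //=; rewrite ffunE.
Qed.

Definition fgp (M : lmodType R) (S : M -> Prop) :=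
  exists n (x : 'I_n -> M), forall y, S y <-> exists c : 'I_n -> R, y = \sum_i c i *: x i.

Lemma noeth_R (S : submod R^o) : noetherian R -> fgp S.
Proof.
move=> /(_ (sm_pred S : submodClosed R^o))[n [x h]]; exists n, x => y.
by rewrite -h; split=> [?|/asboolP//]; apply/asboolP.
Qed.
End Modules.

(** * Noetherian and local rings *)

Section Noetherian.
Variable R : comNzRingType.
Hypothesis nR : noetherian R.

(** Induction on the number of generators: [T] is generated by lifts [z] of generators of the ideal
    [I] of last coefficients, together with generators of the part [T'] written without the last
    generator. *)
Lemma fg_sub_fgp (M : lmodType R) : fin_gen M -> forall S : submod M, fgp S.
Proof.
move=> [n [x hx]].
(* Extending the generators by zero to all of [nat] makes dropping the last one a mere change of the
   bound. *)
pose x' i := if insub i is Some j then x j else 0.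
have {hx} : forall y : M, exists c : nat -> R, y = \sum_(i < n) c i *: x' i.
  move=> y; have [c ->] := hx y; exists (fun i => if insub i is Some j then c j else 0).
  by apply: eq_bigr => i _; rewrite /x' valK.
move: x' => {}x hx S.
suff gen k (T : submod M) :
    (forall y, T y -> exists c : nat -> R, y = \sum_(i < k) c i *: x i) -> fgp T.
  exact: (gen n) => y _; apply: hx.
elim: k T => [|k IH] T hT.
  exists 0%N, (fun _ => 0) => y; split=> [/hT[c ->]|[c ->]].
    by exists (fun _ => 0); rewrite !big_ord0.
  by rewrite big_ord0; apply: sm0.
pose I (a : R^o) := exists c : nat -> R, T (\sum_(i < k) c i *: x i + (a : R) *: x k).
have I0 : I 0.
  exists (fun _ => 0); rewrite scale0r addr0 big1 => [|i _]; [exact: sm0 | exact: scale0r].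
have IP a u v : I u -> I v -> I (a *: u + v).
  move=> [c hc] [c' hc']; exists (fun i => a * c i + c' i).
  have := smP a hc hc'; congr (T _); rewrite scalerDr addrACA; congr (_ + _).
    rewrite scaler_sumr -big_split; apply: eq_bigr => i _.
    by rewrite scalerDl scalerA.
  by rewrite scalerA -scalerDl.
have [p [a ha]] := noeth_R (mksub I0 IP) nR.
have Ia j : I (a j).
  apply/ha; exists (fun i => (i == j)%:R).
  rewrite (bigD1 j) //= eqxx scale1r big1 ?addr0 // => i /negPf->; exact: scale0r.
have [c hc] := choice Ia.
pose z j := \sum_(i < k) c j i *: x i + (a j : R) *: x k.
pose T' y := T y /\ exists c : nat -> R, y = \sum_(i < k) c i *: x i.
have T'0 : T' 0.
  split; first exact: sm0.
  by exists (fun _ => 0); rewrite big1 // => i _; rewrite scale0r.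
have T'P b u v : T' u -> T' v -> T' (b *: u + v).
  move=> [Tu [cu eu]] [Tv [cv ev]]; split; first exact: smP.
  exists (fun i => b * cu i + cv i); rewrite eu ev scaler_sumr -big_split.
  by apply: eq_bigr => i _; rewrite scalerDl scalerA.
have [q [w hw]] : fgp (mksub T'0 T'P) by apply: IH => y [].
have Tw j : T (w j).
  suff : T' (w j) by case.
  apply/hw; exists (fun i => (i == j)%:R).
  rewrite (bigD1 j) //= eqxx scale1r big1 ?addr0 // => i /negPf->; exact: scale0r.
exists (p + q)%N, (fun i => match split i with inl i => z i | inr i => w i end) => y.
split=> [Ty|[e ->]]; last first.
  by apply: sm_sum => i; apply: smZ; case: split => // j; apply: hc.
have [d ed] := hT y Ty; move: ed; rewrite big_ord_recr /= => ed.
have /ha[e ee] : I (d k) by exists d; rewrite -ed.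
have /hw[g eg] : T' (y - \sum_j e j *: z j).
  split; first by apply: smB => //; apply: sm_sum => j; apply: smZ; apply: hc.
  exists (fun i => d i - \sum_j e j * c j i).
  have -> : \sum_j e j *: z j =
      \sum_(i < k) (\sum_j e j * c j i) *: x i + d k *: x k.
    rewrite [d k]ee scaler_suml (eq_bigr _ (fun j _ => scalerDr _ _ _)) big_split /=.
    congr (_ + _); last by apply: eq_bigr => j _; rewrite scalerA.
    under eq_bigr => j _ do rewrite scaler_sumr.
    rewrite exchange_big /=; apply: eq_bigr => i _; rewrite scaler_suml.
    by apply: eq_bigr => j _; rewrite scalerA.
  rewrite ed opprD addrACA subrr addr0 -sumrB; apply: eq_bigr => i _.
  by rewrite scalerBl.
exists (fun i => match split i with inl i => e i | inr i => g i end).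
rewrite big_split_ord /=.
under eq_bigr => i _ do rewrite (unsplitK (inl i)).
under [X in _ = _ + X]eq_bigr => i _ do rewrite (unsplitK (inr i)).
by rewrite -eg addrC subrK.
Qed.

Lemma fg_inj (A B : lmodType R) (i : {linear A -> B}) :
  injective i -> fin_gen B -> fin_gen A.
Proof.
move=> ii fB; have [n [x hx]] := fg_sub_fgp fB (img_sub i).
have hh j : img_sub i (x j).
  apply/hx; exists (fun i => (i == j)%:R).
  rewrite (bigD1 j) //= eqxx scale1r big1 ?addr0 // => k /negPf->; exact: scale0r.
have [z hz] := choice hh; exists n, z => y.
have /hx[c ec] : img_sub i (i y) by exists y.
exists c; apply: ii; rewrite ec linear_sum; apply: eq_bigr => j _.
by rewrite linearZ hz.
Qed.

(** Without a maximal member, choice yields a strictly ascending chain in [F]; its union is finitely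
    generated, hence reached at a finite stage. *)
Lemma max_submod (M : lmodType R) (F : submod M -> Prop) (S0 : submod M) :
  fin_gen M -> F S0 ->
  exists S, F S /\ forall T, F T -> (forall x, S x -> T x) -> forall x, T x -> S x.
Proof.
move=> fM F0; apply: contrapT => nex.
have nxt (S : {S | F S}) :
    exists T : {S | F S}, (forall x, sval S x -> sval T x) /\
      exists2 x, sval T x & ~ sval S x.
  apply: contrapT => nT; apply: nex; exists (sval S); split; first exact: svalP.
  move=> T FT ST x Tx; apply: contrapT => nSx; apply: nT.
  by exists (exist _ T FT); split=> //=; exists x.
have [f fP] := choice nxt.
pose s n := iter n f (exist _ S0 F0).
have s1 n x : sval (s n) x -> sval (s n.+1) x by apply: (fP (s n)).1.
have smon n k x : sval (s n) x -> sval (s (n + k)%N) x.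
  by elim: k => [|k IH]; rewrite ?addn0 // addnS => /IH; apply: s1.
pose U x := exists n, sval (s n) x.
have U0 : U 0 by exists 0%N; apply: sm0.
have UP a x y : U x -> U y -> U (a *: x + y).
  move=> [n hx] [k hy]; exists (n + k)%N; apply: smP; first exact: smon.
  by rewrite addnC; apply: smon.
have [n [x hx]] := fg_sub_fgp fM (mksub U0 UP).
have hh j : U (x j).
  apply/hx; exists (fun i => (i == j)%:R).
  rewrite (bigD1 j) //= eqxx scale1r big1 ?addr0 // => k /negPf->; exact: scale0r.
(* The sum of the stages at which the generators appear bounds each of them. *)
have [N hN] := choice hh; pose m := (\sum_j N j)%N.
have [_ [y ys1 ys]] := fP (s m); apply: ys.
have /hx[c ->] : U y by exists m.+1.
apply: sm_sum => i; apply: smZ.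
have -> : m = (N i + \sum_(j | j != i) N j)%N by rewrite /m (bigD1 i).
exact/smon/hN.
Qed.

(** Take the largest [ker f^n]. An element of [ker f] is some [f^n y], and [y] lies in
    [ker f^(n+1)], which is [ker f^n]. *)
Lemma surj_inj (M : lmodType R) (f : {linear M -> M}) :
  fin_gen M -> surjective_map f -> injective f.
Proof.
move=> fM fs.
have itl n : linear (iter n f).
  by elim: n => [//|n IH] a u v /=; rewrite IH linearP.
pose F (S : submod M) := exists n, forall x, S x <-> iter n f x = 0.
have [|S [[n hn] hS]] := @max_submod M F (ker_sub (mklin (itl 0%N))) fM.
  by exists 0%N.
apply: lin_inj => x fx.
have its k : forall y, exists z, iter k f z = y.
  elim: k => [|k IH] y; first by exists y.
  by have [z <-] := fs y; have [w <-] := IH z; exists w.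
have [y ey] := its n x.
rewrite -ey; apply/hn; apply: (hS (ker_sub (mklin (itl n.+1)))).
- by exists n.+1.
- by move=> z /hn hz; rewrite /ker_sub /= /mklin /= hz linear0.
- by rewrite /ker_sub /= ey.
Qed.
End Noetherian.

(** * Units, generators of the maximal ideal and Nakayama's lemma *)

Section Local.
Variables (R : comNzRingType) (m : idealr R).
Hypothesis (nR : noetherian R) (lR : local_with m).

(** Otherwise an ideal maximal among those containing [a] but not 1 is a maximal ideal, hence equal
    to [m], although it contains [a]. *)
Lemma local_unit a : a \notin m -> exists b, a * b = 1.
Proof.
move=> am; apply: contrapT => nu.
have Ra0 : exists b, a * b = 0 by exists 0; rewrite mulr0.
pose Ra := @mksub R R^o (fun x => exists b, a * b = x) Ra0.
have RaP c x y : (exists b, a * b = x) -> (exists b, a * b = y) ->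
    exists b, a * b = c *: (x : R^o) + (y : R^o).
  move=> [b <-] [b' <-]; exists (c * b + b').
  by rewrite /GRing.scale /= mulrDr mulrCA.
have fR : fin_gen R^o.
  exists 1%N, (fun _ => 1) => y; exists (fun _ => y).
  by rewrite big_ord1 /GRing.scale /= mulr1.
pose F (S : submod R^o) := S a /\ ~ S 1.
have [|S [[Sa S1] hS]] := @max_submod R nR R^o F (Ra RaP) fR.
  by split; [exists 1; rewrite mulr1 | move=> e; apply: nu].
have cl : idealr_closed (sm_pred S).
  split; first exact/asboolP/sm0; first exact/asboolP.
  by move=> c u v /asboolP hu /asboolP hv; apply/asboolP; apply: smP.
pose J : idealr R := HB.pack (sm_pred S) (isIdealr.Build R (sm_pred S) cl).
have Jm : maximal_ideal J.
  move=> K JK x; apply/idP/idP=> [xK|]; last exact: JK.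
  have K0 : 0 \in K by exact: rpred0.
  have KP c u v : u \in K -> v \in K -> c *: (u : R^o) + (v : R^o) \in K.
    by move=> hu hv; apply: rpredD => //; apply: idealMr.
  apply/asboolP; apply: (hS (@mksub R R^o (fun x => x \in K) K0 KP)) => //.
    split; first by apply: JK; apply/asboolP.
    by rewrite /= idealr1.
  by move=> y Sy; apply: JK; apply/asboolP.
by move: am; rewrite -(lR.2 J Jm) => /negP; apply; apply/asboolP.
Qed.

Lemma to_residue_eq0 a : (to_residue m a = 0) <-> a \in m.
Proof.
have k : (to_residue m a == 0) = (a \in m).
  by rewrite -[a in RHS]subr0 Quotient.idealrBE -[0 in LHS](raddf0 (@to_residue R m)).
by split=> [/eqP|h]; [|apply/eqP]; rewrite k.
Qed.

Lemma to_residue_surj (x : residue m) : exists a, to_residue m a = x.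
Proof. by exists (repr (x : {ideal_quot m})); rewrite /to_residue reprK. Qed.

Lemma ideal_gens : exists n (x : 'I_n -> R), (forall i, x i \in m) /\
  forall a, a \in m -> exists c : 'I_n -> R, a = \sum_i c i * x i.
Proof.
have m0 : (0 : R^o) \in m by exact: rpred0.
have mP c u v : u \in m -> v \in m -> c *: (u : R^o) + (v : R^o) \in m.
  by move=> hu hv; apply: rpredD => //; apply: idealMr.
have [n [x hx]] := noeth_R (@mksub R R^o (fun x => x \in m) m0 mP) nR.
exists n, x; split=> [j|a am]; last by have /hx[c ->] := am; exists c.
apply/hx; exists (fun i => (i == j)%:R).
rewrite (bigD1 j) //= eqxx scale1r big1 ?addr0 // => k /negPf->; exact: scale0r.
Qed.

Definition in_mM (M : lmodType R) (t : M) :=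
  exists n (c : 'I_n -> R) (y : 'I_n -> M), (forall i, c i \in m) /\ t = \sum_i c i *: y i.

Lemma in_mMP (M : lmodType R) n (x : 'I_n -> M) (t : M) :
  (forall y, exists c : 'I_n -> R, y = \sum_i c i *: x i) -> in_mM t ->
  exists c : 'I_n -> R, (forall i, c i \in m) /\ t = \sum_i c i *: x i.
Proof.
move=> hx [k [c [y [hc ->]]]].
have [d hd] := choice (fun i => hx (y i)).
exists (fun j => \sum_i c i * d i j); split=> [j|].
  by apply: rpred_sum => i _; rewrite mulrC; apply: idealMr.
under eq_bigr => i _ do rewrite hd scaler_sumr.
rewrite exchange_big; apply: eq_bigr => j _; rewrite scaler_suml.
by apply: eq_bigr => i _; rewrite scalerA.
Qed.

(** Determinant trick modulo [S]: the generators satisfy [(1 - A) x = 0] modulo [S] with the entries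
    of [A] in [m], so [det (1 - A)] carries every [x_i] into [S]; it reduces to 1, so it is a
    unit. *)
Lemma nakayama (M : lmodType R) (S : submod M) : fin_gen M ->
  (forall y, exists s t, [/\ S s, in_mM t & y = s + t]) -> forall y, S y.
Proof.
move=> [n [x hx]] hS.
have h i : exists c : 'I_n -> R, (forall j, c j \in m) /\
    S (x i - \sum_j c j *: x j).
  have [s [t [Ss /(in_mMP hx)[c [cm ->]] ->]]] := hS (x i).
  by exists c; rewrite addrK.
have [A hA] := choice h.
pose B : 'M[R]_n := 1%:M - \matrix_(i, j) A i j.
have SB i : S (\sum_j B i j *: x j).
  have [_ hi] := hA i; congr (S _): hi.
  have e : x i = \sum_j (1%:M : 'M[R]_n) i j *: x j.
    rewrite (bigD1 i) //= mxE eqxx scale1r big1 ?addr0 // => j ij.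
    by rewrite mxE eq_sym (negPf ij) scale0r.
  rewrite {1}e -sumrB; apply: eq_bigr => j _.
  by rewrite -scalerBl !mxE.
have Sd i : S (\det B *: x i).
  have := @sm_sum R M S n (fun k => \adj B i k *: (\sum_j B k j *: x j)).
  move=> /(_ (fun k => smZ _ (SB k))); congr (S _).
  under eq_bigr => k _ do rewrite scaler_sumr.
  rewrite exchange_big (bigD1 i) //= [X in _ + X]big1 => [|j ji].
    rewrite addr0 (eq_bigr (fun k => (\adj B i k * B k i) *: x i)); last first.
      by move=> k _; rewrite scalerA.
    rewrite -scaler_suml; congr (_ *: _).
    by have := congr1 (fun X : 'M_n => X i i) (mul_adj_mx B); rewrite !mxE eqxx mulr1n.
  rewrite (eq_bigr (fun k => (\adj B i k * B k j) *: x j)); last first.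
    by move=> k _; rewrite scalerA.
  rewrite -scaler_suml.
  have := congr1 (fun X : 'M_n => X i j) (mul_adj_mx B); rewrite !mxE => ->.
  by rewrite eq_sym (negPf ji) mulr0n scale0r.
have [|b db] := @local_unit (\det B).
  apply/negP => /to_residue_eq0; rewrite -det_map_mx.
  have -> : map_mx (@to_residue R m) B = 1%:M.
    apply/matrixP=> i j; rewrite !mxE rmorphB /=.
    have [Aij _] := hA i; have /to_residue_eq0 -> := Aij j.
    by rewrite subr0 rmorph_nat.
  by rewrite det1; apply/eqP; apply: oner_neq0.
move=> y; have [c ->] := hx y; apply: sm_sum => i; apply: smZ.
by have := smZ b (Sd i); rewrite scalerA mulrC db scale1r.
Qed.
End Local.

(** * Projective resolutions and mapping cones *)

Section Projective.
Variable R : comNzRingType.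

(** Projectivity, applied after restricting codomains to the image of [g]; this is the form that
    lifts along differentials, which are not onto. *)
Lemma proj_lift (P A B : lmodType R) (g : {linear A -> B}) (f : {linear P -> B}) :
  projective P -> (forall p, exists a, g a = f p) ->
  exists h : {linear P -> A}, forall p, g (h p) = f p.
Proof.
move=> pP hf; pose j := sm_incl (img_sub g).
have [|g' hg'] := @factor_inj _ _ _ _ j g (sm_incl_inj (S := img_sub g)).
  by move=> d; apply/(sm_inclP (img_sub g)); exists d.
have [|f' hf'] := @factor_inj _ _ _ _ j f (sm_incl_inj (S := img_sub g)).
  by move=> d; apply/(sm_inclP (img_sub g)); apply: hf.
have [|h hh] := pP _ _ g' f'.
  move=> y; have [a ea] : img_sub g (j y) by apply/(sm_inclP (img_sub g)); exists y.
  by exists a; apply: (@sm_incl_inj _ _ (img_sub g)); rewrite -/j hg'.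
by exists h => p; rewrite -hg' hh hf'.
Qed.

Lemma proj_R : projective (R^o : lmodType R).
Proof.
move=> A B g h /(_ (h 1))[a ea].
have la : linear (fun r : R^o => (r : R) *: a).
  by move=> c u v; rewrite scalerDl scalerA.
exists (mklin la) => x; rewrite mklinE linearZ ea -linearZ; congr (h _).
by rewrite /GRing.scale /= mulr1.
Qed.

Lemma proj_pow n (P : lmodType R) : projective P -> projective (pow n P).
Proof.
move=> pP A B g h gs.
have hj (j : 'I_n) : exists h' : {linear P -> A}, forall x, g (h' x) = (h \o pin P j) x.
  exact: (pP _ _ g (h \o pin P j)).
have [h' hh'] := choice hj.
exists (psum h') => x; rewrite psumE linear_sum [RHS]pow_linE.
by apply: eq_bigr => j _; rewrite hh'.
Qed.

Lemma prod_dec (A B C : lmodType R) (f : {linear (A * B)%type -> C}) x :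
  f x = f (x.1, 0) + f (0, x.2).
Proof.
rewrite -linearD; congr (f _); rewrite [x in LHS]surjective_pairing.
by rewrite [RHS]/GRing.add /= /add_pair /= addr0 add0r.
Qed.

Fact inl_lin (A B : lmodType R) : linear (fun a : A => (a, 0 : B)).
Proof. by move=> a u v; congr pair; rewrite /= ?scaler0 ?addr0. Qed.
Fact inr_lin (A B : lmodType R) : linear (fun b : B => (0 : A, b)).
Proof. by move=> a u v; congr pair; rewrite /= ?scaler0 ?addr0. Qed.
Definition linl (A B : lmodType R) : {linear A -> (A * B)%type} := mklin (@inl_lin A B).
Definition linr (A B : lmodType R) : {linear B -> (A * B)%type} := mklin (@inr_lin A B).

Fact cpair_lin (A B C : lmodType R) (f : {linear A -> C}) (g : {linear B -> C}) :
  linear (fun x : (A * B)%type => f x.1 + g x.2).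
Proof. by move=> a u v; rewrite /= !linearP scalerDr addrACA. Qed.
Definition cpair (A B C : lmodType R) (f : {linear A -> C}) (g : {linear B -> C}) :
  {linear (A * B)%type -> C} := mklin (cpair_lin f g).

Fact dpair_lin (A B C : lmodType R) (f : {linear C -> A}) (g : {linear C -> B}) :
  linear (fun x => (f x, g x)).
Proof. by move=> a u v; rewrite /= !linearP. Qed.
Definition dpair (A B C : lmodType R) (f : {linear C -> A}) (g : {linear C -> B}) :
  {linear C -> (A * B)%type} := mklin (dpair_lin f g).

Lemma proj_prod (P Q : lmodType R) : projective P -> projective Q ->
  projective (P * Q)%type.
Proof.
move=> pP pQ A B g h gs.
have [f1 h1] := pP _ _ g (h \o @linl P Q : {linear _ -> _}) gs.
have [f2 h2] := pQ _ _ g (h \o @linr P Q : {linear _ -> _}) gs.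
by exists (cpair f1 f2) => x; rewrite mklinE linearD h1 h2 [RHS]prod_dec.
Qed.
End Projective.

Section Ext.
Variable R : comNzRingType.
Implicit Types A B C M N : lmodType R.

Definition ext_res A (P : proj_resolution A) i N :=
  forall f : {linear pr_obj P i -> N}, cocycle f -> coboundary f.

Lemma pr_dd A (P : proj_resolution A) i x : pr_diff P i (pr_diff P i.+1 x) = 0.
Proof. by apply/pr_exactS; exists x. Qed.

Lemma pr_ad A (P : proj_resolution A) x : pr_aug P (pr_diff P 0 x) = 0.
Proof. by apply/pr_exact0; exists x. Qed.

Lemma pr_factor A (P : proj_resolution A) N (f : {linear pr_obj P 0 -> N}) :
  cocycle f -> exists g : {linear A -> N}, forall x, g (pr_aug P x) = f x.
Proof.
move=> cf; apply: factor_surj; first exact: pr_surj.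
by move=> b /pr_exact0[x <-].
Qed.

(* The map "multiplication by x" on P is null-homotopic up to s0 o aug; only
   the effect on cocycles matters. *)
Lemma scaled_coboundary A (P : proj_resolution A) (x : R) (s0 : {linear A -> pr_obj P 0}) :
  (forall a, pr_aug P (s0 a) = x *: a) ->
  forall i N (f : {linear pr_obj P i.+1 -> N}), cocycle f ->
  exists g : {linear pr_obj P i -> N}, forall q, x *: f q = g (pr_diff P i q).
Proof.
move=> hs0.
have hs i : exists s : {linear pr_obj P i -> pr_obj P i.+1},
    forall y, pr_diff P i (s (pr_diff P i y)) = x *: pr_diff P i y.
  elim: i => [|i [s IH]].
    pose f : {linear pr_obj P 0 -> pr_obj P 0} :=
      (x \*: (idfun : {linear _ -> _})) \- (s0 \o pr_aug P).
    have [|s hs] := @proj_lift _ _ _ _ (pr_diff P 0) f (@pr_projective _ _ P 0).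
      by move=> p; apply/pr_exact0; rewrite linearB linearZ /= hs0 subrr.
    by exists s => y; rewrite hs /= pr_ad linear0 subr0.
  pose f : {linear pr_obj P i.+1 -> pr_obj P i.+1} :=
    (x \*: (idfun : {linear _ -> _})) \- (s \o pr_diff P i).
  have [|s' hs'] := @proj_lift _ _ _ _ (pr_diff P i.+1) f (@pr_projective _ _ P i.+1).
    by move=> p; apply/pr_exactS; rewrite linearB linearZ /= IH subrr.
  by exists s' => y; rewrite hs' /= pr_dd linear0 subr0.
move=> i N f cf; have [s hs'] := hs i.
exists (f \o s) => q.
have [z hz] : exists z, pr_diff P i.+1 z = x *: q - s (pr_diff P i q).
  by apply/pr_exactS; rewrite linearB linearZ /= hs' subrr.
by apply/eqP; rewrite -subr_eq0 -linearZ -linearB /= -hz; apply/eqP/cf.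
Qed.

Lemma chain_lift A' A (u : {linear A' -> A}) (P' : proj_resolution A') (P : proj_resolution A) :
  exists a : forall i, {linear pr_obj P' i -> pr_obj P i},
    (forall x, pr_aug P (a 0%N x) = u (pr_aug P' x)) /\
    (forall i x, pr_diff P i (a i.+1 x) = a i (pr_diff P' i x)).
Proof.
(* The invariant carried through the recursion: the next lifting problem is solvable. *)
pose good i (a : {linear pr_obj P' i -> pr_obj P i}) :=
  forall x, exists y, pr_diff P i y = a (pr_diff P' i x).
have [a0 ha0] := @proj_lift _ _ _ _ (pr_aug P) (u \o pr_aug P')
  (@pr_projective _ _ P' 0) (fun p => pr_surj P (u (pr_aug P' p))).
have g0 : good 0%N a0.
  by move=> x; apply/pr_exact0; rewrite ha0 /= pr_ad linear0.
have step i (a : {a | good i a}) :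
    {b : {linear pr_obj P' i.+1 -> pr_obj P i.+1} |
      good i.+1 b /\ forall x, pr_diff P i (b x) = sval a (pr_diff P' i x)}.
  apply: cid.
  have [|b hb] := @proj_lift _ _ _ _ (pr_diff P i) (sval a \o pr_diff P' i)
    (@pr_projective _ _ P' i.+1).
    exact: (svalP a).
  exists b; split=> // x; apply/pr_exactS.
  by rewrite hb /= pr_dd linear0.
pose fix al i : {a | good i a} :=
  match i with
  | 0 => exist _ a0 g0
  | j.+1 => let b := step j (al j) in exist _ (sval b) (svalP b).1
  end.
exists (fun i => sval (al i)); split=> // i x /=.
exact: (svalP (step i (al i))).2.
Qed.

(** * The mapping cone of a chain map over an injection, as a resolution of the cokernel *)

Section Cone.
Variables (A' A A'' : lmodType R) (u : {linear A' -> A}) (v : {linear A -> A''}).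
Variables (P' : proj_resolution A') (P : proj_resolution A).
Variable a : forall i, {linear pr_obj P' i -> pr_obj P i}.
Hypothesis (uv : ses u v).
Hypothesis a0 : forall x, pr_aug P (a 0%N x) = u (pr_aug P' x).
Hypothesis aS : forall i x, pr_diff P i (a i.+1 x) = a i (pr_diff P' i x).

Definition cobj (i : nat) : lmodType R :=
  match i with
  | 0 => pr_obj P 0
  | j.+1 => (pr_obj P j.+1 * pr_obj P' j)%type
  end.

(** The sign on [pr_diff P'] makes consecutive differentials compose to zero. *)
Definition cdiff (i : nat) : {linear cobj i.+1 -> cobj i} :=
  match i with
  | 0 => cpair (pr_diff P 0) (a 0)
  | j.+1 => dpair (cpair (pr_diff P j.+1) (a j.+1))
                  (cpair \0 (\- pr_diff P' j : {linear _ -> _}))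
  end.

Lemma cdiff0E p q : cdiff 0 (p, q) = pr_diff P 0 p + a 0%N q.
Proof. by []. Qed.

Lemma cdiffSE i p q :
  cdiff i.+1 (p, q) = (pr_diff P i.+1 p + a i.+1 q, - pr_diff P' i q).
Proof. by congr pair; rewrite /= add0r. Qed.

Fact cone_proj i : projective (cobj i).
Proof.
case: i => [|i]; first exact: pr_projective.
by apply: proj_prod; apply: pr_projective.
Qed.

Fact cone_surj : surjective_map (v \o pr_aug P : {linear _ -> _}).
Proof.
have [_ _ vs] := uv => y; have [x <-] := vs y.
by have [p <-] := pr_surj P x; exists p.
Qed.

Fact cone_exact0 : exact_at (cdiff 0) (v \o pr_aug P : {linear _ -> _}).
Proof.
have [ui e _] := uv; move=> y; split=> [/e[x ex]|[[p q] <-]] /=; last first.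
  by rewrite linearD pr_ad add0r a0; apply/e; eexists.
have [q eq] := pr_surj P' x.
have [p ep] : exists p, pr_diff P 0 p = y - a 0%N q.
  by apply/pr_exact0; rewrite linearB a0 eq ex subrr.
by exists (p, q); rewrite /= ep subrK.
Qed.

Fact cone_exactS i : exact_at (cdiff i.+1) (cdiff i).
Proof.
have [ui e _] := uv; move=> [p q]; split; last first.
  case=> [[p' q'] <-]; rewrite cdiffSE; case: i p q p' q' => [|i] p q p' q'.
    by rewrite cdiff0E linearD pr_dd add0r linearN aS subrr.
  by rewrite cdiffSE linearD pr_dd add0r !linearN aS subrr /= pr_dd !oppr0.
case: i p q => [|i] p q; rewrite ?cdiff0E ?cdiffSE.
  (* Here the injectivity of [u] enters: as the augmentation kills [a 0 q], the element [q] is a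
     boundary. *)
  move=> h; have : pr_aug P (a 0%N q) = 0.
    by rewrite -[a 0%N q](addKr (pr_diff P 0 p)) h addr0 linearN pr_ad oppr0.
  rewrite a0 => /(lin_inj0 ui) /pr_exact0[q' eq'].
  have [p' ep'] : exists p', pr_diff P 1 p' = p + a 1%N q'.
    by apply/pr_exactS; rewrite linearD aS eq'.
  by exists (p', - q'); rewrite cdiffSE ep' !linearN addrK opprK eq'.
case=> h1 /eqP; rewrite oppr_eq0 => /eqP /pr_exactS[q' eq'].
have [p' ep'] : exists p', pr_diff P i.+2 p' = p + a i.+2 q'.
  by apply/pr_exactS; rewrite linearD aS eq'.
by exists (p', - q'); rewrite cdiffSE ep' !linearN addrK opprK eq'.
Qed.

Definition cone : proj_resolution A'' :=
  ProjResolution cone_proj cone_surj cone_exact0 cone_exactS.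

Definition cinl i : {linear pr_obj P i -> pr_obj cone i} :=
  match i with 0 => idfun | j.+1 => linl (pr_obj P j.+1) (pr_obj P' j) end.
Definition cinr j : {linear pr_obj P' j -> pr_obj cone j.+1} :=
  linr (pr_obj P j.+1) (pr_obj P' j).

Lemma cdiff_inl i x : pr_diff cone i (cinl i.+1 x) = cinl i (pr_diff P i x).
Proof.
case: i x => [|i] x; first by rewrite -[LHS]/(cdiff 0 (x, 0)) cdiff0E linear0 addr0.
by rewrite -[LHS]/(cdiff i.+1 (x, 0)) cdiffSE !(linear0, addr0, oppr0).
Qed.

Lemma cdiff_inr0 x : pr_diff cone 0 (cinr 0 x) = cinl 0 (a 0%N x).
Proof. by rewrite -[LHS]/(cdiff 0 (0, x)) cdiff0E linear0 add0r. Qed.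

Lemma cdiff_inr i x :
  pr_diff cone i.+1 (cinr i.+1 x) = cinl i.+1 (a i.+1 x) - cinr i (pr_diff P' i x).
Proof.
rewrite -[LHS]/(cdiff i.+1 (0, x)) cdiffSE linear0 add0r.
by congr pair; rewrite /= ?subr0 ?sub0r.
Qed.

Lemma cone_dec i N (f : {linear pr_obj cone i.+1 -> N}) x :
  f x = f (cinl i.+1 x.1) + f (cinr i x.2).
Proof. exact: prod_dec. Qed.
End Cone.
End Ext.

Arguments cinl : simpl never.
Arguments cinr : simpl never.
Arguments cdiff : simpl never.

(** * Vanishing of Ext *)

Section SecondVariable.
Variable R : comNzRingType.
Implicit Types A B C M N : lmodType R.

Section Fixed.
Variables (A : lmodType R) (P : proj_resolution A).
Variables (N' N N'' : lmodType R) (u : {linear N' -> N}) (v : {linear N -> N''}).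
Hypothesis uv : ses u v.

(** A lift of [f] to [N] fails to be a cocycle by a cocycle with values in [N']; bounding the latter
    corrects the lift. *)
Lemma res_quot i : ext_res P i N -> ext_res P i.+1 N' -> ext_res P i N''.
Proof.
have [ui e vs] := uv => EN EN' f cf.
have [f1 hf1] := @pr_projective _ _ P i _ _ v f vs.
have [|f' hf'] := @factor_inj _ _ _ _ u (f1 \o pr_diff P i) ui.
  by move=> x; apply/e; rewrite hf1 cf.
have [|g' hg'] := EN' f'.
  by move=> x; apply: ui; rewrite hf' /= pr_dd !linear0.
pose h : {linear pr_obj P i -> N} := f1 \- (u \o g').
have ch : cocycle h by move=> x; rewrite /h /= -hg' hf' /= subrr.
have hv x : v (h x) = f x by rewrite /h /= linearB hf1 (ses0 uv) subr0.
have := EN h ch; clearbody h; case: i h f {EN EN' cf f1 hf1 f' hf' g' hg' ch} hv => [|i] h f hv /=.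
  by move=> h0 x; rewrite -hv /= h0 linear0.
by case=> g hg; exists (v \o g) => x; rewrite -hv /= -hg.
Qed.

Lemma res_mid i : ext_res P i N' -> ext_res P i N'' -> ext_res P i N.
Proof.
have [ui e vs] := uv; case: i => [|i] EN' EN'' f cf.
  have cvf : cocycle (v \o f : {linear _ -> _}) by move=> x; rewrite /= cf linear0.
  have [|f' hf'] := @factor_inj _ _ _ _ u f ui.
    by move=> x; apply/e; apply: (EN'' _ cvf).
  move=> x; rewrite -hf' (EN' f') ?linear0 // => y.
  by apply: ui; rewrite hf' cf linear0.
have cvf : cocycle (v \o f : {linear _ -> _}) by move=> x; rewrite /= cf linear0.
have [h'' hh''] := EN'' _ cvf.
have [h hh] := @pr_projective _ _ P i _ _ v h'' vs.
have [|f' hf'] := @factor_inj _ _ _ _ u (f \- (h \o pr_diff P i) : {linear _ -> _}) ui.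
  by move=> x; apply/e; rewrite /= linearB hh -hh'' subrr.
have [|g' hg'] := EN' f'.
  by move=> y; apply: ui; rewrite hf' /= cf pr_dd [h 0]linear0 subrr linear0.
exists ((u \o g') \+ h : {linear _ -> _}) => x /=.
by rewrite -hg' hf' subrK.
Qed.

(** Only the given cocycle has to bound in [N]. In the depth arguments its class dies in [N]
    although Ext into [N] need not vanish. *)
Lemma res_sub i (f : {linear pr_obj P i.+1 -> N'}) : ext_res P i N'' ->
  (exists g : {linear pr_obj P i -> N}, forall x, u (f x) = g (pr_diff P i x)) ->
  coboundary f.
Proof.
have [ui e vs] := uv; move=> EN'' [h hh].
have cvh : cocycle (v \o h : {linear _ -> _}).
  by move=> x; rewrite /= -hh (ses0 uv).
have [h1 h1d h1e] : exists2 h1 : {linear pr_obj P i -> N},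
    (forall x, h1 (pr_diff P i x) = 0) & forall x, v (h1 x) = v (h x).
  have := EN'' _ cvh; case: i f EN'' h hh cvh => [|i] f EN'' h hh cvh /=.
    by move=> h0; exists \0 => x //=; rewrite linear0 h0.
  case=> k hk; have [l hl] := @pr_projective _ _ P i _ _ v k vs.
  by exists (l \o pr_diff P i) => x /=; rewrite ?pr_dd ?linear0 // hl -hk.
have [|h' hh'] := @factor_inj _ _ _ _ u (h \- h1 : {linear _ -> _}) ui.
  by move=> x; apply/e; rewrite /= linearB h1e subrr.
exists h' => x; apply: ui; rewrite hh' /= hh.
by have := h1d x => ->; rewrite subr0.
Qed.
End Fixed.

Lemma ext_quot A N' N N'' (u : {linear N' -> N}) (v : {linear N -> N''}) i :
  ses u v -> Ext_eq0 i A N -> Ext_eq0 i.+1 A N' -> Ext_eq0 i A N''.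
Proof. by move=> uv E E' P; apply: (res_quot uv); [apply: E | apply: E']. Qed.

Lemma ext_mid A N' N N'' (u : {linear N' -> N}) (v : {linear N -> N''}) i :
  ses u v -> Ext_eq0 i A N' -> Ext_eq0 i A N'' -> Ext_eq0 i A N.
Proof. by move=> uv E E' P; apply: (res_mid uv); [apply: E | apply: E']. Qed.

Lemma ext_sub A N' N N'' (u : {linear N' -> N}) (v : {linear N -> N''}) i :
  ses u v -> Ext_eq0 i A N'' -> Ext_eq0 i.+1 A N -> Ext_eq0 i.+1 A N'.
Proof.
move=> uv E E' P f cf; apply: (res_sub uv); first exact: E.
by apply: (E' P (u \o f)) => x /=; rewrite cf linear0.
Qed.

Lemma ext_sub0 A N' N (u : {linear N' -> N}) :
  injective u -> Ext_eq0 0 A N -> Ext_eq0 0 A N'.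
Proof.
move=> ui E P f cf x; apply: ui; rewrite linear0.
by apply: (E P (u \o f)) => y /=; rewrite cf linear0.
Qed.

Lemma ext_retractR A N N' (u : {linear N -> N'}) (v : {linear N' -> N}) i :
  cancel v u -> Ext_eq0 i A N -> Ext_eq0 i A N'.
Proof.
move=> vu E P f cf; have := E P (v \o f).
case: i f cf {E} => [|i] f cf /= h.
  by move=> x; rewrite -[f x]vu h ?linear0 // => y; rewrite /= cf linear0.
have [y|g hg] := h; first by rewrite /= cf linear0.
by exists (u \o g) => x; rewrite /= -hg vu.
Qed.

Lemma ext_isoR A N N' i : lmod_iso N N' -> Ext_eq0 i A N -> Ext_eq0 i A N'.
Proof. by move=> [u [v [_ vu]]]; apply: ext_retractR vu. Qed.

Lemma ext_isoL A A' N i : lmod_iso A A' -> Ext_eq0 i A N -> Ext_eq0 i A' N.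
Proof.
move=> [u [v [uv vu]]] E P f cf.
have vi : injective v by apply: can_inj vu.
have s : surjective_map (v \o pr_aug P : {linear _ -> _}).
  by move=> y; have [x e] := pr_surj P (u y); exists x; rewrite /= e uv.
have ex : exact_at (pr_diff P 0) (v \o pr_aug P : {linear _ -> _}).
  by move=> y; split=> [/= /(lin_inj0 vi)/pr_exact0 //|[x <-]] /=; rewrite pr_ad linear0.
exact: (E (ProjResolution (@pr_projective _ _ P) s ex (@pr_exactS _ _ P)) f cf).
Qed.

Lemma ext_pow A N n i : Ext_eq0 i A N -> Ext_eq0 i A (pow n N).
Proof.
move=> E P f cf.
have h (j : 'I_n) : coboundary (ppr N j \o f : {linear _ -> _}).
  by apply: E => x /=; rewrite cf ffunE.
case: i f cf h {E} => [|i] f cf h /=.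
  by move=> x; apply/ffunP=> j; rewrite ffunE -[RHS](h j x).
have [g hg] := choice h; exists (ptup g) => x.
by apply/ffunP=> j; rewrite ptupE -hg.
Qed.

Lemma ext_injective A I i : injective_module I -> Ext_eq0 i.+1 A I.
Proof.
move=> iI P f cf; pose j := sm_incl (img_sub (pr_diff P i)).
have ji := @sm_incl_inj _ _ (img_sub (pr_diff P i)).
have [|d hd] := @factor_inj _ _ _ _ j (pr_diff P i) ji.
  by move=> x; apply/(sm_inclP (img_sub (pr_diff P i))); exists x.
have ds : surjective_map d.
  move=> y; have [x ex] : img_sub (pr_diff P i) (j y).
    by apply/(sm_inclP (img_sub (pr_diff P i))); exists y.
  by exists x; apply: ji; rewrite -/j hd.
have [|f' hf'] := @factor_surj _ _ _ _ d f ds.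
  move=> b hb; have /pr_exactS[y <-] : pr_diff P i b = 0 by rewrite -hd hb linear0.
  exact: cf.
have [g hg] := iI _ _ j f' ji.
by exists g => x; rewrite -hf' -hg hd.
Qed.

(** A section of the augmentation makes multiplication by 1 null-homotopic in positive degrees. *)
Lemma ext_proj A N i : projective A -> Ext_eq0 i.+1 A N.
Proof.
move=> pA P f cf.
have [s hs] := pA _ _ (pr_aug P) idfun (pr_surj P).
have [a|g hg] := @scaled_coboundary _ _ P 1 s _ i N f cf; first by rewrite scale1r hs.
by exists g => x; rewrite -hg scale1r.
Qed.

End SecondVariable.

(** * Free resolutions and exact segments in the first variable of Ext *)

Section Resolutions.
Variable R : comNzRingType.
Hypothesis nR : noetherian R.
Implicit Types A B C M N : lmodType R.

(** Finite free terms keep [Hom(P_i, N)] finitely generated, as Nakayama's lemma demands, and turn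
    [Hom(P_i, Omega)] into a power of [Omega]. *)
Definition free_res A (P : proj_resolution A) :=
  forall i, exists n, lmod_iso (pow n R^o) (pr_obj P i).

Lemma fg_resolution A : fin_gen A -> exists P : proj_resolution A, free_res P.
Proof.
move=> fA; pose fgm := {M : lmodType R | fin_gen M}.
have cov (X : fgm) : {n : nat & {p : {linear pow n R^o -> sval X} | surjective_map p}}.
  have /fin_genP/cid[n hn] := svalP X.
  by have /cid[p ps] := hn; exists n, p.
pose cn X := projT1 (cov X).
pose cp X : {linear pow (cn X) R^o -> sval X} := sval (projT2 (cov X)).
have cs X : surjective_map (cp X) := svalP (projT2 (cov X)).
have kfg X : fin_gen (Ker (cp X)).
  by apply: (fg_inj nR (@sm_incl_inj _ _ (ker_sub (cp X)))); apply: fg_pow1.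
pose nxt X : fgm := exist _ (Ker (cp X)) (kfg X).
pose sq i := iter i nxt (exist _ A fA).
pose ob i : lmodType R := pow (cn (sq i)) R^o.
pose df i : {linear ob i.+1 -> ob i} := ker_incl (cp (sq i)) \o cp (sq i.+1).
pose ag : {linear ob 0%N -> A} := cp (sq 0%N).
have e0 X : exact_at (ker_incl (cp X) \o cp (nxt X) : {linear _ -> _}) (cp X).
  move=> y; have [_ e _] := ker_ses (cs X).
  split=> [/e[z <-]|[x <-]]; last by apply/e; eexists; reflexivity.
  by have [x <-] := cs (nxt X) z; exists x.
have eS i : exact_at (df i.+1) (df i).
  move=> y; have [h1 h2] := e0 (sq i.+1) y.
  split=> [/(lin_inj0 (@sm_incl_inj _ _ _))/h1 //|/h2 h].
  by rewrite -[LHS]/(ker_incl _ (cp (sq i.+1) y)) h linear0.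
exists (@ProjResolution R A ob df ag (fun i => @proj_pow _ _ _ (@proj_R R))
  (cs (sq 0%N)) (e0 (sq 0%N)) eS).
by move=> i; exists (cn (sq i)), idfun, idfun.
Qed.

Definition power_res n A (P : proj_resolution A) : proj_resolution (pow n A) :=
  @ProjResolution R (pow n A) (fun i => pow n (pr_obj P i))
    (fun i => pmap n (pr_diff P i)) (pmap n (pr_aug P))
    (fun i => proj_pow (@pr_projective _ _ P i)) (pmap_surj (pr_surj P))
    (pmap_exact (@pr_exact0 _ _ P)) (fun i => pmap_exact (@pr_exactS _ _ P i)).

(* The connecting homomorphism, read on the mapping cone. *)
Lemma cone_shift A' A A'' (u : {linear A' -> A}) (v : {linear A -> A''})
    (P' : proj_resolution A') (P : proj_resolution A)
    (a : forall i, {linear pr_obj P' i -> pr_obj P i})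
    (uv : ses u v) (a0 : forall x, pr_aug P (a 0%N x) = u (pr_aug P' x))
    (aS : forall i x, pr_diff P i (a i.+1 x) = a i (pr_diff P' i x)) i N
    (f : {linear pr_obj P' i.+1 -> N}) :
  ext_res (cone uv a0 aS) i.+2 N -> cocycle f ->
  exists (h : {linear pr_obj P i.+1 -> N}) (k : {linear pr_obj P' i -> N}),
    cocycle h /\ forall x, f x = h (a i.+1 x) - k (pr_diff P' i x).
Proof.
move=> E cf; pose F : {linear pr_obj (cone uv a0 aS) i.+2 -> N} := cpair \0 f.
have [[p q]|k hk] := E F.
  rewrite -[pr_diff _ _ _]/(cdiff a i.+2 (p, q)) cdiffSE -[LHS]/(0 + f _) add0r.
  by rewrite linearN cf oppr0.
exists (k \o cinl uv a0 aS i.+1), (k \o cinr uv a0 aS i); split=> [x|x].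
  rewrite -[LHS]/(k (cinl uv a0 aS i.+1 (pr_diff P i.+1 x))) -cdiff_inl -hk.
  by rewrite -[LHS]/(0 + f 0) linear0 addr0.
rewrite -[RHS]/(k (cinl uv a0 aS i.+1 _) - k (cinr uv a0 aS i _)).
by rewrite -linearB -cdiff_inr -hk -[RHS]/(0 + f x) add0r.
Qed.

(** The cone of a lift of the identity resolves the zero module, so its cocycles in positive degrees
    bound. By [cone_shift], [f] is then a cocycle on [P] pulled back along [a], up to a
    coboundary. *)
Lemma ext_res_indep A (P P' : proj_resolution A) i N :
  ext_res P i.+1 N -> ext_res P' i.+1 N.
Proof.
move=> E f cf.
have [a [a0 aS]] := @chain_lift R A A idfun P' P.
have idi : injective (idfun : {linear A -> A}) by [].
have uv := coker_ses idi.
have C0 (x : Cokernel (idfun : {linear A -> A})) : x = 0.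
  have [y <-] := @coker_surj _ _ _ (idfun : {linear A -> A}) x.
  by apply/coker_exact; exists y.
have Ec : ext_res (cone uv a0 aS) i.+2 N.
  move=> F cF; have [z|g hg] := @scaled_coboundary _ _ (cone uv a0 aS) 1 \0 _ i.+1 N F cF.
    by rewrite linear0 [in RHS](C0 z) scaler0.
  by exists g => x; rewrite -hg scale1r.
have [h [k [ch hk]]] := cone_shift Ec cf.
have [l hl] := E _ ch.
exists ((l \o a i) \- k : {linear _ -> _}) => x.
by rewrite hk hl aS.
Qed.

Lemma ext_resP A (P : proj_resolution A) i N : ext_res P i.+1 N -> Ext_eq0 i.+1 A N.
Proof. by move=> E P'; apply: ext_res_indep E. Qed.

Section FirstVariable.
Variables (A' A A'' : lmodType R) (u : {linear A' -> A}) (v : {linear A -> A''}).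
Hypothesis uv : ses u v.
Hypotheses (fA' : fin_gen A') (fA : fin_gen A).

(** If [f o a] is bounded by [g], then [(f, g)] is a cocycle on the cone. *)
Lemma ext_midL i N : Ext_eq0 i.+1 A' N -> Ext_eq0 i.+1 A'' N -> Ext_eq0 i.+1 A N.
Proof.
move=> E' E'' P f cf.
have [P' _] := fg_resolution fA'; have [a [a0 aS]] := chain_lift u P' P.
have [x|g hg] := E' P' (f \o a i.+1); first by rewrite /= -aS cf.
pose F : {linear pr_obj (cone uv a0 aS) i.+1 -> N} := cpair f g.
have [[p q]|k hk] := E'' _ F.
  rewrite -[pr_diff _ _ _]/(cdiff a i.+1 (p, q)) cdiffSE.
  rewrite -[LHS]/(f (pr_diff P i.+1 p + a i.+1 q) + g (- pr_diff P' i q)).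
  by rewrite linearD cf add0r linearN -hg subrr.
exists (k \o cinl uv a0 aS i) => x.
rewrite -[RHS]/(k (cinl uv a0 aS i (pr_diff P i x))) -cdiff_inl -hk.
by rewrite -[RHS]/(f x + g 0) linear0 addr0.
Qed.

Lemma ext_subL i N : Ext_eq0 i.+1 A N -> Ext_eq0 i.+2 A'' N -> Ext_eq0 i.+1 A' N.
Proof.
move=> E E'' P' f cf.
have [P _] := fg_resolution fA; have [a [a0 aS]] := chain_lift u P' P.
have [h [k [ch hk]]] := cone_shift (E'' (cone uv a0 aS)) cf.
have [l hl] := E P _ ch.
exists ((l \o a i) \- k : {linear _ -> _}) => x.
by rewrite hk hl aS.
Qed.

Lemma ext_quotL i N : Ext_eq0 i.+1 A' N -> Ext_eq0 i.+2 A N -> Ext_eq0 i.+2 A'' N.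
Proof.
have [P _] := fg_resolution fA; have [P' _] := fg_resolution fA'.
have [a [a0 aS]] := chain_lift u P' P.
move=> E' E; apply: (@ext_resP _ (cone uv a0 aS)) => f cf.
have [x|l hl] := E P (f \o cinl uv a0 aS i.+2).
  by rewrite -[LHS]/(f (cinl uv a0 aS i.+2 (pr_diff P i.+2 x))) -cdiff_inl cf.
pose g' : {linear pr_obj P' i.+1 -> N} := (f \o cinr uv a0 aS i.+1) \- (l \o a i.+1).
have [x|k hk] := E' P' g'.
  have := cf (cinr uv a0 aS i.+2 x); rewrite cdiff_inr linearB => /eqP.
  rewrite subr_eq0 => /eqP e.
  by rewrite /= -e -aS -hl subrr.
exists (cpair l (\- k : {linear _ -> _})) => -[p q]; rewrite cone_dec.
rewrite -[pr_diff _ _ _]/(cdiff a i.+1 (p, q)) cdiffSE.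
rewrite -[RHS]/(l (pr_diff P i.+1 p + a i.+1 q) + - k (- pr_diff P' i q)).
rewrite [k (- _)]linearN opprK -hk [in RHS]linearD -addrA; congr (_ + _); first exact: hl.
by rewrite addrC subrK.
Qed.

(** The segment [Hom(A, N) -> Hom(A', N) -> Ext^1(A'', N) -> Ext^1(A, N)]. Asking for
    [Hom(A', N) = 0] would be too much; extending its elements to [A] is enough. *)
Lemma ext1_quotL N : Ext_eq0 1 A N ->
  (forall z : {linear A' -> N}, exists x : {linear A -> N}, forall t, x (u t) = z t) ->
  Ext_eq0 1 A'' N.
Proof.
have [P _] := fg_resolution fA; have [P' _] := fg_resolution fA'.
have [a [a0 aS]] := chain_lift u P' P.
move=> E hz; apply: (@ext_resP _ (cone uv a0 aS)) => f cf.
have [x|l hl] := E P (f \o cinl uv a0 aS 1).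
  by rewrite -[LHS]/(f (cinl uv a0 aS 1 (pr_diff P 1 x))) -cdiff_inl cf.
pose g' : {linear pr_obj P' 0 -> N} := (f \o cinr uv a0 aS 0) \- (l \o a 0).
have [x|z hz'] := @pr_factor _ _ P' _ g'.
  have := cf (cinr uv a0 aS 1 x); rewrite cdiff_inr linearB => /eqP.
  rewrite subr_eq0 => /eqP e.
  by rewrite /= -e -aS -hl subrr.
have [w hw] := hz z.
exists (l \+ (w \o pr_aug P) : {linear _ -> _}) => -[p q]; rewrite cone_dec.
rewrite -[pr_diff _ _ _]/(cdiff a 0 (p, q)) cdiff0E.
rewrite -[RHS]/(l (pr_diff P 0 p + a 0%N q) + w (pr_aug P (pr_diff P 0 p + a 0%N q))).
rewrite [pr_aug P _]linearD pr_ad add0r a0 hw hz' linearD.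
rewrite -addrA; congr (_ + _); first exact: hl.
by rewrite addrC subrK.
Qed.

(** The pair [(0, f o aug)] is a cocycle on the cone; the map on [P_0] that bounds it descends to
    [A] and extends [f]. *)
Lemma ext1_extend N (f : {linear A' -> N}) : Ext_eq0 1 A'' N ->
  exists g : {linear A -> N}, forall x, g (u x) = f x.
Proof.
have [P _] := fg_resolution fA; have [P' _] := fg_resolution fA'.
have [a [a0 aS]] := chain_lift u P' P => E.
pose F : {linear pr_obj (cone uv a0 aS) 1 -> N} := cpair \0 (f \o pr_aug P').
have [[p q]|k hk] := E _ F.
  rewrite -[pr_diff _ _ _]/(cdiff a 1 (p, q)) cdiffSE -[LHS]/(0 + f _) add0r.
  by rewrite linearN pr_ad oppr0 linear0.
have [x|g hg] := @pr_factor _ _ P _ (k : {linear pr_obj P 0 -> N}).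
  by have := hk (cinl uv a0 aS 1 x); rewrite cdiff_inl => <-;
    rewrite -[LHS]/(0 + f (pr_aug P' 0)) !linear0 addr0.
exists g => x; have [y <-] := pr_surj P' x.
rewrite -a0 hg; have := hk (cinr uv a0 aS 0 y); rewrite cdiff_inr0 /= => <-.
by rewrite -[LHS]/(0 + f (pr_aug P' y)) add0r.
Qed.
End FirstVariable.

Lemma ext1_lift A N' N N'' (u : {linear N' -> N}) (v : {linear N -> N''})
    (h : {linear A -> N''}) : ses u v -> fin_gen A -> Ext_eq0 1 A N' ->
  exists g : {linear A -> N}, forall x, v (g x) = h x.
Proof.
move=> uv fA E; have [ui e vs] := uv; have [P _] := fg_resolution fA.
have [k hk] := @pr_projective _ _ P 0 _ _ v (h \o pr_aug P) vs.
have [|f hf] := @factor_inj _ _ _ _ u (k \o pr_diff P 0) ui.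
  by move=> x; apply/e; rewrite hk /= pr_ad linear0.
have [x|l hl] := E P f; first by apply: ui; rewrite hf /= pr_dd !linear0.
have [x|g hg] := @pr_factor _ _ P _ (k \- (u \o l) : {linear _ -> _}).
  by rewrite /= -hl hf subrr.
exists g => x; have [y <-] := pr_surj P x.
by rewrite hg linearB hk (ses0 uv) subr0.
Qed.

Lemma ext_powL A N n i : fin_gen A -> Ext_eq0 i.+1 A N -> Ext_eq0 i.+1 (pow n A) N.
Proof.
move=> fA E; have [P _] := fg_resolution fA.
apply: (@ext_resP _ (power_res n P)) => f cf.
have h (j : 'I_n) : exists g : {linear pr_obj P i -> N},
    forall x, f (pin (pr_obj P i.+1) j x) = g (pr_diff P i x).
  apply: (E P (f \o pin (pr_obj P i.+1) j)) => x /=.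
  have := cf (pin (pr_obj P i.+2) j x); congr (f _ = 0).
  by apply/ffunP=> k; rewrite pmapE !pinE; case: eqP => // _; rewrite linear0.
have [g hg] := choice h; exists (psum g) => x.
rewrite psumE pow_linE; apply: eq_bigr => j _.
by rewrite hg pmapE.
Qed.

(** Values on generators embed [Hom(A, B)] in a power of [B]. *)
Lemma fg_LinHom A B : fin_gen A -> fin_gen B -> fin_gen (LinHom A B).
Proof.
move=> [n [x hx]] fB.
have l : linear (fun h : LinHom A B => [ffun j => hom_fun h (x j)] : pow n B).
  by move=> a u v; apply/ffunP=> j; rewrite !ffunE.
apply: (fg_inj nR (i := mklin l)); last exact: fg_pow.
move=> f g /ffunP e; apply: hom_ext => y; have [c ->] := hx y.
rewrite /hom_fun !linear_sum; apply: eq_bigr => j _.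
rewrite !linearZ; congr (_ *: _); have := e j; rewrite !ffunE; exact.
Qed.

Section Nakayama.
Variable m : idealr R.
Hypothesis lR : local_with m.

(** Since Ext of the cokernel vanishes one degree up, [(f_j) |-> sum_j x_j f_j], the map induced by
    [pscale x A], is onto [Ext^(i+1)(A, N)], which therefore equals [m] times itself. *)
Lemma ext_nakayama A N n (x : 'I_n -> R) i : fin_gen A -> fin_gen N ->
  (forall j, x j \in m) -> injective (pscale x A) ->
  Ext_eq0 i.+2 (Cokernel (pscale x A)) N -> Ext_eq0 i.+1 A N.
Proof.
move=> fA fN xm xi E; have [P fP] := fg_resolution fA.
apply: (@ext_resP _ P).
pose a j := pscale x (pr_obj P j).
have a0 y : pr_aug (power_res n P) (a 0%N y) = pscale x A (pr_aug P y).
  by apply/ffunP=> j; rewrite pmapE !pscaleE linearZ.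
have aS j y : pr_diff (power_res n P) j (a j.+1 y) = a j (pr_diff P j y).
  by apply/ffunP=> k; rewrite pmapE !pscaleE linearZ.
(* The cocycles [Z] and their submodule of coboundaries replace the quotient Ext. *)
pose Z0 (f : LinHom (pr_obj P i.+1) N) :=
  forall y, hom_fun f (pr_diff P i.+1 y) = 0.
have Z0P c f g : Z0 f -> Z0 g -> Z0 (c *: f + g).
  move=> hf hg y; rewrite -[LHS]/(c *: hom_fun f (pr_diff P i.+1 y) + hom_fun g _).
  by rewrite hf hg scaler0 addr0.
pose Z := @mksub R _ Z0 (fun _ => erefl) Z0P.
pose B0 (f : smT Z) := exists g : {linear pr_obj P i -> N},
  forall y, hom_fun (val f) y = g (pr_diff P i y).
have B00 : B0 0 by exists \0.
have B0P c f g : B0 f -> B0 g -> B0 (c *: f + g).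
  move=> [f' hf] [g' hg]; exists (c \*: f' \+ g' : {linear _ -> _}) => y.
  by rewrite -[LHS]/(c *: hom_fun (val f) y + hom_fun (val g) y) hf hg.
have fZ : fin_gen (smT Z).
  apply: (fg_inj nR (@sm_incl_inj _ _ Z)); apply: fg_LinHom => //.
  by have [p /fg_iso] := fP i.+1; apply; apply: fg_pow1.
have key (f : smT Z) : B0 f.
  apply: (@nakayama R m nR lR _ (mksub B00 B0P) fZ) => {}f.
  have cf : cocycle (hom_fun (val f) : {linear _ -> _}).
    by have /asboolP := valP f.
  (* This gives [f = sum_j x_j h_j - k d] with cocycles [h_j]: an element of [m Z] plus a
     coboundary. *)
  have [h [k [ch hk]]] := cone_shift (E (cone (coker_ses xi) a0 aS)) cf.
  have hjc j : Z (h \o pin (pr_obj P i.+1) j : {linear pr_obj P i.+1 -> N}).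
    move=> y; have := ch (pin (pr_obj P i.+2) j y); congr (h _ = 0).
    by apply/ffunP=> k'; rewrite pmapE !pinE; case: eqP => // _; rewrite linear0.
  have kc : Z ((\- (k \o pr_diff P i)) : {linear pr_obj P i.+1 -> N}).
    by move=> y; rewrite /hom_fun /= pr_dd !linear0.
  have [z ez] := choice (fun j => (sm_inclP Z _).1 (hjc j)).
  have [w ew] := (sm_inclP Z _).1 kc.
  exists w, (\sum_j x j *: z j); split.
  - exists (\- k : {linear _ -> _}) => y.
    by rewrite -[val w]/(sm_incl Z w) ew.
  - by exists n, x, z.
  - apply: (@sm_incl_inj _ _ Z); rewrite linearD ew linear_sum.
    apply: hom_ext => y; apply: (etrans (hk y)).
    set S := \sum_j _; rewrite -[RHS]/(hom_fun (\- (k \o pr_diff P i) : {linear _ -> _}) y + hom_fun S y).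
    rewrite addrC; congr (_ + _); rewrite /S.
    rewrite pow_linE.
    have hs (I : Type) (r : seq I) (F : I -> LinHom (pr_obj P i.+1) N) t :
      hom_fun (\sum_(j <- r) F j) t = \sum_(j <- r) hom_fun (F j) t.
      by elim/big_rec2: _ => //= j u' v' _ <-.
    rewrite hs; apply: eq_bigr => j _.
    by rewrite linearZ -[RHS]/(x j *: hom_fun (sm_incl Z (z j)) y) ez pscaleE !linearZ.
move=> f cf; have : Z f by [].
by case/(sm_inclP Z) => z ez; have [g hg] := key z; exists g => y; rewrite -hg -[val z]/(sm_incl Z z) ez.
Qed.
End Nakayama.
End Resolutions.

(** * Finite injective dimension *)

Section Pushout.
Variable R : comNzRingType.
Implicit Types A B C S W K : lmodType R.

(** Elementwise, the clauses say that [W] is the direct sum of [A] and [B] modulo the image of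
    [(f, -g)]; exact sequences are read off without a universal property. *)
Definition pushout S A B W (f : {linear S -> A}) (g : {linear S -> B})
    (iA : {linear A -> W}) (iB : {linear B -> W}) :=
  [/\ forall s, iA (f s) = iB (g s),
      forall w, exists a b, w = iA a + iB b
    & forall a b, iA a = iB b -> exists2 s, a = f s & b = g s].

Lemma pushout_sym S A B W f g iA iB :
  @pushout S A B W f g iA iB -> pushout g f iB iA.
Proof.
move=> [h1 h2 h3]; split=> [s|w|b a /esym/h3[s -> ->]]; [by [] | | by exists s].
by have [a [b ->]] := h2 w; exists b, a; rewrite addrC.
Qed.

Lemma pushout_ex S A B (f : {linear S -> A}) (g : {linear S -> B}) :
  exists W (iA : {linear A -> W}) (iB : {linear B -> W}), pushout f g iA iB.
Proof.
pose h := dpair f (\- g : {linear _ -> _}).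
exists (Cokernel h), (coker h \o linl A B), (coker h \o linr A B); split.
- move=> s; apply/eqP; rewrite -subr_eq0 /= -linearB; apply/eqP/coker_exact.
  exists s; apply/eqP; rewrite -subr_eq0; apply/eqP.
  by congr pair; rewrite /= ?subr0 ?sub0r ?opprK ?subrr ?addNr.
- move=> w; have [[a b] <-] := coker_surj w; exists a, b.
  rewrite /= -linearD; congr (coker h _).
  by congr pair; rewrite /= ?addr0 ?add0r.
- move=> a b /eqP; rewrite -subr_eq0 /= -linearB => /eqP/coker_exact[s [e1 e2]].
  exists s; first by rewrite e1 subr0.
  by apply: oppr_inj; rewrite e2 sub0r.
Qed.

Lemma pushout_ses S A B C W f g iA iB (q : {linear B -> C}) :
  @pushout S A B W f g iA iB -> ses g q -> exists v, ses iA v /\ forall b, v (iB b) = q b.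
Proof.
move=> [h1 h2 h3] gq; have [gi e qs] := gq.
have cs : surjective_map (cpair iA iB).
  by move=> w; have [a [b ->]] := h2 w; exists (a, b).
have [|v hv] := @factor_surj _ _ _ _ (cpair iA iB) (q \o @snd A B : {linear _ -> _}) cs.
  move=> [a b] /eqP; rewrite /= addr_eq0 -linearN => /eqP /h3[s _ es].
  by apply/eqP; rewrite -oppr_eq0 -linearN es (ses0 gq).
have vB b : v (iB b) = q b by have := hv (0, b); rewrite /= linear0 add0r.
have vA a : v (iA a) = 0 by have := hv (a, 0); rewrite /= !linear0 addr0.
exists v; split=> //; split.
- apply: lin_inj => a ea.
  have [|s -> /esym/(lin_inj0 gi)->] := h3 a 0; first by rewrite ea linear0.
  by rewrite linear0.
- move=> w; split=> [|[a <-]]; last exact: vA.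
  have [a [b ->]] := h2 w.
  have := hv (a, b); rewrite /= => -> /e[s <-].
  by exists (a + f s); rewrite linearD h1.
- by move=> c; have [b <-] := qs c; exists (iB b).
Qed.

Lemma pushout_surj S A B K W f g iA iB (k : {linear K -> S}) :
  @pushout S A B W f g iA iB -> ses k f -> injective g -> ses (g \o k : {linear _ -> _}) iB.
Proof.
move=> [h1 h2 h3] [ki e fs] gi; split.
- by move=> x y /= /gi/ki.
- move=> b; split=> [h|[x <-]].
    have [|s /esym/e[x <-] ->] := h3 0 b; first by rewrite h linear0.
    by exists x.
  rewrite /= -h1; have /= -> := (e (k x)).2; last by exists x.
  by rewrite linear0.
- move=> w; have [a [b ->]] := h2 w; have [s <-] := fs a.
  by exists (g s + b); rewrite linearD h1.
Qed.
End Pushout.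

Section InjDim.
Variable R : comNzRingType.
Implicit Types A B C E M N I J : lmodType R.

(** Injective dimension at most [n] through iterated cosyzygies, a form suited to induction; the
    comparison with [finite_injdim] closes the section. *)
Fixpoint fid (n : nat) N : Prop :=
  match n with
  | 0 => injective_module N
  | n'.+1 => exists I N1 (u : {linear N -> I}) (v : {linear I -> N1}),
      [/\ ses u v, injective_module I & fid n' N1]
  end.

Lemma inj_retract I J (s : {linear J -> I}) (p : {linear I -> J}) :
  cancel s p -> injective_module I -> injective_module J.
Proof.
move=> sp iI A B g h gi; have [h' hh] := iI _ _ g (s \o h) gi.
by exists (p \o h') => x; rewrite /= hh /= sp.
Qed.

Lemma inj_prod I J : injective_module I -> injective_module J ->
  injective_module (I * J)%type.
Proof.
move=> iI iJ A B g h gi.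
have [h1 e1] := iI _ _ g (@fst I J \o h : {linear _ -> _}) gi.
have [h2 e2] := iJ _ _ g (@snd I J \o h : {linear _ -> _}) gi.
exists (dpair h1 h2) => x; rewrite mklinE e1 e2 /=.
by case: (h x).
Qed.

Lemma inj_pow n I : injective_module I -> injective_module (pow n I).
Proof.
move=> iI A B g h gi.
have hj (j : 'I_n) := iI _ _ g (ppr I j \o h : {linear _ -> _}) gi.
have [h' e'] := choice hj; exists (ptup h') => x.
by apply/ffunP=> j; rewrite ptupE e'.
Qed.

Definition zmodl : lmodType R := pow 0 R^o.
Lemma zmodl0 (x y : zmodl) : x = y.
Proof. by apply/ffunP=> -[]. Qed.

Lemma inj_zmodl : injective_module zmodl.
Proof. by move=> A B g h gi; exists \0 => x; apply: zmodl0. Qed.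

Lemma inj_split A B C (u : {linear A -> B}) (v : {linear B -> C}) :
  ses u v -> injective_module A ->
  exists (r : {linear B -> A}) (s : {linear C -> B}),
    [/\ cancel u r, cancel s v & forall b, b = u (r b) + s (v b)].
Proof.
move=> uv iA; have [ui e vs] := uv; have [r hr] := iA _ _ u idfun ui.
have [|s hs] := @factor_surj _ _ _ _ v (idfun \- (u \o r) : {linear _ -> _}) vs.
  by move=> b /e[a <-]; rewrite /= hr subrr.
exists r, s; split=> // [c|b]; last by rewrite hs /= addrC subrK.
by have [b <-] := vs c; rewrite hs linearB (ses0 uv) subr0.
Qed.

Lemma inj_quot A B C (u : {linear A -> B}) (v : {linear B -> C}) :
  ses u v -> injective_module A -> injective_module B -> injective_module C.
Proof. by move=> uv iA iB; have [r [s [_ sv _]]] := inj_split uv iA; apply: inj_retract sv iB. Qed.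

Lemma inj_ext A B C (u : {linear A -> B}) (v : {linear B -> C}) :
  ses u v -> injective_module A -> injective_module C -> injective_module B.
Proof.
move=> uv iA iC; have [r [s [_ _ d]]] := inj_split uv iA.
apply: (@inj_retract _ _ (dpair r v) (cpair u s)); last exact: inj_prod.
by move=> b; rewrite /= -d.
Qed.

Lemma fid_iso n N N' : lmod_iso N N' -> fid n N -> fid n N'.
Proof.
move=> [f [g [fg gf]]]; case: n => [|n]; first exact: inj_retract gf.
move=> [I [N1 [u [v [[ui e vs] iI fN]]]]]; exists I, N1, (u \o g), v; split=> //; split=> //.
  by move=> x y /= /ui/(can_inj gf).
move=> y; split=> [/e[x <-]|[x <-]]; first by exists (f x); rewrite /= fg.
by apply/e; exists (g x).
Qed.

Lemma fid_succ n N : fid n N -> fid n.+1 N.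
Proof.
elim: n N => [|n IH] N.
  move=> iN; exists N, zmodl, idfun, \0; split=> //; last exact: inj_zmodl.
  split=> [//|y|y]; last by exists 0; apply: zmodl0.
  by split=> _; [exists y | apply: zmodl0].
by move=> [I [N1 [u [v [uv iI /IH h]]]]]; exists I, N1, u, v.
Qed.

Lemma fid_le n k N : (n <= k)%N -> fid n N -> fid k N.
Proof. by move=> /subnK <- h; elim: (_ - _)%N => //= j; apply: fid_succ. Qed.

Lemma fid_inj n N : injective_module N -> fid n N.
Proof. by move=> h; apply: (@fid_le 0). Qed.

(** Horseshoe lemma: [B] embeds in [I * J] by an extension of [a] and by [c o v], and the cokernels
    again form a short exact sequence. *)
Lemma fid_ext n A B C (u : {linear A -> B}) (v : {linear B -> C}) :
  ses u v -> fid n A -> fid n C -> fid n B.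
Proof.
elim: n A B C u v => [|n IH] A B C u v uv; first exact: inj_ext uv.
move=> [I [A1 [a [a' [[ai ea a's] iI fA]]]]] [J [C1 [c [c' [[ci ec c's] iJ fC]]]]].
have [ui e vs] := uv; have [r hr] := iI _ _ u a ui.
pose b : {linear B -> (I * J)%type} := dpair r (c \o v).
have bi : injective b.
  apply: lin_inj => x [e1 /(lin_inj0 ci) /e[y ey]].
  by move: e1; rewrite -ey hr => /(lin_inj0 ai) ->; rewrite linear0.
exists (I * J)%type, (Cokernel b), b, (coker b); split.
- exact: coker_ses.
- exact: inj_prod.
have [|f hf] := @factor_surj _ _ _ _ a' (coker b \o linl I J : {linear _ -> _}) a's.
  move=> i /ea[x <-]; apply/coker_exact; exists (u x).
  by congr pair; rewrite /= ?hr // (ses0 uv) linear0.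
have [|g hg] := @factor_surj _ _ _ _ (coker b) (c' \o @snd I J : {linear _ -> _}) (@coker_surj _ _ _ b).
  by move=> x /coker_exact[y <-] /=; apply/ec; exists (v y).
apply: (IH _ _ _ f g) => //; split.
- apply: lin_inj => x; have [i <-] := a's x.
  rewrite hf /= => /coker_exact[y [e1 /(lin_inj0 ci) /e[z ez]]].
  by apply/ea; exists z; rewrite -e1 -ez hr.
- move=> x; have [[i j] <-] := @coker_surj _ _ _ b x.
  rewrite hg /=; split=> [/ec[y ey]|[z]].
    have [w ew] := vs y; exists (a' (i - r w)); rewrite hf /=.
    apply/eqP; rewrite -subr_eq0 -linearB; apply/eqP/coker_exact; exists (- w).
    rewrite linearN; apply/eqP; rewrite -subr_eq0; apply/eqP.
    congr pair; rewrite /= ?sub0r ?ew ?ey.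
      by rewrite [_ - i]addrC addrA addNr add0r opprK addNr.
    by rewrite opprK addNr.
  have [i' <-] := a's z; rewrite hf /= => /eqP.
  rewrite -subr_eq0 -linearB => /eqP /coker_exact[w [_ ew]].
  by apply/ec; exists (v (- w)); rewrite !linearN ew sub0r opprK.
- by move=> z; have [j <-] := c's z; exists (coker b (0, j)); rewrite hg.
Qed.

(** The quotient [C = B/A] embeds in [I/A], injective because [A] splits off, with the same cokernel
    as [B] in [I]. *)
Lemma fid_quot_inj n A B C (u : {linear A -> B}) (v : {linear B -> C}) :
  ses u v -> injective_module A -> fid n B -> fid n C.
Proof.
case: n => [|n] uv iA; first exact: inj_quot uv iA.
move=> [I [B1 [b [b' [[bi eb b's] iI fB]]]]].
have [ui e vs] := uv.
have bui : injective (b \o u : {linear _ -> _}) by move=> x y /= /bi/ui.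
have [|f hf] := @factor_surj _ _ _ _ v (coker (b \o u) \o b : {linear _ -> _}) vs.
  by move=> x /e[y <-]; apply/coker_exact; exists y.
have [|g hg] := @factor_surj _ _ _ _ (coker (b \o u)) b' (@coker_surj _ _ _ (b \o u)).
  by move=> x /coker_exact[y <-]; apply/eb; exists (u y).
exists (Cokernel (b \o u)), B1, f, g; split=> //.
  split.
  - apply: lin_inj => c; have [x <-] := vs c; rewrite hf => /coker_exact[y /bi ey].
    by apply/e; exists y.
  - move=> x; have [i <-] := @coker_surj _ _ _ (b \o u) x; rewrite hg.
    split=> [/eb[y <-]|[c]]; first by exists (v y); rewrite hf.
    have [y <-] := vs c; rewrite hf /= => /eqP.
    rewrite -subr_eq0 -linearB => /eqP /coker_exact[w /= ew].
    by apply/eb; exists (y - u w); rewrite linearB ew opprB addrC subrK.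
  - by move=> z; have [i <-] := b's z; exists (coker (b \o u) i).
exact: (inj_quot (coker_ses bui)).
Qed.

(** Schanuel's argument: the pushout [W] of two injective embeddings of [J] is an extension of [J1]
    by [E] and of [C] by [I]. *)
Lemma fid_cosyzygy n J E C (u : {linear J -> E}) (v : {linear E -> C}) :
  ses u v -> injective_module E -> fid n.+1 J -> fid n C.
Proof.
move=> uv iE [I [J1 [a [b [ab iI fJ]]]]].
have [W [iA [iB po]]] := pushout_ex u a.
have [w [sw _]] := pushout_ses po ab.
have [w' [sw' _]] := pushout_ses (pushout_sym po) uv.
by apply: (fid_quot_inj sw' iI); apply: (fid_ext sw) => //; apply: fid_inj.
Qed.

(** The pushout [W] of [B] along an injective embedding of [A] is an extension of [A1] by [B], and
    [C] is [W] modulo the injective module [I]. *)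
Lemma fid_quot A B C (u : {linear A -> B}) (v : {linear B -> C}) a b :
  ses u v -> fid a A -> fid b B -> exists c, fid c C.
Proof.
move=> uv; case: a => [|a] fA fB; first by exists b; apply: fid_quot_inj uv fA fB.
have [I [A1 [f [g [fg iI fA1]]]]] := fA.
have [W [iA [iB po]]] := pushout_ex f u.
have [w [sw _]] := pushout_ses po uv.
have [w' [sw' _]] := pushout_ses (pushout_sym po) fg.
exists (maxn a b); apply: (fid_quot_inj sw iI); apply: (fid_ext sw').
  exact: fid_le (leq_maxr _ _) fB.
exact: fid_le (leq_maxl _ _) fA1.
Qed.

Lemma fid_retract n N J (s : {linear N -> J}) (p : {linear J -> N}) :
  cancel s p -> fid n J -> fid n N.
Proof.
elim: n N J s p => [|n IH] N J s p sp; first exact: inj_retract sp.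
move=> fJ; have [I [J1 [u [v [[ui e vs] iI _]]]]] := fJ.
have usi : injective (u \o s : {linear _ -> _}) by move=> x y /= /ui/(can_inj sp).
exists I, (Cokernel (u \o s)), (u \o s), (coker (u \o s)); split=> //; first exact: coker_ses.
(* Embedding [J] through its two complementary parts makes [I/N] a retract of the cokernel, whose
   dimension [fid_cosyzygy] controls. *)
pose w : {linear J -> (I * I)%type} :=
  dpair (u \o s \o p : {linear _ -> _}) (u \o (idfun \- (s \o p)) : {linear _ -> _}).
have wi : injective w.
  apply: lin_inj => x [/= e1 /(lin_inj0 ui) e2].
  move: e1; rewrite -[s (p x)](subrK x) -opprB e2 oppr0 add0r; exact: lin_inj0.
have fC : fid n (Cokernel w) by apply: (fid_cosyzygy (coker_ses wi)) => //; apply: inj_prod.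
have [|f hf] := @factor_surj _ _ _ _ (coker (u \o s)) (coker w \o linl I I : {linear _ -> _})
    (@coker_surj _ _ _ (u \o s)).
  move=> x /coker_exact[y <-]; apply/coker_exact; exists (s y).
  by congr pair; rewrite /= sp // subrr linear0.
have [|g hg] := @factor_surj _ _ _ _ (coker w) (coker (u \o s) \o @fst I I : {linear _ -> _})
    (@coker_surj _ _ _ w).
  by move=> x /coker_exact[y <-]; apply/coker_exact; exists (p y).
apply: (IH _ _ f g) => // x; have [i <-] := @coker_surj _ _ _ (u \o s) x.
by rewrite hf hg.
Qed.

Lemma fid_pow n k N : fid n N -> fid n (pow k N).
Proof.
elim: n N => [|n IH] N; first exact: inj_pow.
move=> [I [N1 [u [v [uv iI /IH h]]]]].
by exists (pow k I), (pow k N1), (pmap k u), (pmap k v); split=> //;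
  [apply: pow_ses | apply: inj_pow].
Qed.

Lemma ext_fid n N A j : fid n N -> (n < j)%N -> Ext_eq0 j A N.
Proof.
elim: n N j => [|n IH] N [//|j] /=; first by move=> h _; apply: ext_injective.
move=> [I [N1 [u [v [uv iI /IH h]]]]]; rewrite ltnS => nj.
by apply: (ext_sub uv); [apply: h | apply: ext_injective].
Qed.

Lemma finite_injdim_fid N : finite_injdim N -> exists n, fid n N.
Proof.
move=> [I [n hn]]; exists n; elim: n N I hn => [|n IH] N I hn.
  have s : surjective_map (ir_aug I).
    by move=> y; apply/ir_exact0; apply: hn.
  by have /lmod_iso_sym/(@fid_iso 0) := bij_lmod_iso (@ir_inj _ _ I) s;
    apply; apply: ir_injective.
pose a := ir_aug I.
have ai : injective a := @ir_inj _ _ I.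
have [|b hb] := @factor_surj _ _ _ _ (coker a) (ir_diff I 0) (@coker_surj _ _ _ a).
  by move=> x /coker_exact[y <-]; apply/ir_exact0; exists y.
have bi : injective b.
  apply: lin_inj => x; have [y <-] := @coker_surj _ _ _ a x.
  by rewrite hb => /ir_exact0[z <-]; apply/coker_exact; exists z.
have e0 : exact_at b (ir_diff I 1).
  move=> y; split=> [/ir_exactS[x <-]|[x <-]]; first by exists (coker a x).
  by have [z <-] := @coker_surj _ _ _ a x; rewrite hb; apply/ir_exactS; exists z.
exists (ir_obj I 0), (Cokernel a), a, (coker a); split.
- exact: coker_ses.
- exact: ir_injective.
apply: (IH _ (InjResolution (fun i => @ir_injective _ _ I i.+1) bi e0
  (fun i => @ir_exactS _ _ I i.+1))) => i ni x.
exact: (hn i.+1).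
Qed.

Lemma fid_finite_injdim n N : fid n N -> finite_injdim N.
Proof.
move=> fN; suff [I hI] : exists I : inj_resolution N,
    forall i, (n < i)%N -> forall x : ir_obj I i, x = 0 by exists I, n.
elim: n N fN => [|n IH] N.
  move=> iN; pose ob i : lmodType R := if i is 0 then N else zmodl.
  pose df i : {linear ob i -> ob i.+1} := \0.
  have ii i : injective_module (ob i) by case: i => [|i] //; apply: inj_zmodl.
  have e0 : exact_at (idfun : {linear N -> ob 0%N}) (df 0%N).
    by move=> y; split=> _ //; exists y.
  have eS i : exact_at (df i) (df i.+1).
    by move=> y; split=> [_|_]; [exists 0 | ]; apply: zmodl0.
  exists (@InjResolution _ _ ob df idfun ii (fun x y e => e) e0 eS).
  by case=> // i _ x; apply: zmodl0.
move=> [I [N1 [u [v [uv iI /IH[J hJ]]]]]]; have [ui e vs] := uv.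
pose ob i : lmodType R := if i is j.+1 then ir_obj J j else I.
pose df i : {linear ob i -> ob i.+1} :=
  match i return {linear ob i -> ob i.+1} with
  | 0 => ir_aug J \o v | j.+1 => ir_diff J j end.
have ii i : injective_module (ob i) by case: i => [|i] //; apply: ir_injective.
have e0 : exact_at (u : {linear N -> ob 0%N}) (df 0%N).
  move=> y; split=> [/(lin_inj0 (@ir_inj _ _ J))/e //|/e h].
  by rewrite /= h linear0.
have eS i : exact_at (df i) (df i.+1).
  case: i => [|i]; last exact: ir_exactS.
  move=> y; split=> [/ir_exact0[x <-]|[x <-]].
    by have [z <-] := vs x; exists z.
  by apply/ir_exact0; exists (v x).
exists (@InjResolution _ _ ob df u ii ui e0 eS).
by case=> // i ni x; apply: hJ.
Qed.
End InjDim.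

(** * Depth *)

Section Depth.
Variables (R : comNzRingType) (m : idealr R).
Hypotheses (nR : noetherian R) (lR : local_with m).
Implicit Types A B C D M N : lmodType R.
Let k : lmodType R := residue m.

Definition dep t M := forall i, (i < t)%N -> Ext_eq0 i k M.

Lemma depth_geP M t : depth_ge m M t <-> dep t M.
Proof.
rewrite /depth_ge /depth; case: pselect => [ex|nex]; last first.
  by split=> // _ i _; apply: contrapT => h; apply: nex; exists i; apply/asboolP.
case: ex_minnP => e /asboolP ne emin; split=> [te i it|h].
  apply: contrapT => h; have := emin i (asboolT h).
  by rewrite leqNgt (leq_trans it te).
by rewrite leqNgt; apply/negP => /h.
Qed.

Lemma depth_some M t : depth m M = Some t -> dep t M /\ ~ Ext_eq0 t k M.
Proof.
rewrite /depth; case: pselect => // ex [<-].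
case: ex_minnP => e /asboolP ne emin; split=> // i ie.
by apply: contrapT => h; have := emin i (asboolT h); rewrite leqNgt ie.
Qed.

Fact to_k_lin : linear (fun a : R^o => to_residue m a : k).
Proof. by move=> a u v; rewrite rmorphD rmorphM. Qed.
Definition to_k : {linear R^o -> k} := mklin to_k_lin.

Lemma to_k_surj : surjective_map to_k.
Proof. by move=> x; have [a <-] := to_residue_surj x; exists a. Qed.

Lemma to_k0 a : to_k a = 0 <-> a \in m.
Proof. exact: to_residue_eq0. Qed.

Lemma fg_R : fin_gen R^o.
Proof.
exists 1%N, (fun _ => 1) => y; exists (fun _ => y).
by rewrite big_ord1 /GRing.scale /= mulr1.
Qed.

Lemma fg_k : fin_gen k.
Proof. exact: (fg_surj to_k_surj fg_R). Qed.

Lemma k_scale0 a (x : k) : a \in m -> a *: x = 0.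
Proof.
have [b <-] := to_k_surj x => am; rewrite -linearZ; apply/to_k0.
by rewrite -[a *: _]/(a * b) mulrC; apply: idealMr.
Qed.

Fact cyc_lin M (y : M) : linear (fun a : R^o => (a : R) *: y).
Proof. by move=> c u v; rewrite scalerDl scalerA. Qed.
Definition cyc M (y : M) : {linear R^o -> M} := mklin (cyc_lin y).

Lemma k_hom M (y : M) : (forall a, a \in m -> a *: y = 0) ->
  exists h : {linear k -> M}, h (to_k 1) = y.
Proof.
move=> hy; have [|h hh] := @factor_surj _ _ _ _ to_k (cyc y) to_k_surj.
  by move=> a /to_k0 /hy.
by exists h; rewrite hh mklinE scale1r.
Qed.

Lemma k_hom_inj M (h : {linear k -> M}) : h (to_k 1) <> 0 -> injective h.
Proof.
move=> h1; apply: lin_inj => x; have [a <-] := to_k_surj x => h0.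
apply: contrapT => /to_k0 /negP am; apply: h1.
have [b ab] := local_unit nR lR am.
by rewrite -ab mulrC -[_ * _]/(b *: (a : R^o)) !linearZ_LR h0 scaler0.
Qed.

Lemma k_hom0 M (h : {linear k -> M}) : h (to_k 1) = 0 -> forall x, h x = 0.
Proof.
move=> h1 x; have [a <-] := to_k_surj x.
by rewrite -[a]mulr1 -[_ * _]/(a *: (1 : R^o)) !linearZ_LR h1 scaler0.
Qed.

Lemma ext0_hom A N (h : {linear A -> N}) : fin_gen A -> Ext_eq0 0 A N -> forall x, h x = 0.
Proof.
move=> fA E x; have [P _] := fg_resolution nR fA.
have [y <-] := pr_surj P x; apply: (E P (h \o pr_aug P)) => z.
by rewrite /= pr_ad linear0.
Qed.

Lemma hom_ext0 A N : (forall (h : {linear A -> N}) x, h x = 0) -> Ext_eq0 0 A N.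
Proof.
by move=> h P f cf x; have [g hg] := pr_factor cf; rewrite -hg h.
Qed.

Lemma soc0 M (y : M) : Ext_eq0 0 k M -> (forall a, a \in m -> a *: y = 0) -> y = 0.
Proof. by move=> E /k_hom[h <-]; apply: (ext0_hom h fg_k E). Qed.

Lemma ext_k_scale i M (P : proj_resolution k) (f : {linear pr_obj P i -> M}) a :
  a \in m -> cocycle f -> coboundary (a \*: f : {linear _ -> _}).
Proof.
case: i f => [|i] f am cf /=.
  by have [g hg] := pr_factor cf => x; rewrite -hg -linearZ k_scale0 // linear0.
have [|g hg] := @scaled_coboundary _ _ P a \0 _ i M f cf; last by exists g.
by move=> x; rewrite linear0 k_scale0.
Qed.

Section Gens.
Variables (n : nat) (x : 'I_n -> R).
Hypothesis (xm : forall i, x i \in m).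

(** Each [x_j] kills [k], hence [Ext(k, D)]; so the map [Ext^(i+1)(k, D) -> Ext^(i+1)(k, D^n)] is
    zero and the connecting map from [Ext^i(k, C)] is onto. *)
Lemma ext_k_sub D C (v : {linear pow n D -> C}) i : ses (pscale x D) v ->
  Ext_eq0 i k C -> Ext_eq0 i.+1 k D.
Proof.
move=> uv E P f cf; apply: (res_sub uv); first exact: E.
have h j : exists g : {linear pr_obj P i -> D}, forall y, x j *: f y = g (pr_diff P i y).
  exact: (ext_k_scale (xm j) cf).
have [g hg] := choice h; exists (ptup g) => y.
by apply/ffunP=> j; rewrite pscaleE ptupE hg.
Qed.

Lemma ext_k_sub0 D : injective (pscale x D) -> Ext_eq0 0 k D.
Proof.
move=> xi; apply: hom_ext0 => h y; apply: xi; rewrite linear0.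
by apply/ffunP=> j; rewrite pscaleE -linearZ k_scale0 // linear0 ffunE.
Qed.

Lemma dep_coker D C (v : {linear pow n D -> C}) t : ses (pscale x D) v ->
  dep t.+1 D -> dep t C.
Proof.
move=> uv hD i it; apply: (ext_quot uv); last exact: hD.
by apply: ext_pow; apply: hD; apply: ltnW.
Qed.

Lemma dep_up D C (v : {linear pow n D -> C}) t : ses (pscale x D) v ->
  dep t C -> dep t.+1 D.
Proof.
move=> uv hC [_|i it]; last by apply: ext_k_sub uv _; apply: hC.
by have [ui _ _] := uv; apply: ext_k_sub0.
Qed.

Lemma soc_inj D : (forall a, a \in m -> exists c : 'I_n -> R, a = \sum_i c i * x i) ->
  Ext_eq0 0 k D -> injective (pscale x D).
Proof.
move=> hx E; apply: lin_inj => y /ffunP hy; apply: soc0 E _ => a /hx[c ->].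
rewrite scaler_suml big1 // => i _; rewrite -scalerA.
by have := hy i; rewrite pscaleE ffunE => ->; rewrite scaler0.
Qed.
End Gens.

Lemma dep_sub A B C (u : {linear A -> B}) (v : {linear B -> C}) t :
  ses u v -> dep t B -> dep t.-1 C -> dep t A.
Proof.
move=> uv hB hC [|i] it; first by have [ui _ _] := uv; apply: ext_sub0 ui _; apply: hB.
by apply: (ext_sub uv); [apply: hC; rewrite -ltnS (ltn_predK it) | apply: hB].
Qed.

Lemma dep_mid A B C (u : {linear A -> B}) (v : {linear B -> C}) t :
  ses u v -> dep t A -> dep t C -> dep t B.
Proof. by move=> uv hA hC i it; apply: (ext_mid uv); [apply: hA | apply: hC]. Qed.

Lemma dep_iso A B t : lmod_iso A B -> dep t A -> dep t B.
Proof. by move=> ab hA i it; apply: ext_isoR ab _; apply: hA. Qed.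

Lemma dep_pow n A t : dep t A -> dep t (pow n A).
Proof. by move=> hA i it; apply: ext_pow; apply: hA. Qed.

Lemma dep_le t t' A : (t' <= t)%N -> dep t A -> dep t' A.
Proof. by move=> tt hA i it; apply: hA; apply: leq_trans tt. Qed.

(** * From vanishing of Ext on the residue field to all finitely generated modules *)

Section Vanishing.
Variables (N : lmodType R) (r : nat).
Hypotheses (fN : fin_gen N) (hr : forall j, (r < j)%N -> Ext_eq0 j k N).

Let good A := forall j, (r < j)%N -> Ext_eq0 j A N.

Let good_mid A' A A'' (u : {linear A' -> A}) (v : {linear A -> A''}) :
  ses u v -> fin_gen A -> good A' -> good A'' -> good A.
Proof.
move=> uv fA g' g'' [//|j] rj; have [ui _ _] := uv.
by apply: (ext_midL nR uv (fg_inj nR ui fA)); [apply: g' | apply: g''].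
Qed.

Let good_triv A : (forall x : A, x = 0) -> good A.
Proof.
move=> A0 [//|j] _; apply: ext_proj => B C g h gs; exists \0 => x.
by rewrite /= (A0 x) !linear0.
Qed.

(* Noetherian induction on the annihilator of a generator. *)
Lemma good_cyclic A (x : A) : (forall y, exists c, y = c *: x) -> good A.
Proof.
move=> hx; apply: contrapT => nA.
have ann0 B (y : B) : (0 : R) *: y = 0 by rewrite scale0r.
have annP B (y : B) (a u v : R) : u *: y = 0 -> v *: y = 0 -> (a * u + v) *: y = 0.
  by move=> hu hv; rewrite scalerDl -scalerA hu hv scaler0 addr0.
pose ann B (y : B) := @mksub R R^o (fun c : R => c *: y = 0) (@ann0 B y) (@annP B y).
(* Annihilators of cyclic counterexamples; past a maximal one, [gd] says that cyclic modules with
   strictly larger annihilator are good. *)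
pose F (S : submod R^o) := exists A (x : A), [/\ forall y, exists c, y = c *: x,
  forall c : R, S c <-> c *: x = 0 & ~ good A].
have [|S [[{nA hx}A [{}x [hx hS nA]]] Smax]] := @max_submod R nR R^o F (ann A x) fg_R.
  by exists A, x; split.
have gd B (y : B) : (forall z, exists c, z = c *: y) ->
    (forall c : R, c *: x = 0 -> c *: y = 0) ->
    (exists2 c : R, c *: y = 0 & c *: x <> 0) -> good B.
  move=> hy xy [c cy cx]; apply: contrapT => nB; apply: cx; apply/hS.
  apply: (Smax (ann B y)) => //; first by exists B, y; split.
  by move=> e /hS; apply: xy.
have fA : fin_gen A.
  by exists 1%N, (fun _ => x) => y; have [c ->] := hx y; exists (fun _ => c); rewrite big_ord1.
apply: nA.
have [[c cm cx]|nc] := pselect (exists2 c, c \in m & c *: x <> 0); last first.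
  have kx a : a \in m -> a *: x = 0.
    by move=> am; apply: contrapT => h; apply: nc; exists a.
  have [x0|x0] := pselect (x = 0).
    by apply: good_triv => y; have [c ->] := hx y; rewrite x0 scaler0.
  have [h hh] := k_hom kx.
  have hi : injective h by apply: k_hom_inj; rewrite hh.
  have hs : surjective_map h.
    by move=> y; have [c ->] := hx y; exists (c *: to_k 1); rewrite linearZ_LR hh.
  by move=> j rj; apply: ext_isoL (bij_lmod_iso hi hs) _; apply: hr.
pose xs (i : 'I_1) := c.
(* If [c] is injective on [A], then [A/cA] has a larger annihilator, and Nakayama's lemma for Ext
   with the single element [c] returns to [A]. *)
have [ci|ci] := pselect (injective (pscale xs A)).
  move=> [//|j] rj; apply: (ext_nakayama nR lR (x := xs)) => //.
  pose w : pow 1 A := [ffun => x].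
  apply: (gd _ (coker (pscale xs A) w)); last exact: ltnW.
  - move=> z; have [u <-] := coker_surj z; have [e he] := hx (u ord0).
    exists e; rewrite -linearZ_LR; congr (coker _ _); apply/ffunP=> i.
    by rewrite !ffunE (ord1 i).
  - move=> e ex; rewrite -linearZ_LR; have -> : e *: w = 0 by apply/ffunP=> i; rewrite !ffunE.
    exact: linear0.
  - exists c => //; rewrite -linearZ_LR; apply/coker_exact; exists x.
    by apply/ffunP=> i; rewrite pscaleE !ffunE.
(* Otherwise [e] kills [c x] but not [x], so both [cA] and [A/cA] have larger annihilators. *)
have [e ex ecx] : exists2 e : R, e *: x <> 0 & e *: (c *: x) = 0.
  apply: contrapT => h; apply: ci; apply: lin_inj => y /ffunP/(_ ord0).
  rewrite pscaleE ffunE /xs; have [e ->] := hx y => he.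
  by apply: contrapT => h'; apply: h; exists e; rewrite // scalerA mulrC -scalerA.
pose T := img_sub (c \*: (idfun : {linear A -> A}) : {linear _ -> _}).
have [y hy] := (sm_inclP T (c *: x)).1 (ex_intro _ x erefl).
have Ti := @sm_incl_inj _ _ T.
apply: (good_mid (coker_ses Ti) fA).
- apply: (gd _ y).
  + move=> z; have /(sm_inclP T)[b hb] : exists t, sm_incl T t = sm_incl T z by exists z.
    have [a ha] := hx b; exists a; apply: Ti; rewrite -hb linearZ_LR hy ha /=.
    by rewrite !scalerA mulrC.
  + by move=> a ax; apply: Ti; rewrite linearZ_LR hy linear0 scalerA mulrC -scalerA ax scaler0.
  + by exists e => //; apply: Ti; rewrite linearZ_LR hy linear0.
- apply: (gd _ (coker (sm_incl T) x)).
  + move=> z; have [b <-] := coker_surj z; have [a ->] := hx b.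
    by exists a; rewrite linearZ_LR.
  + by move=> a ax; rewrite -linearZ_LR ax linear0.
  + by exists c => //; rewrite -linearZ_LR; apply/coker_exact; exists y.
Qed.

Lemma ext_fg_vanish A j : fin_gen A -> (r < j)%N -> Ext_eq0 j A N.
Proof.
move=> [n [x hx]]; suff : good A by apply.
elim: n A x hx => [|n IH] A x hx.
  by apply: good_triv => y; have [c ->] := hx y; rewrite big_ord0.
pose T := img_sub (comb (fun i => x (lift ord0 i))).
have Ti := @sm_incl_inj _ _ T.
apply: (good_mid (coker_ses Ti)); first by exists n.+1, x.
- have hT i : T (x (lift ord0 i)).
    exists (pin R^o i 1); rewrite combE (bigD1 i) //= pinE eqxx scale1r.
    by rewrite big1 ?addr0 // => l li; rewrite pinE (negPf li) scale0r.
  have [y hy] := choice (fun i => (sm_inclP T _).1 (hT i)).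
  apply: (IH _ y) => z.
  have /(sm_inclP T)[c hc] : exists t, sm_incl T t = sm_incl T z by exists z.
  exists c; apply: Ti; rewrite -hc combE linear_sum; apply: eq_bigr => i _.
  by rewrite linearZ_LR hy.
- apply: (@good_cyclic _ (coker (sm_incl T) (x ord0))) => z.
  have [y <-] := coker_surj z; have [c ->] := hx y; exists (c ord0).
  rewrite big_ord_recl linearD linearZ_LR -[RHS]addr0; congr (_ + _).
  apply/coker_exact; apply/(sm_inclP T).
  by exists [ffun i => c (lift ord0 i)]; rewrite combE; apply: eq_bigr => i _; rewrite ffunE.
Qed.
End Vanishing.

(* Applied to C = R it yields a module of projective dimension at most d into
   which k embeds, hence Ext^j(k, N) = 0 for j > d. *)
Lemma lower_depth N t C s : fin_gen C -> dep t C -> ~ Ext_eq0 t k C ->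
  (forall i, (s < i)%N -> Ext_eq0 i C N) ->
  exists C', [/\ fin_gen C', ~ Ext_eq0 0 k C' & forall i, (s + t < i)%N -> Ext_eq0 i C' N].
Proof.
have [n [x [xm hx]]] := ideal_gens m nR.
elim: t C s => [|t IH] C s fC dC nC hC; first by exists C; split=> //; rewrite addn0.
have xi : injective (pscale x C) by apply: soc_inj => //; apply: dC.
have uv := coker_ses xi.
have fC1 : fin_gen (Cokernel (pscale x C)) := fg_surj (@coker_surj _ _ _ _) (fg_pow n fC).
have [||i|C' [h1 h2 h3]] := IH _ s.+1 fC1.
- exact: dep_coker uv dC.
- by move=> E; apply: nC; apply: (ext_k_sub xm uv E).
- case: i => [//|[//|i]] si; apply: (ext_quotL nR uv fC (fg_pow n fC)).
    exact: hC.
  by apply: ext_powL => //; apply: hC; apply: ltnW.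
by exists C'; split=> //; rewrite addnS.
Qed.

Section DepthR.
Variable d : nat.
Hypothesis dR : depth m R^o = Some d.

Section FiniteInjDim.
Variables (N : lmodType R) (n : nat).
Hypotheses (fN : fin_gen N) (iN : fid n N).

(** As [k] embeds in [C] with [Ext^j(C, N) = 0] for [j > d], vanishing of [Ext^(j+1)(C/k, N)]
    suffices. It follows from vanishing on [k] in degrees above [j], whence a descending induction
    starting beyond [n]. *)
Lemma ext_k_fid j : (d < j)%N -> Ext_eq0 j k N.
Proof.
have [dep_R nR0] := depth_some dR.
have [|C [fC nC hC]] := @lower_depth N d R^o 0 fg_R dep_R nR0.
  by case=> // i _; apply: ext_proj; apply: proj_R.
have [h h1] : exists h : {linear k -> C}, h (to_k 1) <> 0.
  apply: contrapT => nh; apply: nC; apply: hom_ext0 => h; apply: k_hom0.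
  by apply: contrapT => h1; apply: nh; exists h.
have hi := k_hom_inj h1.
suff key e : forall j, (d < j)%N -> (n < j + e)%N -> Ext_eq0 j k N.
  by move=> dj; apply: (key n.+1) => //; rewrite addnS ltnS leq_addl.
elim: e => [|e IH] [//|i] di; first by rewrite addn0; apply: ext_fid.
move=> ni; apply: (ext_subL nR (coker_ses hi) fC); first exact: hC.
apply: (@ext_fg_vanish N i.+1) => //; last exact: (fg_surj (@coker_surj _ _ _ _) fC).
move=> l il; apply: IH; first exact: ltn_trans il.
by apply: leq_trans ni _; rewrite addnS ltn_add2r.
Qed.

(** Passing to the cokernel of [pscale x D] trades one unit of depth for one degree of Ext, until
    [ext_k_fid] applies in degrees above [d]. *)
Lemma ext_mcm_fid D i : fin_gen D -> dep d D -> Ext_eq0 i.+1 D N.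
Proof.
have [n' [x [xm hx]]] := ideal_gens m nR.
suff key t : forall D i, fin_gen D -> dep t D -> (d < i.+1 + t)%N -> Ext_eq0 i.+1 D N.
  by move=> fD dD; apply: (key d) => //; rewrite addSn ltnS leq_addl.
elim: t => [|t IH] {}D {}i fD dD.
  rewrite addn0 => di; apply: ext_fg_vanish di => //; exact: ext_k_fid.
move=> di; have xi : injective (pscale x D) by apply: soc_inj => //; apply: dD.
apply: (ext_nakayama nR lR fD fN xm xi); apply: IH; last by rewrite addSnnS.
- exact: (fg_surj (@coker_surj _ _ _ _) (fg_pow _ fD)).
- exact: dep_coker (coker_ses xi) dD.
Qed.
End FiniteInjDim.
End DepthR.

(** The first coefficient modulo [m] over a minimal generating system is well defined: a relation
    with a unit there would make that generator redundant. *)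
Lemma surj_k M (y : M) : fin_gen M -> y <> 0 ->
  exists p : {linear M -> k}, surjective_map p.
Proof.
move=> fM y0.
pose G n := `[< exists x : 'I_n -> M, forall y, exists c : 'I_n -> R, y = \sum_i c i *: x i >].
have exG : exists n, G n by have [n hn] := fM; exists n; apply/asboolP.
have [[|n] /asboolP[x hx] nmin] := ex_minnP exG.
  by case: y0; have [c ->] := hx y; rewrite big_ord0.
have cs : surjective_map (comb x).
  by move=> z; have [c ->] := hx z; exists [ffun i => c i]; rewrite combE;
    apply: eq_bigr => i _; rewrite ffunE.
have [|p hp] := @factor_surj _ _ _ _ (comb x) (to_k \o ppr R^o ord0) cs.
  move=> c; rewrite combE => hc; apply/to_k0.
  apply: contrapT => /negP /(local_unit nR lR)[b cb].
  have : (n.+1 <= n)%N; last by rewrite ltnn.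
  apply: nmin; apply/asboolP; exists (fun i => x (lift ord0 i)) => z.
  have [e ->] := hx z.
  have x0 : x ord0 = - \sum_(i < n) (b * c (lift ord0 i)) *: x (lift ord0 i).
    apply/eqP; rewrite -addr_eq0; apply/eqP.
    have := congr1 ( *:%R b) hc; rewrite scaler0 big_ord_recl scalerDr scalerA.
    have {}cb : b * c ord0 = 1 by rewrite mulrC.
    rewrite cb scale1r scaler_sumr => {2}<-; congr (_ + _).
    by apply: eq_bigr => i _; rewrite scalerA.
  exists (fun i => e (lift ord0 i) - e ord0 * (b * c (lift ord0 i))).
  rewrite big_ord_recl x0 scalerN scaler_sumr -sumrN -big_split.
  by apply: eq_bigr => i _; rewrite /= scalerBl !scalerA addrC mulrA.
exists p => z; have [a <-] := to_k_surj z.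
by exists (comb x (pin R^o ord0 a)); rewrite hp /= /ppr /= ffunE eqxx.
Qed.
End Depth.

(** * Maximal Cohen-Macaulay modules and duality *)

Section HomFunctor.
Variable R : comNzRingType.
Implicit Types A B C N : lmodType R.

Fact hprec_lin A B N (u : {linear A -> B}) :
  linear (fun f : LinHom B N => (hom_fun f \o u : {linear A -> N}) : LinHom A N).
Proof. by move=> a f g; apply: hom_ext. Qed.
Definition hprec A B N (u : {linear A -> B}) : {linear LinHom B N -> LinHom A N} :=
  mklin (@hprec_lin A B N u).

Lemma hprecE A B N (u : {linear A -> B}) (f : LinHom B N) x :
  hom_fun (hprec N u f) x = hom_fun f (u x).
Proof. by []. Qed.

Fact hom_ev_lin A N (x : A) : linear (fun f : LinHom A N => hom_fun f x).
Proof. by []. Qed.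

Fact ev_lin A N : linear (fun x : A =>
  (mklin (@hom_ev_lin A N x) : LinHom (LinHom A N) N)).
Proof. by move=> a x y; apply: hom_ext => f; rewrite /hom_fun /= linearP. Qed.
Definition ev A N : {linear A -> LinHom (LinHom A N) N} := mklin (@ev_lin A N).

Lemma evE A N (x : A) (f : LinHom A N) : hom_fun (ev A N x) f = hom_fun f x.
Proof. by []. Qed.

Lemma hprec_iso A B N : lmod_iso A B -> lmod_iso (LinHom A N) (LinHom B N).
Proof.
move=> [f [g [fg gf]]]; exists (hprec N g), (hprec N f).
by split=> h; apply: hom_ext => x; rewrite !hprecE ?fg ?gf.
Qed.

Lemma hprec_inj A B N (v : {linear A -> B}) : surjective_map v -> injective (hprec N v).
Proof.
move=> vs f g e; apply: hom_ext => y; have [x <-] := vs y.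
by rewrite -[LHS]hprecE e.
Qed.

Lemma hprec_exact A B C N (u : {linear A -> B}) (v : {linear B -> C}) :
  exact_at u v -> surjective_map v -> exact_at (hprec N v) (hprec N u).
Proof.
move=> e vs f; split=> [h|[g <-]]; last first.
  apply: hom_ext => x; rewrite !hprecE; have -> : v (u x) = 0 by apply/e; exists x.
  by rewrite /hom_fun linear0.
have [|g hg] := @factor_surj _ _ _ _ v (hom_fun f : {linear B -> N}) vs.
  by move=> b /e[x <-]; rewrite -[LHS]/(hom_fun (hprec N u f) x) h.
by exists (g : LinHom C N); apply: hom_ext => x; apply: hg.
Qed.

Lemma hom_ses A B C N (u : {linear A -> B}) (v : {linear B -> C}) : noetherian R ->
  ses u v -> fin_gen A -> fin_gen B -> Ext_eq0 1 C N -> ses (hprec N v) (hprec N u).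
Proof.
move=> nR uv fA fB E; have [ui e vs] := uv; split; first exact: hprec_inj.
- exact: hprec_exact.
- move=> f; have [g hg] := ext1_extend nR uv fA fB (hom_fun f : {linear A -> N}) E.
  by exists (g : LinHom B N); apply: hom_ext => x; apply: hg.
Qed.

Lemma pin_scale n (j : 'I_n) (c : R) : pin R^o j c = c *: pin R^o j 1.
Proof. by rewrite -linearZ_LR; congr (pin _ _ _); rewrite /GRing.scale /= mulr1. Qed.

Lemma hom_pow_iso n N : lmod_iso (LinHom (pow n R^o) N) (pow n N).
Proof.
have l : linear (fun h : LinHom (pow n R^o) N =>
    [ffun j => hom_fun h (pin R^o j 1)] : pow n N).
  by move=> a f g; apply/ffunP=> j; rewrite !ffunE.
apply: (@bij_lmod_iso _ _ _ (mklin l)).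
  move=> f g /ffunP e; apply: hom_ext => c.
  rewrite /hom_fun [in LHS]pow_linE [in RHS]pow_linE; apply: eq_bigr => j _.
  by rewrite pin_scale !linearZ_LR; congr (_ *: _); have := e j; rewrite !ffunE.
move=> y; exists (comb y : LinHom (pow n R^o) N); apply/ffunP=> j.
rewrite mklinE ffunE /hom_fun combE (bigD1 j) //= pinE eqxx scale1r.
by rewrite big1 ?addr0 // => i /negPf ij; rewrite pinE ij scale0r.
Qed.

Lemma ext1_sub A N' N N'' (u : {linear N' -> N}) (v : {linear N -> N''}) :
  ses u v -> Ext_eq0 1 A N ->
  (forall h : {linear A -> N''}, exists g : {linear A -> N}, forall x, v (g x) = h x) ->
  Ext_eq0 1 A N'.
Proof.
move=> uv E hl P f cf; have [ui e vs] := uv.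
have [x|h hh] := E P (u \o f); first by rewrite /= cf linear0.
have [x|k hk] := @pr_factor _ _ P _ (v \o h).
  by rewrite /= -hh (ses0 uv).
have [l hl'] := hl k.
have [|h' hh'] := @factor_inj _ _ _ _ u (h \- (l \o pr_aug P) : {linear _ -> _}) ui.
  by move=> x; apply/e; rewrite /= linearB hl' hk /= subrr.
exists h' => x; apply: ui; rewrite hh' /= pr_ad linear0 subr0.
exact: hh.
Qed.
End HomFunctor.

(** * Exchanging the arguments of [Ext^1] against a dual *)

Section Transposition.
Variables (R : comNzRingType) (nR : noetherian R).
Implicit Types A B C D N : lmodType R.
Variable O : lmodType R.
Local Notation dual D := (LinHom D O : lmodType R).

(** The module [B] is the coboundaries in [P_1^+]; it contains all cocycles as soon as [Ext^1(C, O)]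
    vanishes. *)
Lemma dual_res C (P : proj_resolution C) :
  exists (B : lmodType R) (p : {linear dual (pr_obj P 0) -> B})
    (i : {linear B -> dual (pr_obj P 1)}),
    [/\ ses (hprec O (pr_aug P)) p, injective i & forall x, i (p x) = hprec O (pr_diff P 0) x].
Proof.
have [B [p [i [ps ii hi]]]] := img_factor (hprec O (pr_diff P 0)).
exists B, p, i; split=> //; split=> //; first exact: hprec_inj (pr_surj P).
move=> y; rewrite -(@hprec_exact _ _ _ _ O _ _ (@pr_exact0 _ _ P) (pr_surj P)) -hi.
by split=> [->|/(lin_inj0 ii)]; rewrite ?linear0.
Qed.

Fact transp_lin A B N (f : {linear A -> LinHom B N}) :
  linear (fun b : B => (mklin (fun a u v =>
    congr1 (fun h : LinHom B N => hom_fun h b) (linearP f a u v)) : LinHom A N)).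
Proof.
move=> c b b'; apply: hom_ext => a; rewrite /hom_fun /= /hom_fun.
by rewrite linearP.
Qed.
Definition transp A B N (f : {linear A -> LinHom B N}) : {linear B -> LinHom A N} :=
  mklin (@transp_lin A B N f).

Lemma transpE A B N (f : {linear A -> LinHom B N}) a b :
  hom_fun (transp f b) a = hom_fun (f a) b.
Proof. by []. Qed.

(** A cocycle [P_1 -> D^+] is a map from [D] to the cocycles of [P_1^+], that is, to [B]. It lifts
    to [P_0^+], the obstruction lying in [Ext^1(D, C^+)], and the lift read as [P_0 -> D^+] bounds
    the cocycle. *)
Lemma ext1_transp C D : fin_gen D -> Ext_eq0 1 C O -> Ext_eq0 1 D (dual C) ->
  Ext_eq0 1 C (dual D).
Proof.
move=> fD EC ED P f cf.
have [B [p [i [sp ii hi]]]] := dual_res P.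
have [|h hh] := @factor_inj _ _ _ _ i (transp f) ii.
  move=> x; have [y|g hg] := EC P (hom_fun (transp f x)).
    by rewrite -[LHS]/(hom_fun (f (pr_diff P 1 y)) x) cf.
  exists (p (g : LinHom _ _)); rewrite hi; apply: hom_ext => y.
  by rewrite hprecE -[LHS]hg.
have [g hg] := ext1_lift nR h sp fD ED.
exists (transp g) => y; apply: hom_ext => x.
by rewrite transpE -[RHS]hprecE -hi hg hh transpE.
Qed.

(** A map [D -> B] gives a cocycle [P_1 -> D^+]; what bounds it is a lift to [P_0^+]. This suffices
    because [P_0^+] is a power of [O]. *)
Lemma ext1_transp_inv C D : fin_gen C -> Ext_eq0 1 D O -> Ext_eq0 1 C (dual D) ->
  Ext_eq0 1 D (dual C).
Proof.
move=> fC ED EC; have [P fP] := fg_resolution nR fC.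
have [B [p [i [sp ii hi]]]] := dual_res P.
apply: (ext1_sub sp).
  have [n Pn] := fP 0%N; apply: ext_isoR (hprec_iso O Pn) _.
  by apply: ext_isoR (lmod_iso_sym (hom_pow_iso n O)) _; apply: ext_pow.
move=> h; have [_ _ ps] := sp.
have [y|g hg] := EC P (transp (i \o h : {linear _ -> _})).
  apply: hom_ext => x; rewrite transpE /=.
  have [z <-] := ps (h x); rewrite hi hprecE pr_dd.
  by rewrite /hom_fun linear0.
exists (transp g) => x; apply: ii; rewrite hi; apply: hom_ext => y.
by rewrite hprecE transpE -hg transpE.
Qed.
End Transposition.

Section CohenMacaulay.
Variables (R : comNzRingType) (m : idealr R) (d : nat) (O : lmodType R).
Hypotheses (nR : noetherian R) (lR : local_with m) (dR : depth m R^o = Some d).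
Hypothesis dO : dualizing O.
Implicit Types A B C D I J M N Q X Y : lmodType R.
Local Notation dual D := (LinHom D O : lmodType R).
Let k : lmodType R := residue m.

Let fO : fin_gen O. Proof. by case: dO. Qed.
Let EO i : Ext_eq0 i.+1 O O. Proof. by case: dO => _ _ h _; apply: h. Qed.

Lemma fid_dualizing : exists n, fid n O.
Proof. by case: dO => _ /finite_injdim_fid. Qed.

Lemma homothety_iso : lmod_iso R^o (LinHom O O).
Proof.
case: dO => _ _ _ [g hg gh].
have l : linear (fun a : R^o => @homothety R O a).
  by move=> a u v; apply: hom_ext => x; rewrite /hom_fun /= scalerDl scalerA.
exact: (@bij_lmod_iso _ _ _ (mklin l) (can_inj hg) (fun y => ex_intro _ (g y) (gh y))).
Qed.

Lemma homothety_surj (f : {linear O -> O}) : exists a, forall x, f x = a *: x.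
Proof.
case: dO => _ _ _ [g hg gh]; exists (g f) => x.
by rewrite -[LHS]/(hom_fun (f : LinHom O O) x) -{1}[f : LinHom O O]gh.
Qed.

Lemma homothety_faithful a : (forall x : O, a *: x = 0) -> a = 0.
Proof.
case: dO => _ _ _ /bij_inj hi h; apply: hi; apply: hom_ext => x.
by rewrite /hom_fun /= h scale0r.
Qed.

(** Since [Hom(O, O) = R] has depth [d], it suffices that [C] is as deep as [Hom(O, C)] whenever
    [Ext(O, C)] vanishes in positive degrees, a form stable under passing to the cokernel of
    [pscale y C]. *)
Lemma dep_dualizing : dep m d O.
Proof.
have [x x0] : exists x : O, x <> 0.
  apply: contrapT => n; have /eqP := oner_neq0 R; apply.
  apply: homothety_faithful => y; apply: contrapT => y0; apply: n.
  by exists (1 *: y).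
have [p ps] := surj_k nR lR fO x0.
have [n [y [ym hy]]] := ideal_gens m nR.
suff key t C : (forall i, Ext_eq0 i.+1 O C) -> dep m t (LinHom O C) -> dep m t C.
  apply: key EO _; apply: dep_iso homothety_iso _.
  by have [] := depth_some dR.
elim: t C => [//|t IH] C EC hC.
have yi D : Ext_eq0 0 k D -> injective (pscale y D) by apply: soc_inj.
have E0 : Ext_eq0 0 k (LinHom O C) by apply: hC.
have E0C : Ext_eq0 0 k C.
  (* A map [k -> C] preceded by [O -> k] is an element of [Hom(O, C)] killed by [m]. *)
  apply: hom_ext0 => h z; have [w <-] := ps z.
  have e : (h \o p : LinHom O C) = 0.
    apply: soc0 E0 _ => // a am; apply: hom_ext => v.
    by rewrite -[LHS]/(a *: h (p v)) -linearZ_LR k_scale0 // linear0.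
  by rewrite -[LHS]/(hom_fun (h \o p : LinHom O C) w) e.
have uv := coker_ses (yi _ E0C); set v := coker _ in uv.
apply: (dep_up (x := y) ym uv); apply: IH.
  move=> i; apply: (ext_quot uv); last exact: EC.
  exact: ext_pow.
have [ui e vs] := uv.
have l : linear (fun g : pow n (LinHom O C) =>
    (v \o ptup (fun j => hom_fun (g j) : {linear O -> C}) : LinHom O (Cokernel (pscale y C)))).
  move=> a f g; apply: hom_ext => z; rewrite /hom_fun /= -linearP; congr (v _).
  by apply/ffunP=> j; rewrite !ffunE.
apply: (dep_coker (x := y) (v := mklin l) _ hC); split.
- exact: yi.
- move=> g; split=> [h|[f <-]]; last first.
    apply: hom_ext => z; apply/e; exists (hom_fun f z).
    by apply/ffunP=> j; rewrite !ffunE.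
  have hz z : exists c, pscale y C c = ptup (fun j => hom_fun (g j) : {linear O -> C}) z.
    by apply/e; rewrite -[RHS]/(hom_fun (0 : LinHom O (Cokernel (pscale y C))) z) -h.
  have [f hf] := factor_inj ui hz.
  exists (f : LinHom O C); apply/ffunP=> j; apply: hom_ext => z.
  rewrite pscaleE; have /ffunP/(_ j) := hf z; rewrite pscaleE ptupE; exact.
- move=> f.
  have [g hg] := ext1_lift nR (hom_fun f : {linear _ -> _}) uv fO (EC 0%N).
  exists [ffun j => (ppr C j \o g : LinHom O C)]; apply: hom_ext => z.
  rewrite -[RHS]hg; congr (v _); apply/ffunP=> j; rewrite !ffunE.
  by [].
Qed.

Definition mcm D := fin_gen D /\ dep m d D.

Lemma MCMP D : MCM m d D <-> mcm D.
Proof. by split=> -[h /depth_geP]. Qed.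

Lemma mcm_dualizing : mcm O.
Proof. by split=> //; apply: dep_dualizing. Qed.

Lemma mcm_iso A B : lmod_iso A B -> mcm A -> mcm B.
Proof. by move=> ab [h h']; split; [apply: fg_iso ab h | apply: dep_iso ab h']. Qed.

Lemma mcm_free n : mcm (pow n R^o).
Proof. by split; [apply: fg_pow1 | apply: dep_pow; have [] := depth_some dR]. Qed.

Lemma mcm_ext A B C (u : {linear A -> B}) (v : {linear B -> C}) :
  ses u v -> mcm A -> mcm C -> mcm B.
Proof. by move=> uv [h1 h2] [h3 h4]; split; [apply: fg_ext uv _ _ | apply: dep_mid uv _ _]. Qed.

Lemma mcm_syz A B C (u : {linear A -> B}) (v : {linear B -> C}) :
  ses u v -> mcm B -> mcm C -> mcm A.
Proof.
move=> uv [h1 h2] [h3 h4]; have [ui _ _] := uv; split; first exact: fg_inj ui h1.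
by apply: (dep_sub uv) => //; apply: dep_le h4; apply: leq_pred.
Qed.

Lemma ext_mcm D N n i : mcm D -> fin_gen N -> fid n N -> Ext_eq0 i.+1 D N.
Proof. by move=> [h1 h2] fN iN; apply: (ext_mcm_fid nR lR dR fN iN). Qed.

Lemma ext_mcm_dualizing D i : mcm D -> Ext_eq0 i.+1 D O.
Proof. by have [n iO] := fid_dualizing => hD; apply: ext_mcm hD fO iO. Qed.

Lemma mcm_pow_dual n : mcm (dual (pow n R^o)).
Proof.
apply: mcm_iso (lmod_iso_sym (hom_pow_iso n O)) _.
by split; [apply: fg_pow | apply: dep_pow dep_dualizing].
Qed.

(** Dualizing [0 -> S -> F -> D -> 0] puts [D^+] in [F^+] with cokernel [S^+], again the dual of a
    maximal CM module; each round gains one unit of depth. *)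
Lemma mcm_dual D : mcm D -> mcm (dual D).
Proof.
move=> hD; split; first by apply: fg_LinHom => //; case: hD.
suff key j : (j <= d)%N -> forall D, mcm D -> dep m j (dual D) by apply: key.
elim: j => [//|j IH] jd {hD}D hD.
have [/fin_genP[n [p ps]] _] := hD.
have hS := mcm_syz (ker_ses ps) (mcm_free n) hD.
have [fS _] := hS.
have ds := hom_ses nR (ker_ses ps) fS (fg_pow1 _ n) (@ext_mcm_dualizing _ 0 hD).
apply: (dep_sub ds); first by apply: dep_le jd _; have [] := mcm_pow_dual n.
by apply: IH hS; apply: ltnW.
Qed.

(** On the [j]-th copy of [O] the functional is an endomorphism of [O], hence a homothety [a_j]; it
    is evaluation at [(a_j)]. *)
Lemma ev_pow_surj n : surjective_map (ev (pow n R^o) O).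
Proof.
move=> xi.
have hl (j : 'I_n) : linear (fun w : O =>
    hom_fun xi (comb (fun i => if i == j then w else 0) : LinHom (pow n R^o) O)).
  move=> a u v; rewrite -[RHS]/(a *: (xi : {linear _ -> _}) _ + (xi : {linear _ -> _}) _).
  rewrite -linearP; congr (hom_fun xi _); apply: hom_ext => c.
  rewrite /hom_fun /= scaler_sumr -big_split; apply: eq_bigr => i _ /=.
  by case: eqP => _; rewrite ?scalerDr ?scaler0 ?addr0 // !scalerA mulrC.
have [a ha] := choice (fun j => homothety_surj (mklin (hl j))).
exists [ffun j => a j]; apply: hom_ext => g; rewrite evE.
have -> : g = \sum_j (comb (fun i => if i == j then hom_fun g (pin R^o j 1) else 0) :
    LinHom (pow n R^o) O).
  have hs (I : Type) (r : seq I) (F : I -> LinHom (pow n R^o) O) t :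
      hom_fun (\sum_(j <- r) F j) t = \sum_(j <- r) hom_fun (F j) t.
    by elim/big_rec2: _ => //= j u' v' _ <-.
  apply: hom_ext => c; rewrite hs /hom_fun [LHS]pow_linE; apply: eq_bigr => j _.
  rewrite combE (bigD1 j) //= eqxx big1 ?addr0; last first.
    by move=> i /negPf->; rewrite scaler0.
  rewrite -[pin_fun j (c j)]/(pin R^o j (c j)) pin_scale; exact: linearZ_LR.
set F := fun j => _.
have hs (I : Type) (r : seq I) (G : I -> LinHom (pow n R^o) O) t :
    hom_fun (\sum_(j <- r) G j) t = \sum_(j <- r) hom_fun (G j) t.
  by elim/big_rec2: _ => //= j u' v' _ <-.
rewrite hs [in RHS]/hom_fun linear_sum; apply: eq_bigr => j _.
have := ha j (hom_fun g (pin R^o j 1)); rewrite mklinE /hom_fun => ->.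
rewrite /F combE (bigD1 j) //= eqxx ffunE big1 ?addr0 // => i /negPf->.
by rewrite scaler0.
Qed.

Lemma ev_pow_inj n : injective (ev (pow n R^o) O).
Proof.
apply: lin_inj => c hc; apply/ffunP=> j; rewrite ffunE; apply: homothety_faithful => w.
pose g : LinHom (pow n R^o) O := comb (fun i => if i == j then w else 0).
have : hom_fun (ev (pow n R^o) O c) g = 0 by rewrite hc.
rewrite evE /hom_fun combE (bigD1 j) //= eqxx big1 ?addr0 // => i /negPf->.
by rewrite scaler0.
Qed.

(** The cokernel of [D^+] in [F^+] is maximal CM, so a functional on [D^+] extends to [F^+], where
    it is an evaluation. *)
Lemma ev_surj D : mcm D -> surjective_map (ev D O).
Proof.
move=> hD xi; have [fD _] := hD; have [n [p ps]] := (fin_genP D).1 fD.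
have hS := mcm_syz (ker_ses ps) (mcm_free n) hD; have [fS _] := hS.
have ds := hom_ses nR (ker_ses ps) fS (fg_pow1 _ n) (@ext_mcm_dualizing _ 0 hD).
have E1 : Ext_eq0 1 (dual (Ker p)) O by apply: ext_mcm_dualizing; apply: mcm_dual.
have [fDd _] := mcm_dual hD; have [fFd _] := mcm_pow_dual n.
have [xi' hxi] := ext1_extend nR ds fDd fFd (hom_fun xi : {linear _ -> _}) E1.
have [c hc] := ev_pow_surj (xi' : LinHom (LinHom (pow n R^o) O) O).
exists (p c); apply: hom_ext => g; rewrite evE -[RHS]hxi.
by rewrite -[xi' _]/(hom_fun (xi' : LinHom _ _) (hprec O p g)) -hc evE hprecE.
Qed.

(** If evaluation at [p c] is zero, evaluation at [c] descends to the dual of the syzygy, where it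
    is evaluation at some [s]; then [c = s] lies in the kernel of [p]. *)
Lemma ev_inj D : mcm D -> injective (ev D O).
Proof.
move=> hD; apply: lin_inj => y hy; have [fD _] := hD.
have [n [p ps]] := (fin_genP D).1 fD.
have hS := mcm_syz (ker_ses ps) (mcm_free n) hD; have [fS _] := hS.
have [_ e rs] := hom_ses nR (ker_ses ps) fS (fg_pow1 _ n) (@ext_mcm_dualizing _ 0 hD).
have [c hc] := ps y; move: hy; rewrite -hc => hy.
have [|z hz] := @factor_surj _ _ _ _ _ (hom_fun (ev _ O c) : {linear _ -> _}) rs.
  move=> g /e[f <-]; rewrite -[LHS]/(hom_fun (ev _ O (p c)) f) hy; reflexivity.
have [s hs] := ev_surj hS (z : LinHom _ _).
have -> : c = ker_incl p s.
  apply: ev_pow_inj; apply: hom_ext => g; rewrite -[LHS]hz.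
  by rewrite -[z _]/(hom_fun (z : LinHom _ _) (hprec O (ker_incl p) g)) -hs !evE.
exact: (ses0 (ker_ses ps)).
Qed.

Lemma bidual_iso D : mcm D -> lmod_iso D (dual (dual D)).
Proof. by move=> hD; apply: bij_lmod_iso (ev_inj hD) (ev_surj hD). Qed.

Lemma ses_isoL A A' B C (e : {linear A -> A'}) (u : {linear A' -> B}) (v : {linear B -> C}) :
  injective e -> surjective_map e -> ses u v -> ses (u \o e : {linear _ -> _}) v.
Proof.
move=> ei es [ui ex vs]; split=> //; first by move=> x y /= /ui/ei.
move=> y; split=> [/ex[x <-]|[x <-]]; last by apply/ex; exists (e x).
by have [z <-] := es x; exists z.
Qed.

(** The dual of a free cover of [D^+], so that [Q] is a power of [O]. *)
Lemma mcm_embed D : mcm D -> exists (Q Y : lmodType R) (u : {linear D -> Q}) (v : {linear Q -> Y}),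
  [/\ ses u v, mcm Q, mcm Y & exists n, fid n Q].
Proof.
move=> hD; have hDd := mcm_dual hD; have [fDd _] := hDd.
have [n [p ps]] := (fin_genP _).1 fDd.
have hS := mcm_syz (ker_ses ps) (mcm_free n) hDd; have [fS _] := hS.
have ds := hom_ses nR (ker_ses ps) fS (fg_pow1 _ n) (@ext_mcm_dualizing _ 0 hDd).
have := ses_isoL (ev_inj hD) (ev_surj hD) ds.
exists (dual (pow n R^o)), (dual (Ker p)), (hprec O p \o ev D O), (hprec O (ker_incl p)).
split=> //; [exact: mcm_pow_dual | exact: mcm_dual | have [a ha] := fid_dualizing; exists a].
by apply: fid_iso (lmod_iso_sym (hom_pow_iso n O)) _; apply: fid_pow.
Qed.

Definition approx M := exists (I Y : lmodType R) (u : {linear I -> Y}) (v : {linear Y -> M}),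
  [/\ ses u v, mcm Y, fin_gen I & exists n, fid n I].
Definition hull M := exists (J Y : lmodType R) (u : {linear M -> J}) (v : {linear J -> Y}),
  [/\ ses u v, mcm Y, fin_gen J & exists n, fid n J].

(** Pushout along the embedding of [Y] in [Q]: the resulting [J] is [Q/I], a quotient of modules of
    finite injective dimension. *)
Lemma approx_hull M : approx M -> hull M.
Proof.
move=> [I [Y [u [v [uv hY fI [a ia]]]]]]; have [ui e vs] := uv.
have [Q [Y' [f [g [fg hQ hY' [b ib]]]]]] := mcm_embed hY; have [fi _ _] := fg.
have [J [iA [iB po]]] := pushout_ex v f.
have [w [sw _]] := pushout_ses po fg.
have sI := pushout_surj po uv fi; have [_ _ iBs] := sI.
have [fQ _] := hQ.
exists J, Y', iA, w; split=> //; first exact: fg_surj iBs fQ.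
exact: fid_quot sI ia ib.
Qed.

(** The pushout [W] of the hull of [S] along [S -> F] is an extension of [M] by [J] and of [Y] by
    [F], both of these maximal CM. *)
Lemma hull_approx (S F M : lmodType R) (u : {linear S -> F}) (v : {linear F -> M}) :
  ses u v -> mcm F -> hull S -> approx M.
Proof.
move=> uv hF [J [Y [f [g [fg hY fJ iJ]]]]].
have [W [iA [iB po]]] := pushout_ex f u.
have [w [sw _]] := pushout_ses po uv.
have [w' [sw' _]] := pushout_ses (pushout_sym po) fg.
exists J, W, iA, w; split=> //; exact: mcm_ext sw' hF hY.
Qed.

Lemma approx_ex M : fin_gen M -> approx M.
Proof.
suff key t N : fin_gen N -> dep m (d - t) N -> approx N.
  by move=> fM; apply: (key d) => //; rewrite subnn.
elim: t N => [|t IH] N fN hN.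
  rewrite subn0 in hN; exists (zmodl R), N, \0, idfun; split=> //.
  - split=> [x y _|y|y]; [exact: zmodl0 | | by exists y].
    by split=> [/= ->|[x <-]//]; exists 0.
  - exact: fg_pow1.
  - by exists 0%N; apply: inj_zmodl.
have [n [p ps]] := (fin_genP N).1 fN.
apply: (hull_approx (ker_ses ps) (mcm_free n)); apply: approx_hull; apply: IH.
  exact: fg_inj (@sm_incl_inj _ _ (ker_sub p)) (fg_pow1 _ n).
apply: (dep_sub (ker_ses ps)).
  by have [_ h] := mcm_free n; apply: dep_le h; apply: leq_subr.
by rewrite -subnS.
Qed.
End CohenMacaulay.

(** * Special preenvelopes *)

Section Preenvelopes.
Variables (R : comNzRingType) (m : idealr R) (d : nat) (O : lmodType R).
Hypotheses (nR : noetherian R) (lR : local_with m) (dR : depth m R^o = Some d).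
Hypothesis dO : dualizing O.
Implicit Types A B C D I J M N Q X Y W : lmodType R.
Local Notation dual D := (LinHom D O : lmodType R).

Let fO : fin_gen O. Proof. by case: dO. Qed.
Let mcmO : mcm m d O := mcm_dualizing nR lR dR dO.
Let EmO D i (h : mcm m d D) : Ext_eq0 i.+1 D O := ext_mcm_dualizing nR lR dR dO h.

Section Fixed.
Variables (M X : lmodType R) (mu : {linear M -> X}).
Hypothesis pmu : MCM_preenvelope m d mu.

Let mX : mcm m d X. Proof. by have [/MCMP] := pmu. Qed.

Lemma fg_coker : fin_gen (Cokernel mu).
Proof. by have [h _] := mX; apply: fg_surj (@coker_surj _ _ _ mu) h. Qed.

(** A map from the image of [mu] to [O] factors, after composition with [M], through the
    preenvelope; so it extends to [X]. *)
Lemma preenvelope_ext1 : Ext_eq0 1 (Cokernel mu) O.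
Proof.
have [_ pm] := pmu; have [fX _] := mX.
have [Z [p [i [ps ii ip]]]] := img_factor mu.
have iv : ses i (coker mu).
  split=> //; last exact: coker_surj.
  move=> y; split=> [/coker_exact[x <-]|[z <-]]; first by exists (p x).
  by have [x <-] := ps z; apply/coker_exact; exists x; rewrite ip.
apply: (ext1_quotL nR iv (fg_inj nR ii fX) fX); first exact: EmO.
move=> z; have [f hf] := pm O (z \o p) ((MCMP _ _ _).2 mcmO).
exists f => t; have [x <-] := ps t.
by rewrite ip -hf.
Qed.

(** By biduality every maximal CM module is a dual. *)
Lemma dual_criterion :
  (forall D, mcm m d D -> Ext_eq0 1 D (dual (Cokernel mu))) -> special_MCM_preenvelope m d mu.
Proof.
move=> h; split=> // X' /MCMP mX'; have mD := mcm_dual nR lR dR dO mX'; have [fD _] := mD.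
apply: ext_isoR (lmod_iso_sym (bidual_iso nR lR dR dO mX')) _.
by apply: (ext1_transp nR fD preenvelope_ext1); apply: h.
Qed.

Lemma special_fid : special_MCM_preenvelope m d mu -> exists n, fid n (dual (Cokernel mu)).
Proof.
move=> [_ sp]; set N := LinHom _ _.
have E D : mcm m d D -> Ext_eq0 1 D N.
  move=> mD; apply: (ext1_transp_inv nR fg_coker); first exact: EmO.
  by apply: sp; apply/MCMP; exact: (mcm_dual nR lR dR dO mD).
have fN : fin_gen N by apply: fg_LinHom => //; exact: fg_coker.
have [J [Y [u [v [uv mY _ [n iJ]]]]]] := approx_hull nR lR dR dO (approx_ex nR lR dR dO fN).
have [ui e vs] := uv.
have [s hs] := ext1_lift nR (idfun : {linear Y -> Y}) uv mY.1 (E Y mY).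
have [|r hr] := @factor_inj _ _ _ _ u (idfun \- (s \o v) : {linear _ -> _}) ui.
  by move=> x; apply/e; rewrite /= linearB hs subrr.
exists n; apply: (@fid_retract _ _ _ _ u r) iJ => x; apply: ui.
by rewrite hr /= (ses0 uv) linear0 subr0.
Qed.
End Fixed.

Lemma special_preenvelope_ex M : fin_gen M ->
  exists (X : lmodType R) (mu : {linear M -> X}), special_MCM_preenvelope m d mu.
Proof.
move=> fM; have fMd : fin_gen (dual M) by apply: fg_LinHom.
have [I [Y [u [v [uv mY fI [n iI]]]]]] := approx_ex nR lR dR dO fMd.
have [ui e vs] := uv.
have mYd := mcm_dual nR lR dR dO mY.
pose mu : {linear M -> dual Y} := hprec O v \o ev M O.
have muE x y : hom_fun (mu x) y = hom_fun (v y) x by [].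
have pmu : MCM_preenvelope m d mu.
  split=> [|X' mu' /MCMP mX']; first exact/MCMP.
  have mX'd := mcm_dual nR lR dR dO mX'.
  (* The obstruction to lifting [X'^+ -> M^+] to [Y] lies in [Ext^1(X'^+, I) = 0]; the dual of the
     lift is the factorization, up to biduality of [X']. *)
  have [g hg] := ext1_lift nR (hprec O mu') uv mX'd.1 (ext_mcm nR lR dR mX'd fI iI).
  have [b [_ bev]] := bij_inv (ev_inj nR lR dR dO mX') (ev_surj nR lR dR dO mX').
  exists (b \o hprec O g : {linear _ -> _}) => x.
  apply: (ev_inj nR lR dR dO mX').
  rewrite -[in RHS]/(b (hprec O g (mu x))) bev; apply: hom_ext => xi.
  by rewrite hprecE muE hg hprecE.
exists (dual Y), mu; apply: dual_criterion => // D mD.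
have [b [evb bev]] := bij_inv (ev_inj nR lR dR dO mY) (ev_surj nR lR dR dO mY).
have vb f : v (b f) = hprec O mu f.
  by rewrite -[in RHS](bev f); apply: hom_ext => x.
(* Up to [Y = Y^++], the dual of the cokernel is the kernel of [Y -> M^+]; [w] identifies it with
   [I]. *)
have [|w hw] := @factor_inj _ _ _ _ u (b \o hprec O (coker mu)) ui.
  move=> f; apply/e; rewrite /= vb; apply: hom_ext => x.
  rewrite !hprecE (_ : coker mu (mu x) = 0); last by apply/coker_exact; exists x.
  by rewrite /hom_fun linear0.
have bi : injective b by apply: can_inj bev.
have wi : injective w.
  move=> f g e'; apply: (hprec_inj (@coker_surj _ _ _ mu)); apply: bi.
  by rewrite -[b _]hw -[b (hprec O _ g)]hw e'.
have ws : surjective_map w.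
  move=> i; have [|f hf] := (@hprec_exact _ _ _ _ O _ _ (@coker_exact _ _ _ mu) (@coker_surj _ _ _ mu) (ev Y O (u i))).1.
    by rewrite -vb evb (ses0 uv).
  by exists f; apply: ui; rewrite hw -[LHS]/(b (hprec O (coker mu) f)) hf evb.
apply: ext_isoR (lmod_iso_sym (bij_lmod_iso wi ws)) _.
exact: (ext_mcm nR lR dR mD fI iI).
Qed.

(* Wakamatsu's argument: an extension of Coker mu by X' is pulled back to X,
   where mu lifts into the pullback; the endomorphism of X obtained this way
   fixes mu, hence is invertible and yields a splitting. *)
Lemma envelope_special M X (mu : {linear M -> X}) :
  MCM_envelope m d mu -> special_MCM_preenvelope m d mu.
Proof.
move=> [pmu auto]; split=> // X' /MCMP mX' P f cf.
have [/MCMP mX pm] := pmu.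
set C := Cokernel mu in P f cf *.
have [Z [p [i [ps ii ip]]]] := img_factor (pr_diff P 0).
have iv : ses i (pr_aug P).
  split=> //; last exact: pr_surj.
  move=> y; split=> [/pr_exact0[x <-]|[z <-]]; first by exists (p x).
  by have [x <-] := ps z; rewrite ip pr_ad.
have [|f' hf'] := @factor_surj _ _ _ _ p f ps.
  move=> b pb; have /pr_exactS[x <-] : pr_diff P 0 b = 0 by rewrite -ip pb linear0.
  exact: cf.
(* The extension of the cokernel by [X'] with class [f]. Its pullback [W] to [X] is an extension of
   [X] by [X'], hence maximal CM. *)
have [E [iX [iP po]]] := pushout_ex f' i.
have [q [sq qP]] := pushout_ses po iv; have [iXi eq qs] := sq.
pose h : {linear (X * E)%type -> C} := cpair (coker mu) (\- q : {linear _ -> _}).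
pose W := Ker h; pose pw : {linear W -> (X * E)%type} := ker_incl h.
have pwi : injective pw := @sm_incl_inj _ _ (ker_sub h).
have hW (x : X) (e : E) : coker mu x = q e -> exists w, pw w = (x, e).
  move=> xe; apply/(sm_inclP (ker_sub h)).
  by rewrite -[sm_car _ _]/(coker mu x - q e = 0) xe subrr.
have Wh w : coker mu (pw w).1 = q (pw w).2.
  have /(sm_inclP (ker_sub h)) : exists w', pw w' = pw w by exists w.
  by move/eqP; rewrite -[h _]/(coker mu (pw w).1 - q (pw w).2) subr_eq0 => /eqP.
have [|a ha] := @factor_inj _ _ _ _ pw (linr X E \o iX) pwi.
  by move=> x; apply: hW; rewrite linear0 (ses0 sq).
pose b : {linear W -> X} := @fst X E \o pw.
have ab : ses a b.
  split.
  - move=> x y e; have := congr1 pw e; rewrite !ha => -[]; exact: iXi.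
  - move=> w; split=> [bw|[x <-]]; last by rewrite -[b _]/(pw (a x)).1 ha.
    have /eq[x ex] : q (pw w).2 = 0 by rewrite -Wh -[(pw w).1]/(b w) bw linear0.
    exists x; apply: pwi; rewrite ha [RHS]surjective_pairing -[(pw w).1]/(b w) bw -ex.
    by [].
  - move=> x; have [e he] := qs (coker mu x); have [w hw] := hW x e (esym he).
    by exists w; rewrite -[b _]/(pw w).1 hw.
have mW : mcm m d W := mcm_ext ab mX' mX.
have [|mu' hmu'] := @factor_inj _ _ _ _ pw (linl X E \o mu) pwi.
  by move=> x; apply: hW; rewrite linear0; apply/coker_exact; exists x.
have [phi hphi] := pm W mu' ((MCMP _ _ _).2 mW).
have bphi x : (b \o phi) (mu x) = mu x by rewrite -[LHS]/(b (phi (mu x))) -hphi -[b _]/(pw (mu' x)).1 hmu'.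
have [g fg gf] := auto (b \o phi) bphi.
have [g' [_ gg']] := bij_inv (can_inj fg) (fun y => ex_intro _ (g y) (gf y)).
(* A map over the cokernel that kills [mu]; it descends to a splitting of [E], and the resulting
   retraction onto [X'] bounds [f]. *)
pose s : {linear X -> E} := @snd X E \o pw \o phi \o g'.
have qsx x : q (s x) = coker mu x.
  by rewrite -[in RHS](gg' x) -[RHS]/(coker mu (pw (phi (g' x))).1) Wh.
have g'mu x : g' (mu x) = mu x.
  apply: (can_inj fg); exact: etrans (gg' _) (esym (bphi x)).
have smu x : s (mu x) = 0 by rewrite -[LHS]/(pw (phi (g' (mu x)))).2 g'mu -hphi hmu'.
have [|s' hs'] := @factor_surj _ _ _ _ (coker mu) s (@coker_surj _ _ _ mu).
  by move=> x /coker_exact[y <-].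
have [|r hr] := @factor_inj _ _ _ _ iX (idfun \- (s' \o q) : {linear _ -> _}) iXi.
  move=> e; apply/eq; rewrite /= linearB; have [x hx] := @coker_surj _ _ _ mu (q e).
  by rewrite -hx hs' qsx hx subrr.
exists (r \o iP) => x; apply: iXi; rewrite /= hr /= qP pr_ad linear0 subr0.
by rewrite -hf'; have [-> _ _] := po; rewrite ip.
Qed.
End Preenvelopes.

(** * Symmetric polynomials and interpolation *)

Section SymmetricDescent.
Variable n : nat.
Local Notation L := {mpoly int[n]}.
Definition elem_syms := [tuple mesym n int i.+1 | i < n].
(** The source is the ring of symmetric polynomials in disguise: its [i]-th variable stands for the
    elementary symmetric polynomial of degree [i + 1]. *)
Definition cmp : {rmorphism L -> L} := comp_mpoly elem_syms.

Lemma cmp_inj : injective cmp.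
Proof. exact: msym_fundamental_un. Qed.

Lemma descent (p : {poly L}) :
  (forall s, map_poly (@msym n int s) p = p) -> exists t, map_poly cmp t = p.
Proof.
move=> hp.
have hs i : p`_i \is symmetric.
  by apply/issymP => s; rewrite -{2}(hp s) coef_map.
exists (\poly_(i < size p) sval (sym_fundamental (hs i))).
apply/polyP => i; rewrite coef_map coef_poly; case: ltnP => h.
  by case: sym_fundamental => t [ht _] /=.
by rewrite [LHS]rmorph0 nth_default.
Qed.

Lemma map_cmp_inj : injective (map_poly cmp).
Proof. exact: map_inj_poly cmp_inj (rmorph0 _). Qed.

Lemma mpoly_rmorphE (K : comNzRingType) (phi : {rmorphism L -> K}) p :
  phi p = mmap intr (fun i => phi 'X_i) p.
Proof.
rewrite {1}(mpolyE p) rmorph_sum; apply: eq_bigr => u _.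
rewrite -mul_mpolyC rmorphM; congr (_ * _).
  have -> : (p@_u)%:MP_[n] = (p@_u)%:~R :> L by rewrite -{1}[p@_u]intz rmorph_int.
  exact: rmorph_int.
by rewrite mpolyXE_id rmorph_prod; apply: eq_bigr => i _; rewrite rmorphXn.
Qed.

Lemma mpoly_rmorph_eq (K : comNzRingType) (phi psi : {rmorphism L -> K}) :
  (forall i, phi 'X_i = psi 'X_i) -> phi =1 psi.
Proof.
move=> h p; rewrite [LHS]mpoly_rmorphE [RHS]mpoly_rmorphE; congr (mmap _ _ p).
exact/funext.
Qed.

Definition gpoly : {poly L} := \prod_(i < n) ('X - ('X_i)%:P).

(** The preimage under [cmp] of the elementary symmetric polynomial of degree [k]; variables are
    numbered from 0, hence the shift. *)
Definition yvar (k : nat) : L :=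
  if k is j.+1 then (if insub j is Some i then 'X_(i : 'I_n) else 0) else 1.

Definition gpoly_desc : {poly L} :=
  \sum_(k < n.+1) (-1) ^+ k *: (yvar k *: 'X^(n - k)).

Lemma cmp_yvar (k : 'I_n.+1) : cmp (yvar k) = mesym n int k.
Proof.
case: k => -[|k] /= h; first by rewrite rmorph1 mesym0E.
rewrite insubT /cmp comp_mpolyXU -tnth_nth tnth_mktuple.
by [].
Qed.

Lemma gpoly_descE : map_poly cmp gpoly_desc = gpoly.
Proof.
rewrite /gpoly Viete rmorph_sum; apply: eq_bigr => k _.
rewrite /= !map_polyZ rmorphXn rmorphN1 /= map_polyXn.
by rewrite -cmp_yvar.
Qed.

Section Sets.
Variable b : nat.
Local Notation I := {set 'I_n}.

Definition theta (A : I) : L := \prod_(i in A) 'X_i.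
Definition lag (A : I) : {poly L} := \prod_(B : I | (#|B| == b) && (B != A)) ('X - (theta B)%:P).
Definition bigP : {poly L} := \prod_(B : I | #|B| == b) ('X - (theta B)%:P).
(* Lagrange interpolation without its denominator: the value at [theta A] is
   [c A] times the derivative of [bigP] there. *)
Definition interp (c : I -> L) : {poly L} := \sum_(A : I | #|A| == b) c A *: lag A.
(* [c] is determined by a polynomial invariant under the stabilizer of one set
   of size b; this is what makes [interp c] symmetric. *)
Definition equi (c : I -> L) := forall (s : 'S_n) (A : I), #|A| = b -> msym s (c A) = c (s @: A).

Lemma msym_theta (s : 'S_n) (A : I) : msym s (theta A) = theta (s @: A).
Proof.
rewrite /theta rmorph_prod /= big_imset /=; last by move=> x y _ _; apply: perm_inj.
by apply: eq_bigr => i _; rewrite /msym mmapX mmap1U.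
Qed.

Lemma imset_permK (s : 'S_n) : cancel (fun A : I => s @: A) (fun A : I => (s^-1)%g @: A).
Proof.
move=> A; rewrite -imset_comp -[RHS]imset_id; apply: eq_imset => x /=.
exact: permK.
Qed.

Lemma imset_permKV (s : 'S_n) : cancel (fun A : I => (s^-1)%g @: A) (fun A : I => s @: A).
Proof.
move=> A; rewrite -imset_comp -[RHS]imset_id; apply: eq_imset => x /=.
exact: permKV.
Qed.

Lemma msym_XsubC (s : 'S_n) (A : I) :
  map_poly (msym s) ('X - (theta A)%:P) = 'X - (theta (s @: A))%:P.
Proof. by rewrite rmorphB /= map_polyX map_polyC /= msym_theta. Qed.

Lemma msym_bigP (s : 'S_n) : map_poly (msym s) bigP = bigP.
Proof.
rewrite /bigP rmorph_prod /=.
rewrite [RHS](reindex_onto _ _ (fun A _ => imset_permKV s A)) /=.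
apply: eq_big => A; last by rewrite msym_XsubC.
by rewrite imset_permK eqxx andbT card_imset //; apply: perm_inj.
Qed.

Lemma msym_lag (s : 'S_n) (A : I) : map_poly (msym s) (lag A) = lag (s @: A).
Proof.
rewrite /lag rmorph_prod /=.
rewrite [RHS](reindex_onto _ _ (fun A _ => imset_permKV s A)) /=.
apply: eq_big => B; last by rewrite msym_XsubC.
rewrite imset_permK eqxx andbT card_imset; last exact: perm_inj.
by rewrite (inj_eq (can_inj (imset_permK s))).
Qed.

Lemma msym_interp c s : equi c -> map_poly (msym s) (interp c) = interp c.
Proof.
move=> ec; rewrite /interp rmorph_sum /=.
rewrite [RHS](reindex_onto _ _ (fun A _ => imset_permKV s A)) /=.
apply: eq_big => A.
  by rewrite imset_permK eqxx andbT card_imset //; apply: perm_inj.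
by move=> /eqP hA; rewrite map_polyZ /= msym_lag ec.
Qed.

Lemma bigP_monic : bigP \is monic.
Proof. by apply: monic_prod => i _; apply: monicXsubC. Qed.

Lemma lag_mul (A B : I) : #|A| = b -> #|B| = b -> A != B ->
  lag A * lag B =
  bigP * \prod_(K : I | [&& #|K| == b, K != A & K != B]) ('X - (theta K)%:P).
Proof.
move=> hA hB AB; rewrite /bigP (bigD1 A) /=; last by rewrite hA.
rewrite -/(lag A).
have -> : lag B = ('X - (theta A)%:P) *
    \prod_(K : I | [&& #|K| == b, K != A & K != B]) ('X - (theta K)%:P).
  rewrite /lag (bigD1 A) /=; last by rewrite hA eqxx.
  by congr (_ * _); apply: eq_bigl => K; rewrite -andbA [(K != B) && _]andbC.
by rewrite mulrCA mulrA.
Qed.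

Definition one_fam (A : I) : L := 1.

(** Modulo [bigP] the products [lag A * lag B] with [A <> B] vanish, so both sides are the sum of
    the [c A * c' A * lag A ^ 2]. At a root of [bigP] with invertible denominator,
    [interp c / interp one_fam] is thus multiplicative in [c]. *)
Lemma interp_mul c c' : exists Q : {poly L},
  interp c * interp c' = interp (fun A => c A * c' A) * interp one_fam + bigP * Q.
Proof.
pose M A B : {poly L} :=
  \prod_(K : I | [&& #|K| == b, K != A & K != B]) ('X - (theta K)%:P).
exists (\sum_(A : I | #|A| == b) \sum_(B : I | #|B| == b)
   (if A == B then 0 else (c A * c' B - c A * c' A) *: M A B)).
rewrite /interp !big_distrlr /= mulr_sumr -big_split; apply: eq_bigr => A /eqP hA.
rewrite /= mulr_sumr -big_split; apply: eq_bigr => B /eqP hB /=.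
rewrite -!scalerAl -!scalerAr !scalerA.
have [<-|AB] := eqVneq A B; first by rewrite mulr0 addr0 mulr1.
by rewrite lag_mul // -/(M A B) -scalerAr -scalerDl mulr1 addrC subrK.
Qed.

Lemma equi_mul c c' : equi c -> equi c' -> equi (fun A => c A * c' A).
Proof. by move=> h h' s A hA; rewrite rmorphM /= h // h'. Qed.

Lemma equi_one : equi one_fam.
Proof. by move=> s A hA; rewrite rmorph1. Qed.

Lemma interp_sum (J : Type) (r : seq J) (c : J -> I -> L) :
  interp (fun A => \sum_(j <- r) c j A) = \sum_(j <- r) interp (c j).
Proof.
rewrite /interp exchange_big /=; apply: eq_bigr => A _.
by rewrite scaler_suml.
Qed.

Lemma interp_const e : interp (fun=> e) = e *: interp one_fam.
Proof. by rewrite /interp scaler_sumr; apply: eq_bigr => A _; rewrite scalerA mulr1. Qed.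

(** The identity descends with its cofactor: [Q] is symmetric because the monic [bigP] can be
    cancelled. *)
Lemma interp_mul_desc c c' : equi c -> equi c' -> exists t1 t2 t3 t4 P Q : {poly L},
  [/\ map_poly cmp t1 = interp c, map_poly cmp t2 = interp c',
      map_poly cmp t3 = interp (fun A => c A * c' A), map_poly cmp t4 = interp one_fam
    & map_poly cmp P = bigP /\ t1 * t2 = t3 * t4 + P * Q].
Proof.
move=> ec ec'; have [Q hQ] := interp_mul c c'.
have sQ s : map_poly (msym s) Q = Q.
  apply: (mulfI (monic_neq0 bigP_monic)).
  have := congr1 (map_poly (@msym n int s)) hQ.
  rewrite rmorphD !rmorphM /= !msym_interp ?msym_bigP //; last exact: equi_mul.
    by rewrite hQ => /addrI ->.
  exact: equi_one.
have [t1 h1] := descent (fun s => msym_interp s ec).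
have [t2 h2] := descent (fun s => msym_interp s ec').
have [t3 h3] := descent (fun s => msym_interp s (equi_mul ec ec')).
have [t4 h4] := descent (fun s => msym_interp s equi_one).
have [P hP] := descent msym_bigP.
have [q hq] := descent sQ.
exists t1, t2, t3, t4, P, q; split=> //; split=> //.
by apply: map_cmp_inj; rewrite rmorphD !rmorphM /= h1 h2 h3 h4 hP hq.
Qed.
End Sets.
End SymmetricDescent.

(** * Lifting coprime factorizations over henselian rings *)

Section HenselFactor.
Variables (R : comNzRingType) (m : idealr R).
Hypotheses (nR : noetherian R) (hm : henselian m).
Variables (a b : nat) (f : {poly R}).
Hypothesis fm : f \is monic.
Let k := residue m.
Let res : {rmorphism R -> k} := @to_residue R m.
Hypothesis fbar : map_poly res f = ('X - 1) ^+ b * 'X^a.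
Local Notation n := (b + a)%N.
Local Notation L := {mpoly int[n]}.
Local Notation I := {set 'I_n}.

(* the roots of f modulo m *)
Let xbar (i : 'I_n) : k := (i < b)%:R.
Let evx : {rmorphism L -> k} := mmap intr xbar.
(** The values that Viete's formulas assign to the elementary symmetric polynomials of the roots of
    [f]. *)
Let sp : {rmorphism L -> R} :=
  mmap intr (fun i : 'I_n => (-1) ^+ i.+1 * f`_(n - i.+1)).

Let size_f : size f = n.+1.
Proof.
have m1 : ('X - 1) ^+ b * 'X^a \is @monic k.
  by rewrite monicMl ?monicXn // monic_exp // -polyC1 monicXsubC.
have -> : size f = size (map_poly res f).
  by rewrite size_map_poly_id0 // (monicP fm) rmorph1 oner_neq0.
rewrite fbar size_monicM ?monicXn // -?size_poly_eq0 ?size_polyXn //.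
  by rewrite -polyC1 size_exp_XsubC addSn addnS.
by rewrite monic_exp // -polyC1 monicXsubC.
Qed.

Lemma gpoly_desc_coef (j : 'I_n.+1) : (gpoly_desc n)`_(n - j) = (-1) ^+ j * yvar n j.
Proof.
rewrite /gpoly_desc coef_sum (bigD1 j) //= !coefZ coefXn eqxx mulr1 big1 ?addr0 //.
move=> i ij; rewrite !coefZ coefXn.
have /negPf-> : (n - j != n - i)%N; last by rewrite !mulr0.
apply: contra ij => /eqP e; apply/eqP/val_inj.
by rewrite /= -(subKn (ltn_ord i : (i <= n)%N)) -e subKn // -ltnS.
Qed.

Lemma sp_gpoly : map_poly sp (gpoly_desc n) = f.
Proof.
apply/polyP => l; rewrite coef_map.
have [ln|nl] := leqP l n; last first.
  rewrite [f`__]nth_default ?size_f // /gpoly_desc coef_sum big1 => [|i _]; first exact: rmorph0.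
  rewrite !coefZ coefXn; have /negPf-> : (l != n - i)%N; last by rewrite !mulr0.
  by rewrite neq_ltn orbC (leq_ltn_trans (leq_subr i n) nl).
have jn : (n - l < n.+1)%N by rewrite ltnS leq_subr.
rewrite -(subKn ln) -[(n - l)%N]/(val (Ordinal jn)) gpoly_desc_coef /= rmorphM.
rewrite rmorphXn rmorphN1.
case: (n - l)%N jn => [|j] jn /=.
  by rewrite expr0 mul1r rmorph1 subn0 -[n]/(n.+1.-1) -size_f -lead_coefE (monicP fm).
by rewrite insubT /sp /= mmapX mmap1U /= mulrA -exprD -signr_odd addnn odd_double mul1r.
Qed.

Lemma prod_xbar : \prod_(i < n) ('X - (xbar i)%:P) = ('X - 1) ^+ b * 'X^a :> {poly k}.
Proof.
rewrite big_split_ord /=; congr (_ * _).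
  rewrite (eq_bigr (fun=> 'X - 1)) ?prodr_const ?card_ord // => i _.
  by rewrite /xbar /= ltn_ord.
rewrite (eq_bigr (fun=> 'X)) ?prodr_const ?card_ord // => i _.
by rewrite /xbar /= ltnNge leq_addr /= subr0.
Qed.

Lemma evx_gpoly : map_poly evx (gpoly n) = map_poly res f.
Proof.
rewrite fbar -prod_xbar /gpoly rmorph_prod /=; apply: eq_bigr => i _.
by rewrite rmorphB /= map_polyX map_polyC /= /evx /= mmapX mmap1U.
Qed.

(** Both sides agree on the variables, by comparing coefficients of the generic polynomial at the
    roots of [f] modulo [m]. *)
Lemma evx_cmp p : evx (@cmp n p) = res (sp p).
Proof.
apply: (@mpoly_rmorph_eq n k (evx \o @cmp n : {rmorphism _ -> _})
  (res \o sp : {rmorphism _ -> _})) => i /=.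
have jn : (i.+1 < n.+1)%N by rewrite ltnS.
have := evx_gpoly; rewrite -gpoly_descE -{1}sp_gpoly.
move/(congr1 (fun q : {poly k} => q`_(n - i.+1))).
rewrite !coef_map -[i.+1]/(val (Ordinal jn)) !gpoly_desc_coef /= valK.
rewrite !rmorphM !rmorphXn !rmorphN1.
by move/(congr1 ( *%R ((-1) ^+ i.+1))); rewrite !mulrA -!exprD -signr_odd addnn odd_double !mul1r.
Qed.

Let I0 : I := [set i : 'I_n | (i < b)%N].

Let card_I0 : #|I0| = b.
Proof.
have -> : I0 = (@lshift b a) @: setT.
  apply/setP => i; rewrite inE; apply/idP/imsetP => [ib|[j _ ->]]; last exact: (ltn_ord j).
  by exists (Ordinal ib) => //; apply: val_inj.
by rewrite card_imset ?cardsT ?card_ord //; apply: lshift_inj.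
Qed.

Let evx_theta (A : I) : #|A| = b -> evx (theta A) = (A == I0)%:R.
Proof.
move=> hA; rewrite /theta rmorph_prod /=.
have e i : evx 'X_i = xbar i by rewrite /evx /= mmapX mmap1U.
have [->|AI] := eqVneq.
  by rewrite big1 // => i; rewrite inE e /xbar => ->.
have /subsetPn[i iA] : ~~ (A \subset I0).
  by apply: contra AI => AI; rewrite eqEcard AI hA card_I0 /=.
by rewrite inE => ib; rewrite (bigD1 i) //= e /xbar (negPf ib) mul0r.
Qed.

Let evXC p : map_poly evx ('X - p%:P) = 'X - (evx p)%:P.
Proof. by rewrite rmorphB /= map_polyX map_polyC. Qed.

Let evXprod (Pr : pred I) (F : I -> L) : map_poly evx (\prod_(B : I | Pr B) ('X - (F B)%:P)) =
  \prod_(B : I | Pr B) ('X - (evx (F B))%:P).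
Proof. by rewrite rmorph_prod; apply: eq_bigr => B _; apply: evXC. Qed.

(** At 1 the factor of [I0] kills [lag A] for [A <> I0], while every factor of [lag I0] becomes
    1. *)
Let interp_at (c : I -> L) : (map_poly evx (interp b c)).[1] = evx (c I0).
Proof.
rewrite /interp rmorph_sum horner_sum (bigD1 I0) ?card_I0 //= big1 ?addr0.
  rewrite map_polyZ hornerZ evXprod horner_prod big1 ?mulr1 // => B /andP[/eqP hB BI].
  by rewrite !hornerE evx_theta // (negPf BI) subr0.
move=> A /andP[/eqP hA AI]; rewrite map_polyZ hornerZ evXprod horner_prod.
rewrite (bigD1 I0) /=; last by rewrite card_I0 eqxx eq_sym.
rewrite !hornerE evx_theta ?card_I0 // eqxx subrr.
by rewrite /= mulr0 mul0r.
Qed.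

(** By [evx_theta], [bigP] reduces to [t - 1] times a power of [t], so 1 is a simple root. *)
Lemma simple_root_lift : exists P c, [/\ map_poly (@cmp n) P = bigP n b,
  (map_poly sp P).[c] = 0 & res c = 1].
Proof.
have [P hP] := descent (@msym_bigP n b).
have mP : P \is monic.
  apply/monicP/(@cmp_inj n); rewrite rmorph1 -lead_coef_map_inj ?rmorph0 //.
    by rewrite hP; apply/monicP/bigP_monic.
  exact: cmp_inj.
have ebar : map_poly res (map_poly sp P) = map_poly evx (bigP n b).
  rewrite -hP -!map_poly_comp; apply: eq_map_poly => p /=.
  by rewrite evx_cmp.
have ebar' : map_poly evx (bigP n b) = ('X - 1%:P) *
    \prod_(B : I | (#|B| == b) && (B != I0)) ('X - (evx (theta B))%:P).
  by rewrite evXprod (bigD1 I0) ?card_I0 //= evx_theta ?card_I0 // eqxx.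
have [||c [hc ec]] := hm.2 (map_poly sp P) (1 : k) (monic_map _ mP).
- by rewrite ebar ebar' hornerM !hornerE subrr mul0r.
- rewrite ebar ebar' derivM derivXsubC mul1r hornerD hornerM !hornerE subrr mul0r addr0.
  rewrite horner_prod big1 ?oner_neq0 // => B /andP[/eqP hB BI].
  by rewrite !hornerE evx_theta // (negPf BI) subr0.
by exists P, c.
Qed.

Lemma hensel_factor : exists g h : {poly R}, [/\ f = g * h,
  map_poly res g = ('X - 1) ^+ b & map_poly res h = 'X^a].
Proof.
have [P [c [hP Pc c1]]] := simple_root_lift.
have [t4 h4] := descent (fun s => msym_interp s (@equi_one n b)).
pose ev (t : {poly L}) := (map_poly sp t).[c].
have resev t : res (ev t) = (map_poly evx (map_poly (@cmp n) t)).[1].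
  rewrite /ev -horner_map c1 -!map_poly_comp; congr (_.[_]).
  by apply: eq_map_poly => p /=; rewrite evx_cmp.
have [D' hD'] : exists D', ev t4 * D' = 1.
  apply: (local_unit nR hm.1); apply/negP => /to_residue_eq0.
  rewrite -[to_residue m _]/(res _) resev h4 interp_at rmorph1.
  by apply/eqP/oner_neq0.
have canD x y : x * ev t4 = y * ev t4 -> x = y.
  by move=> e; rewrite -[x]mulr1 -[y]mulr1 -hD' !mulrA e.
(* [V w r]: the family [w] specializes to [r], the value at [c] of its
   interpolating polynomial divided by that of the denominator. *)
pose V (w : I -> L) r := exists2 t, map_poly (@cmp n) t = interp b w & ev t = r * ev t4.
have V_ex w : equi b w -> exists r, V w r.
  move=> ew; have [t ht] := descent (fun s => msym_interp s ew).
  by exists (ev t * D'), t => //; rewrite -mulrA [D' * _]mulrC hD' mulr1.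
have V_uniq w w' r r' : interp b w = interp b w' -> V w r -> V w' r' -> r = r'.
  move=> e [t ht hr] [t' ht' hr']; apply: canD; rewrite -hr -hr'; congr (ev _).
  by apply: (@map_cmp_inj n); rewrite ht ht'.
have V_res w r : V w r -> res r = evx (w I0).
  move=> [t ht hr]; have := resev t; rewrite ht interp_at => <-; rewrite hr rmorphM.
  by rewrite resev h4 interp_at rmorph1 mulr1.
have V_mul w w' r r' : equi b w -> equi b w' -> V w r -> V w' r' ->
    V (fun A => w A * w' A) (r * r').
  move=> ew ew' [t ht hr] [t' ht' hr'].
  have [t1 [t2 [t3 [t4' [P' [Q [h1 h2 h3 h4' [hP' e]]]]]]]] := interp_mul_desc ew ew'.
  have cI p q : map_poly (@cmp n) p = map_poly (@cmp n) q -> p = q by apply: map_cmp_inj.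
  have e1 : t1 = t by apply: cI; rewrite h1.
  have e2 : t2 = t' by apply: cI; rewrite h2.
  have e4 : t4' = t4 by apply: cI; rewrite h4'.
  have eP : P' = P by apply: cI; rewrite hP'.
  subst; exists t3 => //; apply: canD.
  have := congr1 ev e; rewrite /ev !rmorphD !rmorphM /= !hornerE Pc mul0r addr0 => <-.
  by rewrite -!/(ev _) hr hr' mulrACA mulrA.
have V_sum l (w : 'I_l -> I -> L) (r : 'I_l -> R) : (forall j, V (w j) (r j)) ->
    V (fun A => \sum_j w j A) (\sum_j r j).
  move=> h; have /choice[t ht] : forall j, exists t : {poly L},
      map_poly (@cmp n) t = interp b (w j) /\ ev t = r j * ev t4.
    by move=> j; have [t h1 h2] := h j; exists t.
  exists (\sum_j t j).
    by rewrite rmorph_sum interp_sum; apply: eq_bigr => j _; apply: (ht j).1.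
  rewrite /ev rmorph_sum horner_sum mulr_suml; apply: eq_bigr => j _.
  exact: (ht j).2.
have V_const e : V (fun=> @cmp n e) (sp e).
  exists (e *: t4); first by rewrite map_polyZ /= h4 -interp_const.
  by rewrite /ev map_polyZ hornerZ.
pose G (A : I) : {poly L} := \prod_(i in A) ('X - ('X_i)%:P).
have mG s A : map_poly (msym s) (G A) = G (s @: A).
  rewrite /G rmorph_prod /= big_imset /=; last by move=> x y _ _; apply: perm_inj.
  apply: eq_bigr => i _; rewrite rmorphB /= map_polyX map_polyC /=.
  by rewrite /msym mmapX mmap1U.
have setCs (s : 'S_n) A : s @: (~: A) = ~: (s @: A).
  apply/setP => x; rewrite -[x](permKV s) !inE !mem_imset ?inE //; exact: perm_inj.
(* Coefficients of the generic factor with roots in [A] and of the complementary one; permuting the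
   roots permutes [A]. *)
pose gf j (A : I) := (G A)`_j; pose hf j (A : I) := (G (~: A))`_j.
have egf j : equi b (gf j) by move=> s A hA; rewrite /gf -mG coef_map.
have ehf j : equi b (hf j) by move=> s A hA; rewrite /hf -setCs -mG coef_map.
have [r hr] := choice (fun j => V_ex _ (egf j)).
have [s hs] := choice (fun j => V_ex _ (ehf j)).
have sG A : size (G A) = #|A|.+1.
  by rewrite /G -big_enum size_prod_XsubC -cardE.
(* Values [r j] and [s j] exist for all [j]; beyond the degrees of the factors they must vanish for
   the truncations to lose nothing. *)
have zero (w : I -> L) x : (forall A : I, #|A| = b -> w A = 0) -> V w x -> x = 0.
  move=> w0 hx; rewrite (V_uniq w (fun=> @cmp n 0) x (sp 0) _ hx (V_const 0)) ?rmorph0 //.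
  by apply: eq_bigr => A /eqP hA; rewrite w0 // rmorph0.
pose g := \poly_(j < b.+1) r j; pose h := \poly_(j < a.+1) s j.
have gE j : g`_j = r j.
  rewrite coef_poly; case: ltnP => // bj; rewrite (zero (gf j) (r j) _ (hr j)) // => A hA.
  by rewrite /gf nth_default // sG hA.
have hE j : h`_j = s j.
  rewrite coef_poly; case: ltnP => // aj; rewrite (zero (hf j) (s j) _ (hs j)) // => A hA.
  rewrite /hf nth_default // sG; have := cardsC A; rewrite hA card_ord => /addnI ->.
  exact: aj.
exists g, h; split.
- apply/polyP => l; rewrite coefM.
  have hV : V (fun A => \sum_(j < l.+1) gf j A * hf (l - j)%N A) (\sum_(j < l.+1) g`_j * h`_(l - j)).
    by apply: V_sum => j; rewrite gE hE; apply: V_mul.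
  (* For every [A] the two factors multiply to the generic polynomial, so this family is constant
     and its value is a coefficient of [f]. *)
  rewrite -[in LHS]sp_gpoly coef_map; apply: (V_uniq _ _ _ _ _ (V_const _) hV).
  apply: eq_bigr => A _; congr (_ *: _); rewrite -coefM -coef_map gpoly_descE.
  suff -> : gpoly n = G A * G (~: A) by [].
  rewrite /gpoly (bigID (mem A)) /=; congr (_ * _).
  by apply: eq_bigl => i; rewrite inE.
- apply/polyP => j; rewrite coef_map gE; apply: (etrans (V_res _ _ (hr j))); rewrite /gf -coef_map.
  congr (_`_j); rewrite /G rmorph_prod /= (eq_bigr (fun=> 'X - 1)).
    by rewrite prodr_const card_I0.
  move=> i; rewrite inE => ib; rewrite rmorphB /= map_polyX map_polyC /= /evx /= mmapX mmap1U.
  by rewrite /xbar ib.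
- apply/polyP => j; rewrite coef_map hE; apply: (etrans (V_res _ _ (hs j))); rewrite /hf -coef_map.
  congr (_`_j); rewrite /G rmorph_prod /= (eq_bigr (fun=> 'X)).
    have := cardsC I0; rewrite card_I0 card_ord => /addnI e.
    by rewrite prodr_const e.
  move=> i; rewrite !inE => ib; rewrite rmorphB /= map_polyX map_polyC /= /evx /= mmapX mmap1U.
  by rewrite /xbar (negPf ib) subr0.
Qed.
End HenselFactor.

(** * Polynomials in an endomorphism *)

Lemma monic_comp (R : nzRingType) (p q : {poly R}) :
  p \is monic -> q \is monic -> (1 < size q)%N -> p \Po q \is monic.
Proof.
move=> pm qm q1; pose k := (size p).-1.
have sp : size p = k.+1 by rewrite prednK // lt0n size_poly_eq0 monic_neq0.
have ep : p = 'X^k + take_poly k p.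
  apply/polyP => i; rewrite coefD coefXn coef_take_poly.
  case: (ltngtP i k) => h; rewrite ?add0r ?addr0 //.
    by rewrite nth_default // sp.
  by rewrite h -[p`_k]/(lead_coef p) (monicP pm).
have [k0|k0] := posnP k.
  by move: ep; rewrite k0 expr0 take_poly0l addr0 => ->; rewrite comp_polyC monic1.
rewrite ep comp_polyD comp_Xn_poly monicE lead_coefDl; first by rewrite -monicE monic_exp.
have -> : size (q ^+ k) = ((size q).-1 * k).+1.
  elim: (k) => [|j IH]; first by rewrite expr0 size_poly1 muln0.
  by rewrite exprS size_monicM ?monic_neq0 ?monic_exp // IH mulnS -(ltn_predK q1) addSn addnS.
rewrite ltnS; apply: leq_trans (size_comp_poly_leq _ _) _.
rewrite mulnC ltn_mul2l -ltnS (ltn_predK q1) q1 /=.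
have := size_take_poly k p; case: (size _) => [|j] //=.
Qed.

Section PolyAction.
Variables (R : comNzRingType) (X : lmodType R) (phi : {linear X -> X}).
Implicit Types p q : {poly R}.

Definition pact p (y : X) : X := \sum_(i < size p) p`_i *: iter i phi y.

Lemma pactE p n y : (size p <= n)%N -> pact p y = \sum_(i < n) p`_i *: iter i phi y.
Proof.
move=> pn; rewrite /pact (big_ord_widen n (fun i => p`_i *: iter i phi y)) //.
rewrite [RHS](bigID (fun i : 'I_n => (i < size p)%N)) /= [X in _ = _ + X]big1 ?addr0 //.
by move=> i; rewrite -leqNgt => h; rewrite nth_default // scale0r.
Qed.

Fact pact_lin p : linear (pact p).
Proof.
have il i : linear (iter i phi).
  by elim: i => [//|i IH] a u v /=; rewrite IH linearP.
move=> a u v; rewrite /pact scaler_sumr -big_split; apply: eq_bigr => i _.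
by rewrite il scalerDr !scalerA mulrC.
Qed.

Lemma pact_zero p : pact p 0 = 0.
Proof. exact: linear0 (mklin (pact_lin p)). Qed.

Lemma pactD p q y : pact (p + q) y = pact p y + pact q y.
Proof.
pose n := maxn (size p) (size q).
rewrite !(@pactE _ n) ?leq_maxl ?leq_maxr //; last exact: size_polyD.
by rewrite -big_split; apply: eq_bigr => i _; rewrite coefD scalerDl.
Qed.

Lemma pactCM c p y : pact (c%:P * p) y = c *: pact p y.
Proof.
rewrite !(@pactE _ (size p)) //; last by rewrite mul_polyC; apply: size_scale_leq.
by rewrite scaler_sumr; apply: eq_bigr => i _; rewrite coefCM scalerA.
Qed.

Lemma pactN p y : pact (- p) y = - pact p y.
Proof. by rewrite -mulN1r -[1]/(1%:P) -polyCN pactCM scaleN1r. Qed.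

Lemma pactXM p y : pact ('X * p) y = phi (pact p y).
Proof.
rewrite (@pactE _ (size p).+1); last first.
  by apply: leq_trans (size_polyMleq _ _) _; rewrite size_polyX.
rewrite big_ord_recl coefXM scale0r add0r linear_sum; apply: eq_bigr => i _.
by rewrite coefXM /= linearZ_LR.
Qed.

Lemma pact0 y : pact 0 y = 0.
Proof. by rewrite /pact size_poly0 big_ord0. Qed.

Lemma pact1 y : pact 1 y = y.
Proof. by rewrite /pact size_poly1 big_ord1 coef1 scale1r. Qed.

Lemma pactM p q y : pact (p * q) y = pact p (pact q y).
Proof.
elim/poly_ind: p q y => [|p c IH] q y; first by rewrite mul0r !pact0.
rewrite mulrDl -mulrA !pactD pactCM -[c%:P]mulr1 pactCM pact1; congr (_ + _).
by rewrite !IH pactXM -[in RHS](mulr1 'X) pactXM pact1.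
Qed.

Lemma pactX y : pact 'X y = phi y.
Proof. by rewrite -[X in pact X]mulr1 pactXM pact1. Qed.

Lemma pact_eigen p l y : phi y = l *: y -> pact p y = p.[l] *: y.
Proof.
move=> h; have it i : iter i phi y = l ^+ i *: y.
  by elim: i => [|i /= ->]; rewrite ?scale1r // linearZ_LR h scalerA exprSr.
rewrite /pact horner_coef scaler_suml; apply: eq_bigr => i _.
by rewrite it scalerA.
Qed.

(** Cayley-Hamilton without freeness: [A] is any matrix expressing [phi] on generators. *)
Lemma pact_char n (A : 'M[R]_n.+1) (x : 'I_n.+1 -> X) :
  (forall i, phi (x i) = \sum_j A i j *: x j) ->
  (forall y, exists c : 'I_n.+1 -> R, y = \sum_i c i *: x i) ->
  forall y, pact (char_poly A) y = 0.
Proof.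
move=> hA hx y; pose cv (v : 'rV[R]_n.+1) := \sum_i v 0 i *: x i.
have step v : phi (cv v) = cv (v *m A).
  rewrite /cv linear_sum; under eq_bigr => i _ do rewrite linearZ_LR hA scaler_sumr.
  rewrite exchange_big; apply: eq_bigr => j _; rewrite mxE scaler_suml.
  by apply: eq_bigr => i _; rewrite scalerA.
have cvD u v : cv (u + v) = cv u + cv v.
  by rewrite /cv -big_split; apply: eq_bigr => i _; rewrite mxE scalerDl.
have cvZ c v : cv (c *: v) = c *: cv v.
  by rewrite /cv scaler_sumr; apply: eq_bigr => i _; rewrite mxE scalerA.
have key p v : pact p (cv v) = cv (v *m horner_mx A p).
  elim/poly_ind: p v => [|p c IH] v.
    rewrite pact0 rmorph0 mulmx0 /cv big1 // => i _; by rewrite mxE scale0r.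
  rewrite pactD [p * 'X in X in X + _]mulrC pactXM -[c%:P in LHS]mulr1 pactCM pact1.
  rewrite rmorphD rmorphM /= horner_mx_X horner_mx_C mulmxDr cvD IH step.
  by rewrite mul_mx_scalar cvZ -mulmxA.
have [c ->] := hx y; have := key (char_poly A) (\row_i c i).
rewrite Cayley_Hamilton mulmx0 => e; have -> : \sum_i c i *: x i = cv (\row_i c i).
  by apply: eq_bigr => i _; rewrite mxE.
by rewrite e /cv big1 // => i _; rewrite mxE scale0r.
Qed.
End PolyAction.

Lemma pact_comp (R : comNzRingType) (X : lmodType R) (phi psi : {linear X -> X}) (r q : {poly R}) y :
  (forall z, psi z = pact phi r z) -> pact phi (q \Po r) y = pact psi q y.
Proof.
move=> h; elim/poly_ind: q y => [|q c IH] y; first by rewrite comp_poly0 !pact0.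
rewrite comp_polyD comp_polyC comp_polyM comp_polyX !pactD -[c%:P]mulr1 !pactCM !pact1.
by rewrite !pactM IH pactX h.
Qed.

Lemma bezout_exp (R : comNzRingType) (x y u v : R) n : u * x + v * y = 1 ->
  exists u' v', u' * x ^+ n + v' * y ^+ n = 1.
Proof.
move=> h.
have step (z w : R) : (exists u v, u * z + v * w = 1) -> forall j, exists u v, u * z ^+ j + v * w = 1.
  move=> [s [t e]]; elim=> [|j [s' [t' e']]]; first by exists 1, 0; rewrite mulr1 mul0r addr0.
  exists (s * s'), (s * z * t' + t); rewrite exprS.
  suff -> : s * s' * (z * z ^+ j) + (s * z * t' + t) * w =
    s * z * (s' * z ^+ j + t' * w) + t * w by rewrite e' mulr1.
  by ring.
have [u1 [v1 e1]] := step x y (ex_intro _ u (ex_intro _ v h)) n.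
have [|v2 [u2 e2]] := step y (x ^+ n) _ n.
  by exists v1, u1; rewrite addrC.
by exists u2, v2; rewrite addrC.
Qed.

(** * Idempotents and automorphisms of finitely generated modules over a henselian ring *)

Section Fitting.
Variables (R : comNzRingType) (m : idealr R).
Hypotheses (nR : noetherian R) (hm : henselian m).
Variables (X : lmodType R).
Hypothesis fX : fin_gen X.
Let lR : local_with m := hm.1.
Local Notation res := (@to_residue R m).

Lemma gens_succ : exists n (x : 'I_n.+1 -> X),
  forall y, exists c : 'I_n.+1 -> R, y = \sum_i c i *: x i.
Proof.
have [n [x hx]] := fX.
exists n, (fun i => if unlift ord0 i is Some j then x j else 0) => y.
have [c ->] := hx y; exists (fun i => if unlift ord0 i is Some j then c j else 0).
rewrite big_ord_recl unlift_none scaler0 add0r; apply: eq_bigr => i _.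
by rewrite liftK.
Qed.

Lemma in_mMN (t : X) : in_mM m t -> in_mM m (- t).
Proof.
move=> [n [c [y [cm ->]]]]; exists n, c, (fun i => - y i); split=> //.
by rewrite -sumrN; apply: eq_bigr => i _; rewrite scalerN.
Qed.

Lemma pact_mM (phi : {linear X -> X}) (p : {poly R}) y : (forall i, p`_i \in m) -> in_mM m (pact phi p y).
Proof. by move=> pm; exists (size p), (fun i => p`_i), (fun i => iter i phi y). Qed.

Lemma surj_mod (T : {linear X -> X}) :
  (forall y, exists z t, in_mM m t /\ y = T z + t) -> surjective_map T.
Proof.
move=> h; apply: (@nakayama R m nR lR X (img_sub T) fX) => y.
by have [z [t [tm ->]]] := h y; exists (T z), t; split=> //; exists z.
Qed.

Lemma res_unit a : res a != 0 -> exists c, a * c = 1.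
Proof.
by move=> h; apply: (local_unit nR lR); apply: contra h => /to_residue_eq0 ->.
Qed.

(* With f the characteristic polynomial of phi and f = 'X^a u mod m, u(0) a
   unit, p is 0 modulo 'X^a and 1 modulo u, up to m. *)
Lemma almost_idempotent (phi : {linear X -> X}) : exists p1 : {poly R},
  let p := 'X * p1 in
  (forall y, in_mM m (pact phi p (pact phi p y) - pact phi p y)) /\
  forall (M : lmodType R) (mu : {linear M -> X}), (forall x, phi (mu x) = mu x) ->
    (exists z, mu z <> 0) -> res p.[1] = 1.
Proof.
have [n [x hx]] := gens_succ.
have /choice[A' hA'] := fun i => hx (phi (x i)).
pose A : 'M[R]_n.+1 := \matrix_(i, j) A' i j.
have hA i : phi (x i) = \sum_j A i j *: x j.
  by rewrite hA'; apply: eq_bigr => j _; rewrite mxE.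
have f0 := pact_char hA hx; set f := char_poly A in f0.
have exa : exists i, f`_i \notin m.
  exists (size f).-1; rewrite -/(lead_coef f) (monicP (char_poly_monic A)).
  by rewrite idealr1.
have [a am amin] := ex_minnP exa.
pose low := take_poly a f; pose u := drop_poly a f.
have lowm i : low`_i \in m.
  rewrite coef_take_poly; case: ltnP => h; last exact: rpred0.
  by apply: contraLR h => h; rewrite -leqNgt; apply: amin.
have fE : f = low + u * 'X^a by rewrite poly_take_drop.
have [c fc] := local_unit nR lR am.
have u0 : u`_0 = f`_a by rewrite coef_drop_poly add0n.
(* Chosen so that [1 - w] is [u] divided by its constant term, while [w] is a multiple of ['X]. *)
pose v := - c%:P * drop_poly 1 u; pose w := 'X * v.
have w1 : 1 - w = c%:P * u.
  rewrite /w /v -[u in RHS](poly_take_drop 1) expr1.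
  have -> : take_poly 1 u = (f`_a)%:P.
    apply/polyP => i; rewrite coef_take_poly coefC ltnS leqn0.
    by case: eqP => // ->.
  have cf : c%:P * (f`_a)%:P = 1 :> {poly R} by rewrite -polyCM mulrC fc.
  by rewrite mulrDr cf; ring.
pose p1 := v * w ^+ a.
have pE : 'X * p1 = w ^+ a.+1 by rewrite exprS /p1 mulrA.
pose s := \sum_(i < a.+1) w ^+ i.
have ps : 1 - 'X * p1 = c%:P * u * s.
  by rewrite pE -w1 -[1 in LHS](expr1n _ a.+1) subrXX; congr (_ * _);
    apply: eq_bigr => i _; rewrite expr1n mul1r.
pose r := 'X * v ^+ a.+1 * c%:P * s.
have pp : 'X * p1 * ('X * p1) - 'X * p1 = r * (low - f).
  have -> : 'X * p1 * ('X * p1) - 'X * p1 = - ('X * p1 * (1 - 'X * p1)) by ring.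
  by rewrite ps pE /w exprMn fE /r exprSr; ring.
exists p1; split=> [y|M mu hmu [z z0]].
  have -> : pact phi ('X * p1) (pact phi ('X * p1) y) - pact phi ('X * p1) y =
      pact phi (low * r) y.
    have -> : low * r = r * (low - f) + r * f by ring.
    rewrite pactD [pact phi (r * f) y]pactM f0 pact_zero addr0 -pp.
    by rewrite [RHS]pactD [X in _ = _ + X]pactN [X in _ = X + _]pactM.
  by rewrite pactM; apply: pact_mM.
rewrite pE /w horner_exp.
have w11 : w.[1] = 1 - c * u.[1].
  by rewrite -[w](subKr 1) w1 hornerD hornerN hornerM !hornerC.
(* If [u(1)] were a unit, so would be [f(1)], as [low] has coefficients in [m]; but [f(1)] kills the
   nonzero element [mu z]. *)
have um : u.[1] \in m.
  apply: contrapT => /negP um; apply: z0.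
  have fm : f.[1] *: mu z = 0 by rewrite -(@pact_eigen _ _ phi) ?scale1r ?f0 // hmu.
  have [|c' hc'] := @local_unit R m nR lR f.[1].
    rewrite fE hornerD hornerM hornerXn expr1n mulr1.
    apply: contra um => um; rewrite -[u.[1]](addKr low.[1]) rpredD // rpredN.
    rewrite horner_coef; apply: rpred_sum => i _; rewrite expr1n mulr1; exact: lowm.
  by rewrite -[mu z]scale1r -hc' mulrC -scalerA fm scaler0.
rewrite -/w w11 rmorphXn rmorphB rmorph1 /=.
have /to_residue_eq0 -> : c * u.[1] \in m by apply: idealMr.
by rewrite subr0 expr1n.
Qed.

(** A matrix over [m] expresses [psi^2 - psi], so its characteristic polynomial [q] reduces to a
    power of [t]; then [q(t^2 - t)] annihilates [psi] and reduces to the same power of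
    [t (t - 1)]. *)
Lemma in_mM_factor (psi : {linear X -> X}) :
  (forall y, in_mM m (psi (psi y) - psi y)) ->
  exists n (g h : {poly R}), [/\ forall y, pact psi (g * h) y = 0,
    map_poly res g = ('X - 1) ^+ n.+1 & map_poly res h = 'X^(n.+1)].
Proof.
move=> hpsi; have [n [x hx]] := gens_succ.
pose eta : {linear X -> X} := (psi \o psi) \- psi.
have /choice[B' hB'] := fun i => in_mMP hx (hpsi (x i)).
pose B : 'M[R]_n.+1 := \matrix_(i, j) B' i j.
have hB i : eta (x i) = \sum_j B i j *: x j.
  by rewrite [LHS](hB' i).2; apply: eq_bigr => j _; rewrite mxE.
have q0 := pact_char hB hx; set q := char_poly B in q0.
pose r : {poly R} := 'X^2 - 'X.
have F0 y : pact psi (q \Po r) y = 0.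
  rewrite (@pact_comp _ _ psi eta) ?q0 // => z.
  by rewrite /r pactD pactN expr2 pactM !pactX.
have sr : size r = 3.
  by rewrite /r size_polyDl ?size_polyXn // size_polyN size_polyX.
have rm : r \is monic.
  by rewrite monicE lead_coefDl ?lead_coefXn // size_polyN size_polyX size_polyXn.
have Fm : q \Po r \is monic by apply: monic_comp; rewrite ?char_poly_monic ?sr.
have qb : map_poly res q = 'X^(n.+1).
  rewrite map_char_poly; have -> : map_mx res B = 0.
    by apply/matrixP=> i j; rewrite !mxE; apply/to_residue_eq0; apply: (hB' i).1.
  by rewrite /char_poly /char_poly_mx map_mx0 subr0 det_scalar.
have Fb : map_poly res (q \Po r) = ('X - 1) ^+ n.+1 * 'X^(n.+1).
  rewrite map_comp_poly qb comp_Xn_poly -exprMn; congr (_ ^+ _).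
  by rewrite rmorphB /= map_polyXn map_polyX mulrBl mul1r expr2.
have [g [h [e gb hb]]] := hensel_factor nR hm Fm Fb.
by exists n, g, h; split=> // y; rewrite -e.
Qed.

(** Surjectivity suffices. The part of [psi] belonging to the eigenvalue 0 modulo [m] is cut out by
    an idempotent killing [mu]; as this is zero, [psi], which factors through [phi], is onto modulo
    [m]. *)
Lemma fitting (M : lmodType R) (mu : {linear M -> X}) (phi : {linear X -> X}) :
  (forall e : {linear X -> X}, (forall x, e (e x) = e x) -> (forall z, e (mu z) = 0) ->
     forall x, e x = 0) ->
  (forall z, phi (mu z) = mu z) -> bijective phi.
Proof.
move=> idem hmu.
suff phis : surjective_map phi.
  have [g [h1 h2]] := bij_inv (surj_inj nR fX phis) phis.
  by exists g.
(* If [mu] is zero, the identity is such an idempotent and [X] is zero. *)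
have [[z0 z00]|nz] := pselect (exists z, mu z <> 0); last first.
  have id0 := idem idfun (fun x => erefl).
  move=> y; exists 0; rewrite linear0; apply/esym/id0 => z.
  by apply: contrapT => h; apply: nz; exists z.
have [p1 [hp /(_ M mu hmu (ex_intro _ z0 z00)) lam1]] := almost_idempotent phi.
pose psi : {linear X -> X} := mklin (pact_lin phi ('X * p1)).
pose lam := ('X * p1).[1].
have psimu z : psi (mu z) = lam *: mu z.
  by rewrite mklinE (@pact_eigen _ _ phi _ 1) // hmu scale1r.
have [n [g [h [gh gb hb]]]] := @in_mM_factor psi hp.
have [|u [v uv]] := @bezout_exp {poly R} 'X ('X - 1) 1 (-1) n.+1.
  by ring.
(* The Bezout relation holds for the powers of ['X] and ['X - 1] to which [h] and [g] reduce; so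
   [th] is known to be 1 only modulo [m], which still makes its action bijective. *)
pose th := u * h + v * g.
have thb : map_poly res th = 1.
  have <- : map_poly res (u * 'X^(n.+1) + v * ('X - 1) ^+ n.+1) = 1 by rewrite uv rmorph1.
  by rewrite !rmorphD !rmorphM /= gb hb map_polyXn rmorphXn rmorphB rmorph1 /= map_polyX.
have thm i : (th - 1)`_i \in m.
  by apply/to_residue_eq0; rewrite -coef_map rmorphB rmorph1 /= thb subrr coef0.
pose T : {linear X -> X} := mklin (pact_lin psi th).
have Ts : surjective_map T.
  apply: surj_mod => y; exists y, (- pact psi (th - 1) y); split.
    by apply: in_mMN; apply: pact_mM.
  by rewrite mklinE -pactN opprB -pactD addrC subrK pact1.
have Ti := surj_inj nR fX Ts.
have [T' [TK KT]] := bij_inv Ti Ts.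
pose e : {linear X -> X} := T' \o mklin (pact_lin psi (v * g)).
have Te y : T (e y) = pact psi (v * g) y by apply: KT.
have Tp p y : T (pact psi p y) = pact psi p (T y).
  by rewrite !mklinE -!pactM mulrC.
have ee y : e (e y) = e y.
  apply: (Ti); apply: (Ti); rewrite !Te Tp Te -pactM mklinE -pactM.
  have -> : th * (v * g) = v * g * (v * g) + (u * v) * (g * h) by rewrite /th; ring.
  by rewrite pactD [pact psi (_ * (g * h)) y]pactM gh pact_zero addr0.
(* On the image of [mu], [psi] acts by [lam], which is 1 modulo [m], so [e] acts by some [ka] in
   [m]; as [e] is idempotent and [1 - ka] is a unit, this action is zero. *)
have em z : e (mu z) = 0.
  have thl : res th.[lam] = 1.
    by rewrite -horner_map thb hornerC.
  have [t ht] : exists t, th.[lam] * t = 1.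
    by apply: res_unit; rewrite thl oner_neq0.
  pose ka := t * (v * g).[lam].
  have ka_m : ka \in m.
    apply: idealMr; apply/to_residue_eq0.
    rewrite -horner_map rmorphM /= gb hornerM horner_exp !hornerE.
    by rewrite -[to_residue m lam]/(res ('X * p1).[1]) lam1 subrr expr0n mulr0.
  have eka : e (mu z) = ka *: mu z.
    apply: Ti; rewrite Te (pact_eigen _ (psimu z)) linearZ_LR mklinE (pact_eigen _ (psimu z)).
    by rewrite scalerA [ka * _]mulrC mulrA ht mul1r.
  have [c hc] : exists c, (1 - ka) * c = 1.
    apply: res_unit; rewrite rmorphB rmorph1 /=.
    by have /to_residue_eq0 -> := ka_m; rewrite subr0 oner_neq0.
  rewrite eka -[ka *: _]scale1r -hc mulrC -scalerA scalerBl scale1r -{1}eka.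
  by rewrite -[e (mu z)]ee eka linearZ_LR eka subrr scaler0.
have e0 := idem e ee em.
(* With [e = 0], [T] is the action of [u h], and [h] is a positive power of [t] modulo [m]; one
   factor [t] acts as [psi]. *)
apply: surj_mod => y; have [y' <-] := Ts y.
pose w := pact psi u y'.
have key : phi (pact phi p1 (pact psi 'X^n w)) = pact psi 'X^(n.+1) w.
  by rewrite exprS pactM pactX mklinE pactXM.
exists (pact phi p1 (pact psi 'X^n w)), (pact psi (h - 'X^(n.+1)) w); split.
  apply: pact_mM => i; apply/to_residue_eq0.
  by rewrite -coef_map rmorphB /= hb map_polyXn subrr coef0.
rewrite key pactD pactN addrC subrK /w -pactM mklinE /th pactD -Te e0 linear0 addr0.
by rewrite mulrC.
Qed.
End Fitting.

(* Among the idempotents e of X with e mu = 0, one with maximal image is split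
   off; on the complementary summand no such idempotent survives. *)
Lemma envelope_of_preenvelope (R : comNzRingType) (m : idealr R) (d : nat)
    (M X : lmodType R) (mu : {linear M -> X}) :
  noetherian R -> henselian m -> MCM_preenvelope m d mu ->
  exists (X1 : lmodType R) (mu1 : {linear M -> X1}), MCM_envelope m d mu1.
Proof.
move=> nR hm [[fX dX] pm].
pose F (K : submod X) := exists e : {linear X -> X}, [/\ forall x, e (e x) = e x,
  forall z, e (mu z) = 0 & forall y, K y <-> exists x, e x = y].
have F0 : F (img_sub (\0 : {linear X -> X})) by exists \0.
have [K [[e [ee emu hK]] Kmax]] := max_submod nR fX F0.
pose i : {linear Ker e -> X} := ker_incl e.
have ii : injective i := @sm_incl_inj _ _ (ker_sub e).
have ei x : e (i x) = 0 by apply/(sm_inclP (ker_sub e)); exists x.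
have [|p hp] := @factor_inj _ _ _ _ i (idfun \- e : {linear _ -> _}) ii.
  by move=> x; apply/(sm_inclP (ker_sub e)); rewrite -[sm_car _ _]/(e _ = 0) linearB ee subrr.
have pi : cancel i p by move=> x; apply: ii; rewrite hp /= ei subr0.
have [|mu1 hmu1] := @factor_inj _ _ _ _ i mu ii.
  by move=> x; apply/(sm_inclP (ker_sub e))/emu.
exists (Ker e), mu1; split; first split.
- split; first by apply: fg_surj fX; move=> y; exists (i y); apply: pi.
  apply/depth_geP => j jd; apply: (ext_retractR pi).
  by move/depth_geP: dX; apply.
- move=> X' mu' mX'; have [phi hphi] := pm X' mu' mX'.
  by exists (phi \o i) => x; rewrite hphi -[RHS]/(phi (i (mu1 x))) hmu1.
move=> phi hphi; apply: (fitting nR hm _ _ hphi).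
  by apply: fg_surj fX; move=> y; exists (i y); apply: pi.
move=> e' e'e' e'mu x; apply: (lin_inj0 ii).
(* The idempotent [e] enlarged by [e'] on the complement [Ker e]; maximality of the image of [e]
   forces [e'] to be zero. *)
pose e2 : {linear X -> X} := e \+ (i \o e' \o p).
have pe y : p (e y) = 0 by apply: (lin_inj0 ii); rewrite hp /= ee subrr.
have e2e y : e2 (e y) = e y by rewrite /e2 /= pe !linear0 addr0 ee.
have e2i y : e2 (i y) = i (e' y) by rewrite /e2 /= ei add0r pi.
have F2 : F (img_sub e2).
  exists e2; split=> // y; first by rewrite linearD e2e e2i e'e'.
  by rewrite -hmu1 e2i e'mu linear0.
have KS y : K y -> img_sub e2 y by move=> /hK[z <-]; exists (e z).
have /hK[z ez] : K (i (e' x)) by apply: (Kmax _ F2 KS); exists (i x).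
by rewrite -ez -ee ez ei.
Qed.

Theorem theoremA (R : comNzRingType) (m : idealr R) (d : nat)
    (Omega : lmodType R)
    (R_noetherian : noetherian R)
    (R_local : local_with m)
    (R_dim : krull_dim R d)
    (R_CM : depth m R^o = Some d)
    (Omega_dualizing : dualizing Omega) :
  [/\ (forall M : lmodType R, fin_gen M ->
         exists (X : lmodType R) (mu : {linear M -> X}),
           special_MCM_preenvelope m d mu),
      (henselian m ->
         forall M : lmodType R, fin_gen M ->
         exists (X : lmodType R) (mu : {linear M -> X}), MCM_envelope m d mu)
    & (forall (M X : lmodType R) (mu : {linear M -> X}), fin_gen M ->
         (special_MCM_preenvelope m d mu ->
            finite_injdim (LinHom (Cokernel mu) Omega)) /\
         (MCM_envelope m d mu ->
            special_MCM_preenvelope m d mu /\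
            finite_injdim (LinHom (Cokernel mu) Omega)))].
Proof.
have sp_ex := special_preenvelope_ex R_noetherian R_local R_CM Omega_dualizing.
have sp_fid (M X : lmodType R) (mu : {linear M -> X}) :
    special_MCM_preenvelope m d mu -> finite_injdim (LinHom (Cokernel mu) Omega).
  move=> sp; have [pmu _] := sp.
  have [n fC] := special_fid R_noetherian R_local R_CM Omega_dualizing pmu sp.
  exact: fid_finite_injdim fC.
split=> [||M X mu _] //.
- move=> hm M fM; have [X [mu [pmu _]]] := sp_ex M fM.
  exact: envelope_of_preenvelope R_noetherian hm pmu.
- split=> [|env]; first exact: sp_fid.
  by have sp := envelope_special env; split=> //; apply: sp_fid.
Qed.
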